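(* Let $d\ge 2$, let $Q$ be a quadratic form on $\mathbb{R}^d$, let $v\in\mathbb{R}^d$, $\rho\in\mathbb{R}$, and let $P(x)=Q(x)+\langle v,x\rangle-\rho$. Then there exists an exceptional set $\mathcal{E}=\mathcal{E}(Q,v,\rho)\subseteq\mathbb{S}^{d-1}\times\mathbb{S}^{d-1}$ of measure zero with respect to the surface measure such that the following holds. Let $u_1,u_2\in\mathbb{S}^{d-1}$ be distinct directions (that is, $u_1\neq\pm u_2$) with $Q(u_1)\neq 0$, $Q(u_2)\neq0$ and $(u_1,u_2)\notin\mathcal{E}$. Let $\mu$ be a finite signed Borel measure on $\mathbb{R}^d$ and assume that $u=\widehat{\mu}$ solves the partial differential equation $P(D)u=0$ (in the sense of distributions). If $u$ vanishes on the hyperplanes $H_{u_1}$ and $H_{u_2}$, then $u=0$.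
   Context: For a finite Borel measure $\mu$ on $\mathbb{R}^d$, its Fourier transform is $\widehat{\mu}(\xi)=\int_{\mathbb{R}^d}e^{i\langle x,\xi\rangle}\,d\mu(x)$, $\xi\in\mathbb{R}^d$. $P(D)$ is the constant-coefficient partial differential operator obtained from the polynomial $P$ by replacing each variable $x_j$ by $\frac1i\frac{\partial}{\partial x_j}$. For $u\in\mathbb{R}^d$ with $|u|=1$, $H_u=\{x\in\mathbb{R}^d:\langle x,u\rangle=0\}$. $\mathbb{S}^{d-1}$ is the unit sphere of $\mathbb{R}^d$. *)

(* Defs.v *)
From HB Require Import structures.
From mathcomp Require Import all_boot all_order all_algebra.
From mathcomp Require mpoly.
(* The notations of mpoly clash with those of MathComp-Analysis. *)
Import -(notations) mpoly.
From mathcomp Require Import all_classical all_reals all_analysis.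
From mathcomp Require Import measurable_realfun complex.

Set Implicit Arguments.
Unset Strict Implicit.
Unset Printing Implicit Defensive.

Import Order.TTheory GRing.Theory Num.Theory.
Import numFieldNormedType.Exports.

Local Open Scope classical_set_scope.
Local Open Scope ring_scope.

(* 'rV[R]_n with its Borel sigma-algebra. *)
Notation borel_rV R n := (g_sigma_algebraType (@open 'rV[R]_n)).

Section borel.
Context (R : realType) (n : nat).

Lemma open_measurable_rV (U : set 'rV[R]_n) :
  open U -> measurable (U : set (borel_rV R n)).
Proof. by move=> oU; apply: sub_sigma_algebra. Qed.

Lemma continuous_measurable_rV (f : 'rV[R]_n -> R) :
  continuous f -> measurable_fun [set: borel_rV R n] f.
Proof.
move=> /continuousP cf.
apply: (measurability _ (RGenOpens.measurableE R)) => _ [_ [a [b ->] <-]].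
by rewrite setTI; apply: open_measurable_rV; apply: cf; exact: interval_open.
Qed.

Lemma measurable_coord_rV (i : 'I_n) :
  measurable_fun [set: borel_rV R n] (fun x : 'rV[R]_n => x 0 i).
Proof. by apply: continuous_measurable_rV => x; exact: coord_continuous. Qed.

(* Every open set is a union of balls with rational centre and radius. *)
Lemma open_rat_balls (U : set 'rV[R]_n) : open U ->
  U = \bigcup_(c in [set c : 'rV[rat]_n * rat |
        @ball R 'rV[R]_n (map_mx ratr c.1) (ratr c.2) `<=` U])
      @ball R 'rV[R]_n (map_mx ratr c.1) (ratr c.2).
Proof.
move=> oU; apply/seteqP; split=> [x Ux|x [c /= cU]]; last exact: cU.
have /nbhs_ballP[e /= e0 xeU] : nbhs x U by exact: open_nbhs_nbhs.
have [r] := rat_in_itvoo (divr_gt0 e0 (ltr0n _ 2)).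
rewrite in_itv/= => /andP[r0 re].
have q_ (i : 'I_n) : {q : rat | `|ratr q - x 0 i| < ratr r}.
  apply: cid; have /rat_in_itvoo[q] : x 0 i - ratr r < x 0 i + ratr r.
    by rewrite ltrD2l gtrN.
  by rewrite in_itv/= => qx; exists q; rewrite ltr_distl.
pose q : 'rV[rat]_n := \row_i sval (q_ i).
have qx : @ball R 'rV[R]_n (map_mx ratr q) (ratr r) x.
  by split=> // i j; rewrite ord1 !mxE /ball/=; exact: svalP (q_ j).
exists (q, r) => //= y qy; apply: xeU; rewrite [e]splitr.
have le_er : ratr r <= e / 2 by exact: ltW.
apply: (@ball_triangle R 'rV[R]_n (map_mx ratr q)); last exact: le_ball qy.
exact/(le_ball le_er)/ball_sym.
Qed.

Lemma measurable_fun_rV d (T : measurableType d) (f : T -> 'rV[R]_n) :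
  (forall i, measurable_fun [set: T] (fun t => f t 0 i)) ->
  measurable_fun [set: T] (f : T -> borel_rV R n).
Proof.
move=> mf; apply: (@measurability _ _ _ (borel_rV R n) _ _ (@open 'rV[R]_n)) => // _ [U oU <-].
rewrite setTI (open_rat_balls oU) preimage_bigcup.
rewrite bigcup_mkcond; apply: countable_bigcupT_measurable => [|c].
  exact: countableP.
case: ifP => // _.
have [c0|c0] := ltP 0 (ratr c.2 : R); last first.
  rewrite [X in measurable X](_ : _ = set0)//.
  by apply/seteqP; split => // t [/lt_le_trans/(_ c0)]; rewrite ltxx.
rewrite [X in measurable X](_ : _ =
    \bigcap_(i in [set: 'I_n]) [set t | `|ratr (c.1 0 i) - f t 0 i| < ratr c.2]).
  apply: fin_bigcap_measurable => // i _.
  rewrite [X in measurable X](_ : _ =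
    (fun t => f t 0 i) @^-1` @ball R R^o (ratr (c.1 0 i)) (ratr c.2)) //.
  rewrite -[X in measurable X]setTI; apply: (mf i) => //.
  by apply: open_measurable; exact: (@ball_open R R^o).
apply/seteqP; split=> t /=.
  by move=> [_ h] i _; have := h 0 i; rewrite mxE.
by move=> h; split=> // i j; rewrite ord1 mxE; exact: h.
Qed.

End borel.

Section lebesgue.
Context (R : realType).

Definition cons_rV n (p : measurableTypeR R * borel_rV R n) : borel_rV R n.+1 :=
  row_mx (p.1%:M : 'rV[R]_1) (p.2 : 'rV[R]_n).

Definition uncons_rV n (x : borel_rV R n.+1) : measurableTypeR R * borel_rV R n :=
  ((x : 'rV[R]_n.+1) 0 0, rsubmx (x : 'rV[R]_(1 + n))).

Lemma cons_rVK n : cancel (@cons_rV n) (@uncons_rV n).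
Proof.
move=> [t x]; rewrite /uncons_rV /cons_rV row_mxKr; congr pair.
rewrite (_ : 0 = lshift n 0 :> 'I_(1 + n)); last exact: val_inj.
by rewrite (row_mxEl (t%:M : 'rV_1)) mxE.
Qed.

Lemma measurable_cons_rV n : measurable_fun setT (@cons_rV n).
Proof.
apply: measurable_fun_rV => i; case: (splitP (i : 'I_(1 + n))) => j ij.
  rewrite (_ : (fun _ => _) = fst); first exact: measurable_fst.
  apply/funext => p; rewrite (_ : i = lshift n j); last exact: val_inj.
  by rewrite (row_mxEl (p.1%:M : 'rV_1)) mxE ord1.
rewrite (_ : (fun _ => _) = (fun x : 'rV[R]_n => x 0 j) \o snd).
  exact: measurableT_comp (measurable_coord_rV j) measurable_snd.
apply/funext => p; rewrite (_ : i = rshift 1 j); last exact: val_inj.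
by rewrite (row_mxEr (p.1%:M : 'rV_1)).
Qed.

Lemma measurable_uncons_rV n : measurable_fun setT (@uncons_rV n).
Proof.
apply: measurable_fun_pair; first exact: measurable_coord_rV.
apply: measurable_fun_rV => i.
rewrite (_ : (fun _ => _) = fun x : 'rV[R]_n.+1 => x 0 (rshift 1 i)).
  exact: (measurable_coord_rV (rshift 1 i)).
by apply/funext => x; rewrite mxE.
Qed.

Section lebesgue_step.
Local Open Scope ereal_scope.
Context n (m : {sigma_finite_measure set (borel_rV R n) -> \bar R}).

Definition lebesgue_cons : set (borel_rV R n.+1) -> \bar R :=
  pushforward (@lebesgue_measure R \x m) (@cons_rV n).

Let mcons (A : set (borel_rV R n.+1)) :
  measurable A -> measurable (@cons_rV n @^-1` A).
Proof. by move=> mA; rewrite -[X in measurable X]setTI; exact: measurable_cons_rV. Qed.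

Let lebesgue_cons0 : lebesgue_cons set0 = 0.
Proof. by rewrite /lebesgue_cons /pushforward preimage_set0 measure0. Qed.

Let lebesgue_cons_ge0 A : 0 <= lebesgue_cons A.
Proof. by rewrite /lebesgue_cons /pushforward measure_ge0. Qed.

Let lebesgue_cons_sigma_additive : semi_sigma_additive lebesgue_cons.
Proof.
move=> F mF tF mUF; rewrite /lebesgue_cons /pushforward preimage_bigcup.
apply: measure_semi_sigma_additive.
- by move=> k; exact: mcons.
- apply/trivIsetP => i j _ _ ij; rewrite -preimage_setI.
  by move/trivIsetP : tF => /(_ _ _ _ _ ij) ->//; rewrite preimage_set0.
- by rewrite -preimage_bigcup; exact: mcons.
Qed.

HB.instance Definition _ := isMeasure.Build _ _ _ lebesgue_cons
  lebesgue_cons0 lebesgue_cons_ge0 lebesgue_cons_sigma_additive.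

Let lebesgue_cons_sigma_finite : sigma_finite setT lebesgue_cons.
Proof.
have /sigma_finiteP[F [TF ndF Foo]] := sigma_finiteT (@lebesgue_measure R).
have /sigma_finiteP[G [TG ndG Goo]] := sigma_finiteT m.
exists (fun k => @uncons_rV n @^-1` (F k `*` G k)).
  apply/seteqP; split=> // x _.
  have [[i _ Fi] [j _ Gj]] : (\bigcup_k F k) (uncons_rV x).1 /\
      (\bigcup_k G k) (uncons_rV x).2 by rewrite -TF -TG.
  exists (maxn i j) => //; split.
  - by move: Fi; exact/subsetPset/ndF/leq_maxl.
  - by move: Gj; exact/subsetPset/ndG/leq_maxr.
move=> k; have [mFk Fkoo] := Foo k; have [mGk Gkoo] := Goo k; split.
  rewrite -[X in measurable X]setTI.
  by apply: measurable_uncons_rV => //; exact: measurableX.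
rewrite /lebesgue_cons /pushforward -comp_preimage.
rewrite (_ : _ \o _ = id); last exact/funext/cons_rVK.
by rewrite preimage_id product_measure1E// lte_mul_pinfty// ge0_fin_numE.
Qed.

HB.instance Definition _ := Measure_isSigmaFinite.Build _ _ _ lebesgue_cons
  lebesgue_cons_sigma_finite.

End lebesgue_step.

Fixpoint lebesgue_rV n : {sigma_finite_measure set (borel_rV R n) -> \bar R} :=
  match n with
  | 0 => \d_((0 : 'rV[R]_0) : borel_rV R 0)
  | k.+1 => lebesgue_cons (lebesgue_rV k)
  end.

End lebesgue.

Section euclidean.
Context (R : realType) (d : nat).

Definition dotv (x y : 'rV[R]_d) : R := \sum_i x 0 i * y 0 i.

(* The norm `|x| of the library on 'rV[R]_d is the maximum norm. *)
Definition enorm (x : 'rV[R]_d) : R := Num.sqrt (dotv x x).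

Definition sphere : set 'rV[R]_d := [set x | enorm x = 1].

Definition hyperplane (u : 'rV[R]_d) : set 'rV[R]_d := [set x | dotv x u = 0].

Definition normalize (x : 'rV[R]_d) : 'rV[R]_d := (enorm x)^-1 *: x.

Definition punctured_ball : set 'rV[R]_d := [set x | 0 < enorm x <= 1].

Lemma measurable_enorm : measurable_fun [set: borel_rV R d] enorm.
Proof.
apply: (measurableT_comp (f := @Num.sqrt R)).
  by apply: continuous_measurable_fun; exact: sqrt_continuous.
apply: measurable_sum => i.
by apply: measurable_funM; exact: measurable_coord_rV.
Qed.

Lemma measurable_normalize :
  measurable_fun [set: borel_rV R d] (normalize : _ -> borel_rV R d).
Proof.
apply: measurable_fun_rV => i.
rewrite (_ : (fun _ => _) = fun x => (enorm x)^-1 * x 0 i).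
  apply: measurable_funM; last exact: measurable_coord_rV.
  apply: (measurableT_comp (f := @GRing.inv R)); last exact: measurable_enorm.
  rewrite -(setvU [set 0]); apply/measurable_funU => //; first exact: measurableC.
  split; last exact: measurable_fun_set1.
  apply: open_continuous_measurable_fun; first exact/closed_openC/closed_eq.
  by move=> x /set_mem/eqP x0; exact: inv_continuous.
by apply/funext => x; rewrite mxE.
Qed.

Lemma measurable_punctured_ball :
  measurable (punctured_ball : set (borel_rV R d)).
Proof.
rewrite [X in measurable X](_ : _ = enorm @^-1` `]0, 1]).
  by rewrite -[X in measurable X]setTI; exact: measurable_enorm.
by apply/seteqP; split=> x /=; rewrite in_itv.
Qed.

(* Surface measure of the unit sphere, in polar coordinates:
   sigma A = d * lebesgue {t *: x | 0 < t <= 1, x in A} for A included in the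
   sphere; it is extended by 0 to the whole space. *)
Definition surface_measure (A : set (borel_rV R d)) : \bar R :=
  (d%:R%:E * lebesgue_rV R d (punctured_ball `&` normalize @^-1` A))%E.

Let surface_measure0 : surface_measure set0 = 0%E.
Proof. by rewrite /surface_measure preimage_set0 setI0 measure0 mule0. Qed.

Let surface_measure_ge0 A : (0 <= surface_measure A)%E.
Proof. by rewrite /surface_measure mule_ge0// lee_fin. Qed.

Let surface_measure_sigma_additive : semi_sigma_additive surface_measure.
Proof.
move=> F mF tF mUF.
have mcone A : measurable (A : set (borel_rV R d)) ->
    measurable (punctured_ball `&` normalize @^-1` A : set (borel_rV R d)).
  move=> mA; apply: measurableI; first exact: measurable_punctured_ball.
  by rewrite -[X in measurable X]setTI; exact: measurable_normalize.
rewrite (_ : (fun _ => _) = (fun n => d%:R%:E * (\sum_(0 <= i < n)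
    lebesgue_rV R d (punctured_ball `&` normalize @^-1` F i)))%E); last first.
  by apply/funext => n; rewrite ge0_sume_distrr.
rewrite /surface_measure; apply: cvgeZl => //.
rewrite preimage_bigcup setI_bigcupr.
apply: measure_semi_sigma_additive.
- by move=> n; exact: mcone.
- apply/trivIsetP => i j _ _ ij; apply/seteqP; split=> // x [[_ Fi] [_ Fj]].
  have FF0 : F i `&` F j = set0 by move/trivIsetP : tF; exact.
  by have : (F i `&` F j) (normalize x) by []; rewrite FF0.
- by rewrite -setI_bigcupr -preimage_bigcup; exact: mcone.
Qed.

HB.instance Definition _ := isMeasure.Build _ _ _ surface_measure
  surface_measure0 surface_measure_ge0 surface_measure_sigma_additive.

End euclidean.
Arguments sphere : clear implicits.
Arguments surface_measure : clear implicits.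

Section fourier.
Context (R : realType).
Local Open Scope complex_scope.

(* Extension of an integral from real-valued to complex-valued functions. *)
Definition complex_integral (T : Type) (I : (T -> R) -> R) (f : T -> R[i]) : R[i] :=
  I (fun x => complex.Re (f x)) +i* I (fun x => complex.Im (f x)).

Section charge.
Context dT (T : measurableType dT) (nu : {charge set T -> \bar R}).

Let PN := cid (Hahn_decomposition nu).
Let hahnP := svalP (cid (svalP PN)).

(* Integral against a signed measure, through its Jordan decomposition. *)
Definition charge_integral (f : T -> R) : R :=
  \int[jordan_pos hahnP]_x f x - \int[jordan_neg hahnP]_x f x.

End charge.

Definition expi (t : R) : R[i] := cos t +i* sin t.

Definition fourier d (mu : {charge set (borel_rV R d) -> \bar R})
    (xi : 'rV[R]_d) : R[i] :=
  complex_integral (charge_integral mu) (fun x => expi (dotv x xi)).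

End fourier.

Section distributions.
Context (R : realType) (d : nat).
Local Open Scope complex_scope.

Definition real_partial (j : 'I_d) (f : 'rV[R]_d -> R) : 'rV[R]_d -> R :=
  'D_(delta_mx 0 j) f.

Definition smooth (f : 'rV[R]_d -> R) : Prop :=
  forall s : seq 'I_d, let g := foldr real_partial f s in
    continuous g /\ forall j x, derivable g x (delta_mx 0 j).

Definition partial (j : 'I_d) (phi : 'rV[R]_d -> R[i]) : 'rV[R]_d -> R[i] :=
  fun x => real_partial j (fun y => complex.Re (phi y)) x
           +i* real_partial j (fun y => complex.Im (phi y)) x.

Definition test_function (phi : 'rV[R]_d -> R[i]) : Prop :=
  [/\ smooth (fun x => complex.Re (phi x)), smooth (fun x => complex.Im (phi x)) &
      compact (closure [set x | phi x != 0])].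

(* A distribution is represented by a functional of which only the values at
   test functions matter. *)
Definition distribution := ('rV[R]_d -> R[i]) -> R[i].

Definition regular_distribution (u : 'rV[R]_d -> R[i]) : distribution :=
  fun phi => complex_integral (Rintegral (lebesgue_rV R d) setT)
               (fun x => u x * phi x).

Definition dist_partial (j : 'I_d) (U : distribution) : distribution :=
  fun phi => - U (partial j phi).

(* D_j = (1/i) d/dx_j. The generic constant 'i of numClosedFieldType is not
   syntactically 0 +i* 1, hence the explicit form. *)
Definition dist_D (j : 'I_d) (U : distribution) : distribution :=
  fun phi => (0 +i* 1)^-1 * dist_partial j U phi.

(* D^m = D_1^(m_1) ... D_d^(m_d) *)
Definition dist_monomial (m : multinom d) (U : distribution) : distribution :=
  foldr (fun j => iter (m j) (dist_D j)) U (enum 'I_d).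

(* P(D) = sum_m P_m D^m *)
Definition dist_op (P : mpoly d R) (U : distribution) : distribution :=
  fun phi => \sum_(m <- msupp P) (mcoeff m P)%:C * dist_monomial m U phi.

Definition solves (P : mpoly d R) (u : 'rV[R]_d -> R[i]) : Prop :=
  forall phi, test_function phi -> dist_op P (regular_distribution u) phi = 0.

End distributions.

Definition evalv (R : realType) d (P : mpoly d R) (x : 'rV[R]_d) : R :=
  meval (fun i => x 0 i) P.

(* Homogeneous polynomials of degree 2 *)
Definition quadratic_form (R : realType) d (Q : mpoly d R) : Prop :=
  Q \is ishomog1 2 mdeg.

(* Q(x) + <v, x> - rho *)
Definition quadratic_poly (R : realType) d (Q : mpoly d R) (v : 'rV[R]_d)
    (rho : R) : mpoly d R :=
  Q + \sum_(i < d) v 0 i *: mpolyX R (mnm1 i) - mpolyC d rho.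

(* Main.v *)
Require Import Defs.
From mathcomp Require Import all_boot all_order all_algebra.
From mathcomp Require mpoly.
From mathcomp Require Import all_classical all_reals all_analysis.
From mathcomp Require Import complex.
From mathcomp Require Import measurable_realfun ring lra.

Import Order.TTheory GRing.Theory Num.Theory.
Import numFieldNormedType.Exports.
Local Open Scope classical_set_scope.
Local Open Scope ring_scope.

Set Implicit Arguments.
Unset Strict Implicit.
Unset Printing Implicit Defensive.

(** Write [L f] for the integral of [f] against [mu].  The equation says that the
    transform of [P * mu] is zero, so that by uniqueness of the Fourier transform
    [mu] is carried by the quadric [P = 0] ([solves_carried]).

    Vanishing of the transform on the hyperplane orthogonal to [u] says that the
    image of [mu] under the orthogonal projection along [u] is zero.  A line of
    direction [u] with [Q u != 0] meets the quadric in at most two points, which are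
    exchanged by the affine reflection [S] that preserves the quadric and moves points
    along [u].  Hence [mu] is reversed by [S]: [L (f \o S) = - L f]
    ([reflection_anti_invariant]).

    With two directions, [mu] is reversed by two reflections [S1], [S2] and so
    invariant under [T = S1 \o S2].  On the plane spanned by [u1] and [u2] the linear
    part of [T] has determinant 1 and trace [k - 2], where
    [k = 4 * B(u1, u2) ^ 2 / (Q u1 * Q u2)] and [B] is the polar form of [Q].
    - If [k < 0], [k > 4] or [k = 4], the orbits of [T] leave every bounded set that
      stays away from the common fixed points of [S1] and [S2].  A finite invariant
      measure does not charge such wandering points, and at a common fixed point
      being reversed means being zero ([escape_zero]).
    - If [0 < k < 4], then [T] is a rotation, of angle [2 * theta] with
      [k = 4 * cos theta ^ 2].  When the angle is irrational, the orbits of [x] and of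
      [S1 x] are equidistributed in the same circle, so that the averages of a
      continuous function along both orbits have the same limit, while the integrals
      of these averages are opposite: they vanish ([rotation_zero]).
    - If [theta] is a rational multiple of [pi], which includes [k = 0], the pair
      belongs to the exceptional set.  For fixed [u1] this leaves countably many
      quadratic cones for [u2], none of which contains [u1] itself, whence a null set
      by Fubini ([negligible_exceptional]).

    Signed measures enter only through the functionals [L], which are linear and
    commute with bounded pointwise limits ([bounded_convergence]). *)

(** * Functionals with bounded convergence *)

Lemma cvg_seq_unique {R : realType} (u : nat -> R) (a b : R) :
  u n @[n --> \oo] --> a -> u n @[n --> \oo] --> b -> a = b.
Proof. by move=> /cvg_lim<-// /cvg_lim<-. Qed.

Section bounded_functions.
Context {R : realType} {dT : measure_display} {T : measurableType dT}.
Implicit Types f g : T -> R.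

Definition bounded_measurable f :=
  measurable_fun [set: T] f /\ exists M : R, forall x, `|f x| <= M.

Lemma bounded_measurable_cst (c : R) : bounded_measurable (fun=> c).
Proof. by split; [exact: measurable_cst|exists `|c|]. Qed.

Lemma bounded_measurableD f g : bounded_measurable f -> bounded_measurable g ->
  bounded_measurable (fun x => f x + g x).
Proof.
move=> [mf [M fM]] [mg [N gN]]; split; first exact: measurable_funD.
by exists (M + N) => x; rewrite (le_trans (ler_normD _ _))// lerD.
Qed.

Lemma bounded_measurableM f g : bounded_measurable f -> bounded_measurable g ->
  bounded_measurable (fun x => f x * g x).
Proof.
move=> [mf [M fM]] [mg [N gN]]; split; first exact: measurable_funM.
by exists (M * N) => x; rewrite normrM ler_pM.
Qed.

Lemma bounded_measurableZ (a : R) f : bounded_measurable f ->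
  bounded_measurable (fun x => a * f x).
Proof. by apply: bounded_measurableM; exact: bounded_measurable_cst. Qed.

Lemma bounded_measurable_lin (a : R) f g :
  bounded_measurable f -> bounded_measurable g ->
  bounded_measurable (fun x => a * f x + g x).
Proof.
by move=> bf bg; apply: bounded_measurableD => //; exact: bounded_measurableZ.
Qed.

Lemma bounded_measurable_indic (A : set T) : measurable A ->
  bounded_measurable (\1_A : T -> R).
Proof.
move=> mA; split; first exact: measurable_indic.
by exists 1 => x; rewrite indicE; case: (_ \in _); rewrite ?normr1 ?normr0.
Qed.

Lemma bounded_measurable_lim (f_ : nat -> T -> R) f (M : R) :
  (forall n, measurable_fun [set: T] (f_ n)) -> (forall n x, `|f_ n x| <= M) ->
  (forall x, f_ n x @[n --> \oo] --> f x) -> bounded_measurable f.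
Proof.
move=> mf fM ff; split.
  by apply: (@measurable_fun_cvg _ _ _ _ f_) => // x _; exact: ff.
exists M => x; have nf : `|f_ n x| @[n --> \oo] --> `|f x|.
  by apply: cvg_norm; exact: ff.
rewrite -(cvg_lim _ nf)//; apply: limr_le; first by apply/cvg_ex; exists `|f x|.
by apply: nearW => n; exact: fM.
Qed.

(** The three properties of integration against a finite signed measure that
    the proof uses.  Passing to such functionals makes the operations on
    measures (density, push-forward, restriction) mere compositions. *)
Definition bounded_convergence (L : (T -> R) -> R) :=
  (forall a f g, bounded_measurable f -> bounded_measurable g ->
     L (fun x => a * f x + g x) = a * L f + L g) /\
  (forall (f_ : nat -> T -> R) f (M : R),
     (forall n, measurable_fun [set: T] (f_ n)) -> (forall n x, `|f_ n x| <= M) ->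
     (forall x, f_ n x @[n --> \oo] --> f x) -> L (f_ n) @[n --> \oo] --> L f).

Section functional.
Context (L : (T -> R) -> R) (bL : bounded_convergence L).

Lemma bounded_convergence0 : L (fun=> 0) = 0.
Proof.
have := bL.1 1 _ _ (bounded_measurable_cst 0) (bounded_measurable_cst 0).
under [X in L X]eq_fun do rewrite mul1r addr0.
by rewrite mul1r => /eqP; rewrite -subr_eq0 opprD addNKr oppr_eq0 => /eqP.
Qed.

Lemma bounded_convergenceZ a f : bounded_measurable f ->
  L (fun x => a * f x) = a * L f.
Proof.
move=> bf; have := bL.1 a _ _ bf (bounded_measurable_cst 0).
by under [X in L X]eq_fun do rewrite addr0; rewrite bounded_convergence0 addr0.
Qed.

Lemma bounded_convergenceD f g : bounded_measurable f -> bounded_measurable g ->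
  L (fun x => f x + g x) = L f + L g.
Proof.
move=> bf bg; have := bL.1 1 _ _ bf bg.
by under [X in L X]eq_fun do rewrite mul1r; rewrite mul1r.
Qed.

Lemma bounded_convergenceB f g : bounded_measurable f -> bounded_measurable g ->
  L (fun x => f x - g x) = L f - L g.
Proof.
move=> bf bg; rewrite bounded_convergenceD//; last first.
  by have := bounded_measurableZ (-1) bg; under eq_fun do rewrite mulN1r.
congr (_ + _); have := bounded_convergenceZ (-1) bg.
by under [X in L X]eq_fun do rewrite mulN1r; rewrite mulN1r.
Qed.

Lemma bounded_convergence_weight w : bounded_measurable w ->
  bounded_convergence (fun f => L (fun x => w x * f x)).
Proof.
move=> bw; split=> [a f g bf bg|f_ f M mf fM ff].
  rewrite -bL.1; [|exact: bounded_measurableM..].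
  by congr L; apply/funext => x; rewrite mulrDr mulrCA.
have [mw [N wN]] := bw.
apply: (bL.2 _ _ (N * M)) => [n|n x|x].
- exact: measurable_funM.
- by rewrite normrM ler_pM.
- by apply: cvgMr; exact: ff.
Qed.

(** If the weighted functional vanishes then the functional itself does off the
    zeros of the weight, since [w ^ 2 / (w ^ 2 + 1 / n)] tends to the indicator
    of [w != 0]. *)
Lemma bounded_convergence_cancel w : bounded_measurable w ->
  (forall f, bounded_measurable f -> L (fun x => w x * f x) = 0) ->
  forall f, bounded_measurable f -> L (fun x => (w x != 0)%:R * f x) = 0.
Proof.
move=> [mw [N wN]] Lw f [mf [M fM]].
pose e n : R := n.+1%:R^-1.
have e0 n : 0 < e n by rewrite invr_gt0.
pose h n x := w x / (w x ^+ 2 + e n).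
have den0 n x : 0 < w x ^+ 2 + e n by rewrite ltr_wpDl ?sqr_ge0.
have mh n : measurable_fun [set: T] (h n).
  apply: measurable_funM => //.
  apply: (@measurable_comp _ _ _ _ _ _ [set x : R | x != 0]) => //.
  - by apply: open_measurable; exact: open_neq.
  - by move=> _ [x _ <-] /=; rewrite gt_eqF.
  - apply: open_continuous_measurable_fun; first exact: open_neq.
    by move=> x /set_mem x0; exact: inv_continuous.
  - by apply: measurable_funD => //; apply: measurable_funX.
have h_le n x : `|h n x| <= N / e n.
  rewrite /h normrM normfV (gtr0_norm (den0 n x)).
  by rewrite ler_pM ?invr_ge0// ?(ltW (den0 _ _))// lef_pV2 ?posrE// lerDr sqr_ge0.
have c x : w x * (h n x * f x) @[n --> \oo] --> (w x != 0)%:R * f x.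
  under eq_cvg do rewrite mulrA; apply: cvgMl.
  have [w0|w0] := eqVneq (w x) 0.
    by under eq_cvg do rewrite w0 mul0r; exact: cvg_cst.
  rewrite -[X in _ --> X](_ : w x * (w x / (w x ^+ 2 + 0)) = _); last first.
    by rewrite addr0 mulrA -expr2 divff// sqrf_eq0.
  apply: cvgMr; apply: cvgMr; apply: cvgV; first by rewrite addr0 sqrf_eq0.
  apply: cvgD; first exact: cvg_cst.
  exact: cvg_harmonic.
have := bL.2 (fun n x => w x * (h n x * f x)) _ M _ _ c.
have {}Lw n : L (fun x => w x * (h n x * f x)) = 0.
  apply: Lw; apply: bounded_measurableM; last by split=> //; exists M.
  by split=> //; exists (N / e n).
under [X in _ -> _ -> X]eq_cvg do rewrite Lw.
move=> H; apply: (@cvg_seq_unique _ (fun=> 0)); last exact: cvg_cst.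
apply: H => [n|n x].
  by apply: measurable_funM => //; exact: measurable_funM.
rewrite mulrA normrM (le_trans _ (fM x))// ler_piMl// /h mulrA -expr2 normrM normfV.
rewrite (ger0_norm (sqr_ge0 _)) (gtr0_norm (den0 n x)) ler_pdivrMr// mul1r.
by rewrite lerDl ltW.
Qed.

End functional.
End bounded_functions.

Lemma bounded_convergence_comp {R : realType} {d1 d2} {T1 : measurableType d1}
    {T2 : measurableType d2} (L : (T1 -> R) -> R) (p : T1 -> T2) :
  bounded_convergence L -> measurable_fun [set: T1] p ->
  bounded_convergence (fun f => L (f \o p)).
Proof.
have comp (f : T2 -> R) : measurable_fun [set: T1] p ->
  bounded_measurable f -> bounded_measurable (f \o p).
  move=> mp [mf [M fM]]; split; first exact: measurableT_comp.
  by exists M => x; exact: fM.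
move=> bL mp; split=> [a f g bf bg|f_ f M mf fM ff].
  exact: bL.1 (comp _ mp bf) (comp _ mp bg).
apply: (bL.2 _ _ M) => [n|n x|x]; [|exact: fM|exact: ff].
exact: measurableT_comp.
Qed.

Section trigonometric_closure.
Context {R : realType} {d : nat}.
Implicit Types (f g : 'rV[R]_d -> R) (xi : 'rV[R]_d).

Lemma measurable_dotv xi :
  measurable_fun [set: borel_rV R d] (fun x : 'rV[R]_d => dotv x xi).
Proof.
apply: measurable_sum => i; apply: measurable_funM => //.
exact: measurable_coord_rV.
Qed.

Lemma measurable_cos_dotv xi :
  measurable_fun [set: borel_rV R d] (fun x : 'rV[R]_d => cos (dotv x xi)).
Proof.
apply: (measurableT_comp (f := @cos R)); last exact: measurable_dotv.
by apply: continuous_measurable_fun; exact: continuous_cos.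
Qed.

Lemma measurable_sin_dotv xi :
  measurable_fun [set: borel_rV R d] (fun x : 'rV[R]_d => sin (dotv x xi)).
Proof.
apply: (measurableT_comp (f := @sin R)); last exact: measurable_dotv.
by apply: continuous_measurable_fun; exact: continuous_sin.
Qed.

Lemma bounded_cos_dotv xi :
  bounded_measurable ((fun x => cos (dotv x xi)) : borel_rV R d -> R).
Proof.
split; first exact: measurable_cos_dotv.
by exists 1 => x; rewrite ler_norml cos_geN1 cos_le1.
Qed.

Lemma bounded_sin_dotv xi :
  bounded_measurable ((fun x => sin (dotv x xi)) : borel_rV R d -> R).
Proof.
split; first exact: measurable_sin_dotv.
by exists 1 => x; rewrite ler_norml sin_geN1 sin_le1.
Qed.

Lemma dotvDr (x y z : 'rV[R]_d) : dotv x (y + z) = dotv x y + dotv x z.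
Proof. by rewrite /dotv -big_split; apply: eq_bigr => i _; rewrite mxE mulrDr. Qed.

Lemma dotvC (x y : 'rV[R]_d) : dotv x y = dotv y x.
Proof. by apply: eq_bigr => i _; rewrite mulrC. Qed.

Lemma dotvZr (a : R) (x y : 'rV[R]_d) : dotv x (a *: y) = a * dotv x y.
Proof. by rewrite /dotv mulr_sumr; apply: eq_bigr => i _; rewrite mxE mulrCA. Qed.

Lemma dotvZl (a : R) (x y : 'rV[R]_d) : dotv (a *: x) y = a * dotv x y.
Proof. by rewrite dotvC dotvZr dotvC. Qed.

Lemma dotvNr (x y : 'rV[R]_d) : dotv x (- y) = - dotv x y.
Proof. by rewrite -scaleN1r dotvZr mulN1r. Qed.

Lemma dotvBr (x y z : 'rV[R]_d) : dotv x (y - z) = dotv x y - dotv x z.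
Proof. by rewrite dotvDr dotvNr. Qed.

Lemma dotvBl (x y z : 'rV[R]_d) : dotv (x - y) z = dotv x z - dotv y z.
Proof. by rewrite dotvC dotvBr !(dotvC z). Qed.

Lemma dotv0r (x : 'rV[R]_d) : dotv x 0 = 0.
Proof. by rewrite -(scale0r 0) dotvZr mul0r. Qed.

Lemma dotv_delta (x : 'rV[R]_d) (i : 'I_d) : dotv x (delta_mx 0 i) = x 0 i.
Proof.
rewrite /dotv (bigD1 i)//= big1 => [|j /negPf ji]; last first.
  by rewrite mxE ji andbF mulr0.
by rewrite mxE !eqxx mulr1 addr0.
Qed.

(** Every functional with bounded convergence that kills the characters kills this
    class, see [trig_closure0]; uniqueness amounts to showing that the class contains
    all bounded Borel functions. *)
Inductive trig_closure : ('rV[R]_d -> R) -> Prop :=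
| trig_cos xi : trig_closure (fun x => cos (dotv x xi))
| trig_sin xi : trig_closure (fun x => sin (dotv x xi))
| trig_lin a f g : trig_closure f -> trig_closure g ->
    trig_closure (fun x => a * f x + g x)
| trig_lim (f_ : nat -> 'rV[R]_d -> R) f (M : R) : (forall n, trig_closure (f_ n)) ->
    (forall n x, `|f_ n x| <= M) -> (forall x, f_ n x @[n --> \oo] --> f x) ->
    trig_closure f.

Lemma trig_closure_bounded f : trig_closure f ->
  bounded_measurable (f : borel_rV R d -> R).
Proof.
elim=> {f} [xi|xi|a f g _ bf _ bg|f_ f M _ bf fM ff].
- exact: bounded_cos_dotv.
- exact: bounded_sin_dotv.
- exact: bounded_measurable_lin.
- by apply: (@bounded_measurable_lim _ _ (borel_rV R d) _ _ M) => // n; case: (bf n).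
Qed.

Lemma trig_closure0 (L : (borel_rV R d -> R) -> R) f : bounded_convergence L ->
  (forall xi, L (fun x => cos (dotv x xi)) = 0) ->
  (forall xi, L (fun x => sin (dotv x xi)) = 0) ->
  trig_closure f -> L f = 0.
Proof.
move=> bL Lc Ls; elim=> {f} [//|//|a f g tf Lf tg Lg|f_ f M tf Lf fM ff].
  by rewrite bL.1 ?Lf ?Lg ?mulr0 ?addr0//; exact: trig_closure_bounded.
apply: (@cvg_seq_unique _ (fun n => L (f_ n))).
  by apply: (bL.2 _ _ M) => // n; case: (trig_closure_bounded (tf n)).
by under eq_cvg do rewrite Lf; exact: cvg_cst.
Qed.

Lemma trig_closure_cst (c : R) : trig_closure (fun=> c).
Proof.
have -> : (fun=> c) =
    (fun x : 'rV[R]_d => (c - 1) * cos (dotv x 0) + cos (dotv x 0)).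
  by apply/funext => x; rewrite dotv0r cos0 mulr1 subrK.
by apply: trig_lin; exact: trig_cos.
Qed.

Lemma trig_closureZ (a : R) f : trig_closure f -> trig_closure (fun x => a * f x).
Proof.
move=> tf; rewrite (_ : (fun _ => _) = fun x => a * f x + 0).
  by apply: trig_lin => //; exact: trig_closure_cst.
by apply/funext => x; rewrite addr0.
Qed.

Lemma trig_closureD f g : trig_closure f -> trig_closure g ->
  trig_closure (fun x => f x + g x).
Proof.
move=> tf tg; rewrite (_ : (fun _ => _) = fun x => 1 * f x + g x).
  exact: trig_lin.
by apply/funext => x; rewrite mul1r.
Qed.

Lemma trig_closureB f g : trig_closure f -> trig_closure g ->
  trig_closure (fun x => f x - g x).
Proof.
move=> tf tg; rewrite (_ : (fun _ => _) = fun x => -1 * g x + f x).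
  exact: trig_lin.
by apply/funext => x; rewrite mulN1r addrC.
Qed.

(** Products of two sines or cosines are again sums of sines and cosines; the
    two nested inductions propagate this through linear combinations and limits. *)
Lemma trig_closureM f g : trig_closure f -> trig_closure g ->
  trig_closure (fun x => f x * g x).
Proof.
move=> tf; move: g; elim: tf => {f} [xi|xi|a f1 f2 tf1 IH1 tf2 IH2|f_ f M tf IH fM ff] g.
- elim=> {g} [eta|eta|a g1 g2 _ IH1 _ IH2|g_ g M _ IH gM gg].
  + rewrite (_ : (fun _ => _) = fun x => 2^-1 * (cos (dotv x (xi + eta)) +
      cos (dotv x (xi - eta)))).
      by apply: trig_closureZ; apply: trig_closureD; exact: trig_cos.
    by apply/funext => x; rewrite dotvDr dotvBr cosD cosB; lra.
  + rewrite (_ : (fun _ => _) = fun x => 2^-1 * (sin (dotv x (xi + eta)) -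
      sin (dotv x (xi - eta)))).
      by apply: trig_closureZ; apply: trig_closureB; exact: trig_sin.
    by apply/funext => x; rewrite dotvDr dotvBr sinD sinB; lra.
  + rewrite (_ : (fun _ => _) = fun x => a * (cos (dotv x xi) * g1 x) +
      cos (dotv x xi) * g2 x); first exact: trig_lin.
    by apply/funext => x; ring.
  + apply: (trig_lim IH (M := M)) => [n x|x].
      by rewrite normrM (le_trans _ (gM n x))// ler_piMl// ler_norml cos_geN1 cos_le1.
    by apply: cvgMr; exact: gg.
- elim=> {g} [eta|eta|a g1 g2 _ IH1 _ IH2|g_ g M _ IH gM gg].
  + rewrite (_ : (fun _ => _) = fun x => 2^-1 * (sin (dotv x (xi + eta)) +
      sin (dotv x (xi - eta)))).
      by apply: trig_closureZ; apply: trig_closureD; exact: trig_sin.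
    by apply/funext => x; rewrite dotvDr dotvBr sinD sinB; lra.
  + rewrite (_ : (fun _ => _) = fun x => 2^-1 * (cos (dotv x (xi - eta)) -
      cos (dotv x (xi + eta)))).
      by apply: trig_closureZ; apply: trig_closureB; exact: trig_cos.
    by apply/funext => x; rewrite dotvBr cosB dotvDr cosD; lra.
  + rewrite (_ : (fun _ => _) = fun x => a * (sin (dotv x xi) * g1 x) +
      sin (dotv x xi) * g2 x); first exact: trig_lin.
    by apply/funext => x; ring.
  + apply: (trig_lim IH (M := M)) => [n x|x].
      by rewrite normrM (le_trans _ (gM n x))// ler_piMl// ler_norml sin_geN1 sin_le1.
    by apply: cvgMr; exact: gg.
- move=> tg; rewrite (_ : (fun _ => _) = fun x => a * (f1 x * g x) + f2 x * g x).
    by apply: trig_lin; [exact: IH1|exact: IH2].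
  by apply/funext => x; ring.
- move=> tg; have [_ [N gN]] := trig_closure_bounded tg.
  apply: (trig_lim (fun n => IH n g tg) (M := M * N)) => [n x|x].
    by rewrite normrM ler_pM.
  by apply: cvgMl; exact: ff.
Qed.

(** On [-1, 1] the iterates of this odd cubic converge to the sign.  They are
    polynomials, so that applying them to a function stays inside [trig_closure]. *)
Definition sign_step (s : R) := s * (3 - s ^+ 2) / 2.

Lemma sign_step_itv (s : R) : `|s| <= 1 -> `|sign_step s| <= 1.
Proof.
rewrite /sign_step !ler_norml => /andP[sN1 s1].
have : 0 <= (1 - s) ^+ 2 * (2 + s) by rewrite mulr_ge0 ?sqr_ge0//; lra.
have : 0 <= (1 + s) ^+ 2 * (2 - s) by rewrite mulr_ge0 ?sqr_ge0//; lra.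
by move=> *; apply/andP; split; nra.
Qed.

Lemma iter_sign_step_itv n (s : R) : `|s| <= 1 -> `|iter n sign_step s| <= 1.
Proof. by move=> s1; elim: n => //= n; exact: sign_step_itv. Qed.

Lemma iter_sign_stepN n (s : R) : iter n sign_step (- s) = - iter n sign_step s.
Proof. by elim: n => //= n ->; rewrite /sign_step; field. Qed.

Lemma cvg_iter_sign_step (s : R) : `|s| <= 1 ->
  iter n sign_step s @[n --> \oo] --> Num.sg s.
Proof.
wlog s0 : s / 0 <= s.
  move=> H s1; have [/H//|/ltW] := leP 0 s; first exact.
  rewrite -oppr_ge0 => /H; rewrite normrN => /(_ s1) H'.
  rewrite -[s]opprK; under eq_cvg do rewrite iter_sign_stepN.
  by rewrite sgrN; apply: cvgN.
move=> s1; move: s0; rewrite le_eqVlt => /predU1P[<-|s0].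
  rewrite sgr0; under eq_cvg => n.
    rewrite (_ : iter n _ _ = 0); last by elim: n => //= n ->; rewrite /sign_step !mul0r.
    over.
  exact: cvg_cst.
have s_le1 : s <= 1 by rewrite (le_trans (ler_norm s)).
rewrite gtr0_sg//.
have it n : s <= iter n sign_step s <= 1 /\
    1 - iter n sign_step s <= (1 - s / 2) ^+ n.
  elim: n => [|n [/andP[h1 h2] h3]] /=; first by rewrite lexx s_le1 expr0; split=> //; lra.
  set t := iter n sign_step s in h1 h2 h3 *.
  have e0 : 0 <= (1 - s / 2) ^+ n by rewrite exprn_ge0//; lra.
  rewrite exprS; set e := _ ^+ n in h3 e0 *; rewrite /sign_step; split.
    have : 0 <= t * ((1 - t) * (1 + t)) by rewrite !mulr_ge0//; lra.
    have : 0 <= (1 - t) ^+ 2 * (2 + t) by rewrite mulr_ge0 ?sqr_ge0//; lra.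
    by move=> *; apply/andP; split; nra.
  have : 1 - t * (3 - t ^+ 2) / 2 <= (1 - s / 2) * (1 - t).
    have : 0 <= (1 - t) * (t - s) by rewrite mulr_ge0//; lra.
    have : 0 <= (1 - t) * (t * t) by rewrite !mulr_ge0//; lra.
    by move=> *; nra.
  move=> /le_trans; apply; apply: ler_wpM2l => //; lra.
apply: (@squeeze_cvgr _ _ _ _ (fun n => 1 - (1 - s / 2) ^+ n) (fun=> 1)).
- by apply: nearW => n; have [/andP[_ ->]] := it n; rewrite andbT; lra.
- rewrite -[X in _ --> X]subr0; apply: cvgB; first exact: cvg_cst.
  by apply: cvg_expr; rewrite ger0_norm; lra.
- exact: cvg_cst.
Qed.

Lemma trig_closure_sg f : trig_closure f -> (forall x, `|f x| <= 1) ->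
  trig_closure (fun x => Num.sg (f x)).
Proof.
move=> tf f1; apply: (@trig_lim (fun n x => iter n sign_step (f x)) _ 1).
- elim=> [//|n IH]; rewrite /= /sign_step.
  set h := fun x => iter n sign_step (f x) in IH *.
  rewrite (_ : (fun _ => _) = fun x => 2^-1 * (h x * (3 - h x * h x))).
    apply: trig_closureZ; apply: trig_closureM => //.
    by apply: trig_closureB; [exact: trig_closure_cst|exact: trig_closureM].
  by apply/funext => x; rewrite /h expr2 mulrC.
- by move=> n x; exact: iter_sign_step_itv.
- by move=> x; exact: cvg_iter_sign_step.
Qed.

(** The sign of [x 0 i - a] is the limit of the signs of [sin ((x 0 i - a) / k)] as [k]
    grows, since [sin] has the sign of its argument near 0. *)
Lemma trig_closure_sg_coord (i : 'I_d) (a : R) :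
  trig_closure (fun x => Num.sg (x 0 i - a)).
Proof.
pose g (n : nat) (x : 'rV[R]_d) := sin ((x 0 i - a) / n.+1%:R).
have tg n : trig_closure (g n).
  rewrite /g (_ : (fun _ => _) = fun x =>
    cos (a / n.+1%:R) * sin (dotv x (n.+1%:R^-1 *: delta_mx 0 i)) -
    sin (a / n.+1%:R) * cos (dotv x (n.+1%:R^-1 *: delta_mx 0 i))).
    apply: trig_closureB; apply: trig_closureZ; [exact: trig_sin|exact: trig_cos].
  apply/funext => x; rewrite dotvZr dotv_delta mulrBl sinB (mulrC _^-1).
  by ring.
have g1 n x : `|g n x| <= 1 by rewrite ler_norml sin_geN1 sin_le1.
apply: (@trig_lim (fun n x => Num.sg (g n x)) _ 1).
- by move=> n; exact: trig_closure_sg.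
- by move=> n x; rewrite normr_sg lern1; case: (_ != _).
move=> x; set t := x 0 i - a.
have [N tN] : exists N : nat, `|t| < N%:R.
  exists (Num.truncn `|t|).+1; exact: truncnS_gt.
apply: cvg_near_cst; exists N => // n /= Nn; apply/eqP; rewrite /g -/t.
have tn : `|t / n.+1%:R| < 1.
  rewrite normrM normfV normr_nat ltr_pdivrMr// mul1r (lt_le_trans tN)//.
  by rewrite ler_nat (leq_trans Nn).
have pi1 : 1 < pi :> R by rewrite (lt_le_trans _ (@pi_ge2 R))// ltr1n.
have n0 : 0 < n.+1%:R :> R by [].
case: (ltgtP t 0) => t0.
- rewrite (ltr0_sg t0) ltr0_sg// -oppr_gt0 -sinN sin_gt0_pi//.
  rewrite -mulNr divr_gt0 ?oppr_gt0//= mulNr (lt_trans _ pi1)// ltrNl.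
  by move: tn; rewrite ltr_norml => /andP[].
- rewrite (gtr0_sg t0) gtr0_sg// sin_gt0_pi// divr_gt0//= (lt_trans _ pi1)//.
  by move: tn; rewrite ltr_norml => /andP[].
- by rewrite t0 mul0r sin0.
Qed.

Definition trig_sets : set (set 'rV[R]_d) := [set A | trig_closure (\1_A : _ -> R)].

Lemma trig_sets_sigma_algebra : sigma_algebra [set: 'rV[R]_d] trig_sets.
Proof.
split.
- rewrite /trig_sets/= (_ : \1_set0 = fun=> 0); first exact: trig_closure_cst.
  by apply/funext => x; rewrite indicE in_set0.
- move=> A; rewrite /trig_sets/= => tA.
  rewrite (_ : \1_ _ = fun x => 1 - \1_A x).
    by apply: trig_closureB => //; exact: trig_closure_cst.
  apply/funext => x; rewrite !indicE setTD in_setC.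
  by case: (x \in A); rewrite ?subrr ?subr0.
- move=> A tA; rewrite /trig_sets/=.
  pose B n := \bigcap_(k < n) ~` A k.
  have tB n : trig_closure (\1_(B n) : _ -> R).
    elim: n => [|n IH].
      rewrite (_ : \1_ _ = fun=> 1); first exact: trig_closure_cst.
      by apply/funext => x; rewrite indicE /B mem_set//; move=> k /=.
    rewrite (_ : \1_ _ = fun x => \1_(B n) x * (1 - \1_(A n) x)).
      apply: trig_closureM => //; apply: trig_closureB; last exact: tA.
      exact: trig_closure_cst.
    apply/funext => x; rewrite (_ : B n.+1 = B n `&` ~` A n).
      by rewrite !indicE in_setI in_setC; do 2 case: (x \in _);
        rewrite ?subrr ?subr0 ?mulr1 ?mul0r ?mulr0.
    by rewrite /B !bigcap_mkord big_ord_recr.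
  rewrite (_ : \1_ _ = fun x => 1 - \1_(\bigcap_k ~` A k) x); last first.
    rewrite -setC_bigcup; apply/funext => x; rewrite !indicE in_setC.
    by case: (_ \in _); rewrite ?subr0 ?subrr.
  apply: trig_closureB; first exact: trig_closure_cst.
  apply: (trig_lim tB (M := 1)) => [n x|x].
    by rewrite indicE; case: (_ \in _); rewrite ?normr1 ?normr0.
  have [xA|xA] := pselect ((\bigcap_k ~` A k) x).
    apply: cvg_near_cst; apply: nearW => n; apply/eqP.
    by rewrite !indicE !mem_set// => k _; exact: xA.
  have [N AN] : exists N, A N x.
    by apply: contrapT => H; apply: xA => k _ Ak; apply: H; exists k.
  apply: cvg_near_cst; exists N.+1 => // n /= Nn; apply/eqP.
  by rewrite !indicE !memNset// => /(_ N Nn); exact.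
Qed.

(** The sets whose indicator is in [trig_closure] form a sigma-algebra; it contains the
    half-spaces [x 0 i > a], which generate the Borel sets. *)
Lemma trig_closure_indic (A : set (borel_rV R d)) : measurable A ->
  trig_closure (\1_A : _ -> R).
Proof.
have S := trig_sets_sigma_algebra.
pose T := g_sigma_algebraType trig_sets.
have Tm (B : set 'rV[R]_d) : measurable (B : set T) -> trig_sets B.
  by apply; split=> //; exact: S.
suff : measurable_fun [set: T] (fun x : T => (x : borel_rV R d)).
  by move=> h mA; apply: Tm; rewrite -[X in measurable X]setTI; exact: (h measurableT A mA).
apply: measurable_fun_rV => i.
apply: (measurability _ (RGenOInfty.measurableE R)) => _ [_ [a ->] <-].
rewrite setTI; apply: sub_sigma_algebra; rewrite /trig_sets/=.
rewrite (_ : \1_ _ = fun x : 'rV[R]_d => 2^-1 * (Num.sg (x 0 i - a) +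
    Num.sg (x 0 i - a) * Num.sg (x 0 i - a))).
  apply: trig_closureZ; apply: trig_closureD; last apply: trig_closureM;
  exact: trig_closure_sg_coord.
(* With s the sign, (s + s ^ 2) / 2 is the indicator of the positive numbers. *)
apply/funext => x; rewrite indicE; case: (ltgtP (x 0 i) a) => xa.
- rewrite memNset/=; last by rewrite in_itv/= andbT => /lt_trans/(_ xa); rewrite ltxx.
  by rewrite ltr0_sg ?subr_lt0//; lra.
- rewrite mem_set/=; last by rewrite in_itv/= andbT.
  by rewrite gtr0_sg ?subr_gt0//; lra.
- rewrite memNset/= ?xa; last by rewrite in_itv/= ltxx.
  by rewrite subrr sgr0; lra.
Qed.

End trigonometric_closure.

Lemma trig_closure_sum {R : realType} {d : nat} (I : Type) (s : seq I)
    (F : I -> 'rV[R]_d -> R) :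
  (forall i, trig_closure (F i)) -> trig_closure (fun x => \sum_(i <- s) F i x).
Proof.
move=> tF; elim: s => [|i s IH].
  rewrite (_ : (fun _ => _) = fun=> 0); first exact: trig_closure_cst.
  by apply/funext => x; rewrite big_nil.
rewrite (_ : (fun _ => _) = fun x => F i x + \sum_(j <- s) F j x).
  exact: trig_closureD.
by apply/funext => x; rewrite big_cons.
Qed.

Import HBSimple.
Import HBNNSimple.

(** A nonnegative function is the limit of simple functions below it, and adding a
    constant makes a bounded function nonnegative. *)
Lemma trig_closure_bounded_measurable {R : realType} {d : nat}
    (f : borel_rV R d -> R) : bounded_measurable f -> trig_closure f.
Proof.
move=> [mf [M fM]].
pose g x := `|M| + f x.
have g0 x : 0 <= g x.
  have := fM x; rewrite ler_norml => /andP[+ _]; rewrite /g.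
  by have := ler_norm M; lra.
have mg : measurable_fun [set: borel_rV R d] (EFin \o g).
  by apply/measurable_EFinP; exact: measurable_funD.
pose h n : 'rV[R]_d -> R := nnsfun_approx measurableT mg n.
have th n : trig_closure (h n).
  rewrite (_ : h n = fun x => \sum_(y \in range (h n)) y * \1_(h n @^-1` [set y]) x).
    rewrite (_ : (fun _ => _) = fun x => \sum_(y <- finmap.enum_fset (fset_set (range (h n))))
        y * \1_(h n @^-1` [set y]) x).
      apply: trig_closure_sum => y; apply: trig_closureZ.
      exact: trig_closure_indic.
    have fh : finite_set (range (h n)) by exact: (fimfunP (nnsfun_approx measurableT mg n)).
    by apply/funext => x; rewrite fsbig_finite//.
  by apply/funext => x; rewrite /h [LHS]fimfunE.
rewrite (_ : f = fun x => g x - `|M|); last by apply/funext => x; rewrite /g addrC addKr.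
apply: trig_closureB; last exact: trig_closure_cst.
apply: (trig_lim th (M := `|M| + `|M|)) => [n x|x].
  rewrite ger0_norm//; have : ((h n x)%:E <= (g x)%:E)%E.
    by rewrite /h nnsfun_approxE; apply: le_approx => //= y _; rewrite lee_fin.
  rewrite lee_fin => /le_trans; apply; rewrite lerD2l.
  by rewrite (le_trans (ler_norm _))// (le_trans (fM x))// ler_norm.
have g0E (y : borel_rV R d) : [set: borel_rV R d] y -> (0 <= (EFin \o g) y)%E.
  by rewrite lee_fin.
by have /fine_cvgP[_] := cvg_nnsfun_approx measurableT mg g0E (I : setT x).
Qed.

(** Uniqueness of the Fourier transform: all bounded Borel functions are obtained
    from trigonometric polynomials by bounded limits. *)
Theorem fourier_uniqueness {R : realType} {d : nat}
    (L : (borel_rV R d -> R) -> R) : bounded_convergence L ->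
  (forall xi, L (fun x => cos (dotv x xi)) = 0) ->
  (forall xi, L (fun x => sin (dotv x xi)) = 0) ->
  forall f, bounded_measurable f -> L f = 0.
Proof.
move=> bL Lc Ls f bf; apply: trig_closure0 => //.
exact: trig_closure_bounded_measurable.
Qed.

(** * Integration over coordinate spaces *)

Lemma continuous_rV {R : realType} (T : topologicalType) n (f : T -> 'rV[R]_n) :
  (forall i, continuous (fun t => f t 0 i)) -> continuous f.
Proof.
move=> cf t A [P fP PA]; rewrite /nbhs/=.
have : \forall s \near t, forall j, P 0 j (f s 0 j).
  by apply: filter_forall => j; apply: cf; exact: fP.
by apply: filterS => s fs; apply: PA => i j; rewrite ord1.
Qed.

Section lebesgue_rV_theory.
Context {R : realType}.

Lemma cons_rV0 n (p : R * 'rV[R]_n) : (cons_rV p : 'rV[R]_n.+1) 0 0 = p.1.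
Proof.
rewrite /cons_rV (_ : 0 = lshift n 0 :> 'I_(1 + n)); last exact: val_inj.
by rewrite (row_mxEl (p.1%:M : 'rV_1)) mxE.
Qed.

Lemma cons_rV_lift n (p : R * 'rV[R]_n) (j : 'I_n) :
  (cons_rV p : 'rV[R]_n.+1) 0 (lift ord0 j) = p.2 0 j.
Proof.
rewrite /cons_rV (_ : lift ord0 j = rshift 1 j); last exact: val_inj.
by rewrite (row_mxEr (p.1%:M : 'rV_1)).
Qed.

Lemma cons_rVP n (p : R * 'rV[R]_n) (x : 'rV[R]_n.+1) :
  x 0 0 = p.1 -> (forall j, x 0 (lift ord0 j) = p.2 0 j) -> x = cons_rV p.
Proof.
move=> x0 xj; apply/rowP => i; case: (unliftP ord0 i) => [j|] ->.
  by rewrite xj cons_rV_lift.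
by rewrite x0 cons_rV0.
Qed.

Lemma cons_rVD n (p q : R * 'rV[R]_n) :
  cons_rV (p.1 + q.1, p.2 + q.2) = cons_rV p + cons_rV q :> 'rV[R]_n.+1.
Proof.
apply/esym/cons_rVP => [|j]; first by rewrite mxE !cons_rV0.
by rewrite mxE !cons_rV_lift /= mxE.
Qed.

Lemma cons_rVZ n (a : R) (p : R * 'rV[R]_n) :
  a *: (cons_rV p : 'rV[R]_n.+1) = cons_rV (a * p.1, a *: p.2).
Proof.
apply: cons_rVP => [|j]; first by rewrite mxE cons_rV0.
by rewrite mxE cons_rV_lift /= mxE.
Qed.

Lemma cons_rV_surj n (x : 'rV[R]_n.+1) :
  x = cons_rV (x 0 0, \row_j x 0 (lift ord0 j)).
Proof. by apply: cons_rVP => // j; rewrite mxE. Qed.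

Definition cube n (K : R) : set 'rV[R]_n := [set x | forall i, `|x 0 i| <= K].
Arguments cube : clear implicits.

Lemma cons_cube n (K : R) : @cons_rV R n @^-1` cube n.+1 K = `[- K, K] `*` cube n K.
Proof.
apply/seteqP; split=> p /=.
  move=> h; split.
    by have := h 0; rewrite cons_rV0 /= in_itv/= ler_norml.
  by move=> j; have := h (lift ord0 j); rewrite cons_rV_lift.
rewrite in_itv/= => -[p1 p2] i; case: (unliftP ord0 i) => [j|] ->.
  by rewrite cons_rV_lift; exact: p2.
by rewrite cons_rV0 ler_norml.
Qed.

Lemma measurable_cube n (K : R) : measurable (cube n K : set (borel_rV R n)).
Proof.
rewrite (_ : cube n K = \bigcap_(i in [set: 'I_n]) [set x : 'rV[R]_n | `|x 0 i| <= K]).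
  apply: fin_bigcap_measurable => // i _.
  rewrite [X in measurable X](_ : _ = (fun x : 'rV[R]_n => x 0 i) @^-1` `[- K, K]).
    rewrite -[X in measurable X]setTI.
    by apply: measurable_coord_rV => //; exact: measurable_itv.
  by apply/seteqP; split=> x /=; rewrite in_itv/= ler_norml.
by apply/seteqP; split=> x /= h i; [move=> _; exact: h|exact: (h i I)].
Qed.

Lemma lebesgue_rVS n (A : set (borel_rV R n.+1)) : lebesgue_rV R n.+1 A =
  (@lebesgue_measure R \x lebesgue_rV R n)%E (@cons_rV R n @^-1` A).
Proof. by []. Qed.

Lemma lebesgue_cube n (K : R) : 0 < K ->
  lebesgue_rV R n (cube n K) = ((K *+ 2) ^+ n)%:E.
Proof.
move=> K0; elim: n => [|n IH].
  rewrite /= diracE mem_set//= => -[] //.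
rewrite lebesgue_rVS cons_cube product_measure1E//; last exact: measurable_cube.
rewrite IH [X in (X * _)%E]lebesgue_measure_itv/= lte_fin gtrN// exprS EFinM; congr (_ * _)%E.
by rewrite -EFinD opprK mulr2n.
Qed.

Definition supported_in n (K : R) (f : 'rV[R]_n -> R) :=
  forall (x : 'rV[R]_n) (i : 'I_n), K < `|x 0 i| -> f x = 0.

Lemma integrable_supported dT (T : measurableType dT)
    (mu : {measure set T -> \bar R}) (A : set T) (f : T -> R) (M : R) :
  measurable A -> (mu A < +oo)%E -> measurable_fun setT f ->
  (forall x, `|f x| <= M) -> (forall x, f x != 0 -> A x) ->
  mu.-integrable setT (EFin \o f).
Proof.
move=> mA Aoo mf fM fA.
rewrite (_ : EFin \o f = (EFin \o f) \_ A); last first.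
  apply/funext => x; rewrite patchE /=; case: ifPn => // /negP xA.
  by congr (_%:E); apply/eqP; apply: contra_notT xA => /fA; rewrite inE.
apply/integrable_restrict => //; rewrite setTI.
apply: measurable_bounded_integrable => //; first exact: measurable_funTS.
by exists M; split; [exact: num_real|move=> N MN x _ /=; rewrite (le_trans (fM x))// ltW].
Qed.

Lemma supported_cube n (K : R) (f : 'rV[R]_n -> R) : supported_in K f ->
  forall x, f x != 0 -> cube n K x.
Proof.
by move=> sf x + i; apply: contra_neqT; rewrite -ltNge => /sf.
Qed.

Lemma cube_compact n (K : R) : compact (cube n K : set 'rV[R]_n).
Proof.
rewrite (_ : cube n K = [set x : 'rV[R]_n | forall i, (fun=> `[- K, K]%classic) i (x ord0 i)]).
  by apply: (@rV_compact _ _ (fun=> `[- K, K]%classic)) => i; exact: segment_compact.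
by apply/seteqP; split=> x /= h i; have := h i; rewrite ?inE/= ?in_itv/= ler_norml.
Qed.

Lemma supported_bounded n (K : R) (f : 'rV[R]_n -> R) :
  continuous f -> supported_in K f -> exists M, forall x, `|f x| <= M.
Proof.
move=> cf sf.
have : compact (f @` cube n K).
  by apply: continuous_compact; [exact: continuous_subspaceT|exact: cube_compact].
move=> /compact_bounded[M [_ HM]]; exists (`|M| + 1) => x.
have M1 : M < `|M| + 1 by rewrite (le_lt_trans (ler_norm _))// ltrDl.
have [->|fx] := eqVneq (f x) 0; first by rewrite normr0 addr_ge0.
by apply: HM => //; exists x => //; exact: supported_cube fx.
Qed.

Lemma lebesgue_cube_lty n (K : R) : (lebesgue_rV R n (cube n K) < +oo)%E.
Proof.
apply: (@le_lt_trans _ _ (lebesgue_rV R n (cube n (`|K| + 1)))).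
  rewrite le_measure ?inE//; [exact: measurable_cube|exact: measurable_cube|].
  by move=> x xK i; rewrite (le_trans (xK i))// (le_trans (ler_norm K))// lerDl.
by rewrite lebesgue_cube ?ltry// ltr_wpDl.
Qed.

Lemma integrable_continuous n (K : R) (f : 'rV[R]_n -> R) :
  continuous f -> supported_in K f ->
  (lebesgue_rV R n).-integrable setT (EFin \o f).
Proof.
move=> cf sf; have [M fM] := supported_bounded cf sf.
apply: (@integrable_supported _ (borel_rV R n) _ (cube n K) f M) => //.
- exact: measurable_cube.
- exact: lebesgue_cube_lty.
- exact: continuous_measurable_rV.
- exact: supported_cube.
Qed.

Section slices.
Context n (K : R) (f : 'rV[R]_n.+1 -> R).
Hypotheses (cf : continuous f) (sf : supported_in K f).

Lemma cons_rV_continuousl (y : 'rV[R]_n) : continuous (fun t : R => (cons_rV (t, y) : 'rV[R]_n.+1)).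
Proof.
apply: continuous_rV => i; case: (unliftP ord0 i) => [j|] ->.
  by under eq_fun do rewrite cons_rV_lift; exact: cst_continuous.
by under eq_fun do rewrite cons_rV0; move=> t; exact: cvg_id.
Qed.

Lemma cons_rV_continuousr (t : R) : continuous (fun y : 'rV[R]_n => (cons_rV (t, y) : 'rV[R]_n.+1)).
Proof.
apply: continuous_rV => i; case: (unliftP ord0 i) => [j|] ->.
  by under eq_fun do rewrite cons_rV_lift; exact: coord_continuous.
by under eq_fun do rewrite cons_rV0; exact: cst_continuous.
Qed.

Lemma slicel_continuous y : continuous (fun t : R => f (cons_rV (t, y))).
Proof.
by move=> t; apply: (continuous_comp (@cons_rV_continuousl y t)); exact: cf.
Qed.

Lemma slicer_continuous t : continuous (fun y : 'rV[R]_n => f (cons_rV (t, y))).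
Proof.
by move=> y; apply: (continuous_comp (@cons_rV_continuousr t y)); exact: cf.
Qed.

Lemma slicel_supported y t : K < `|t| -> f (cons_rV (t, y)) = 0.
Proof. by move=> Kt; apply: (sf (i := 0)); rewrite cons_rV0. Qed.

Lemma slicer_supported t : supported_in K (fun y : 'rV[R]_n => f (cons_rV (t, y))).
Proof. by move=> y i Ki; apply: (sf (i := lift ord0 i)); rewrite cons_rV_lift. Qed.

Lemma integrable_cons :
  (@lebesgue_measure R \x lebesgue_rV R n)%E.-integrable setT
    (fun p : measurableTypeR R * borel_rV R n => (f (cons_rV p))%:E).
Proof.
have [M fM] := supported_bounded cf sf.
apply: (@integrable_supported _ _ (@lebesgue_measure R \x lebesgue_rV R n)%E
  (@cons_rV R n @^-1` cube n.+1 K) (fun p => f (cons_rV p)) M).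
- rewrite -[X in measurable X]setTI; apply: measurable_cons_rV => //.
  exact: measurable_cube.
- exact: (lebesgue_cube_lty n.+1 K).
- apply: (@measurableT_comp _ _ _ _ (borel_rV R n.+1)) => //.
    exact: continuous_measurable_rV.
  exact: measurable_cons_rV.
- by move=> p; exact: fM.
- by move=> p; exact: supported_cube.
Qed.

Lemma integral_cons : (\int[lebesgue_rV R n.+1]_x (f x)%:E =
  \int[@lebesgue_measure R \x lebesgue_rV R n]_p (f (cons_rV p))%:E)%E.
Proof.
have mf : measurable_fun [set: borel_rV R n.+1] (EFin \o f).
  by apply/measurable_EFinP; exact: continuous_measurable_rV.
have := integral_pushforward (@measurable_cons_rV R n) mf integrable_cons measurableT.
by rewrite preimage_setT; apply.
Qed.

Lemma Rintegral_consl : \int[lebesgue_rV R n.+1]_x f x =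
  \int[@lebesgue_measure R]_t \int[lebesgue_rV R n]_y f (cons_rV (t, y)).
Proof.
rewrite /Rintegral; congr fine; rewrite integral_cons -integral12_prod_meas1; last first.
  exact: integrable_cons.
apply: eq_integral => t _; rewrite /fubini_F fineK//.
apply: integrable_fin_num => //.
exact: integrable_continuous (@slicer_continuous t) (@slicer_supported t).
Qed.

Lemma Rintegral_consr : \int[lebesgue_rV R n.+1]_x f x =
  \int[lebesgue_rV R n]_y \int[@lebesgue_measure R]_t f (cons_rV (t, y)).
Proof.
have [M fM] := supported_bounded cf sf.
rewrite /Rintegral; congr fine; rewrite integral_cons -integral21_prod_meas1; last first.
  exact: integrable_cons.
apply: eq_integral => y _; rewrite /fubini_G fineK//.
apply: integrable_fin_num => //.
apply: (@integrable_supported _ _ (@lebesgue_measure R) `[- K, K]%classic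
  (fun t => f (cons_rV (t, y))) M).
- exact: measurable_itv.
- by rewrite [X in (X < _)%E]lebesgue_measure_itv/=; case: ifP => _; rewrite ltry.
- by apply: continuous_measurable_fun; exact: slicel_continuous.
- by move=> t; exact: fM.
- move=> t; apply: contra_neqP => /negP; rewrite /= in_itv/= -ler_norml -ltNge.
  exact: slicel_supported.
Qed.

End slices.

End lebesgue_rV_theory.
Arguments cube {R} n K.

(** * Integration by parts, translations and null sets *)

(** The derivative of [F] in direction [w] is computed on any line, in particular
    along a coordinate slice. *)
Lemma derive_affine {R : realType} (V W : normedModType R) (p : V -> W) (a v : V)
    (w : W) (F : W -> R) :
  (forall h : R, p (h *: v + a) = h *: w + p a) -> derivable F (p a) w ->
  derivable (F \o p) a v /\ 'D_v (F \o p) a = 'D_w F (p a).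
Proof.
move=> pE dF.
have E : (fun h : R => h^-1 *: (((F \o p) \o shift a) (h *: v) - (F \o p) a)) =
         (fun h : R => h^-1 *: ((F \o shift (p a)) (h *: w) - F (p a))).
  by apply/funext => h; rewrite /= pE.
by split; rewrite /derivable /derive E.
Qed.

Lemma poly_roots_seq (R : fieldType) (p : {poly R}) : p != 0 ->
  exists s : seq R, forall t, root p t -> t \in s.
Proof.
have [n] := ubnP (size p); elim: n => // n IH in p * => pn p0.
have [[a pa]|nr] := pselect (exists a, root p a); last first.
  by exists [::] => t pt; case: nr; exists t.
have /factor_theorem[q pE] := pa.
have q0 : q != 0 by apply: contra_neq p0 => q0; rewrite pE q0 mul0r.
have [|s Hs] := IH q _ q0.
  by move: pn; rewrite pE size_Mmonic ?monicXsubC// size_XsubC addn2.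
exists (a :: s) => t; rewrite pE rootM root_XsubC inE => /orP[/Hs ->|->//].
by rewrite orbT.
Qed.

Section integration_rV.
Context {R : realType}.

Lemma Rintegral_derive_supported (f g : R -> R) (K : R) :
  continuous g -> (forall t, derivable f t 1 /\ 'D_1 f t = g t) ->
  (forall t, K < `|t| -> f t = 0) -> (forall t, K < `|t| -> g t = 0) ->
  \int[@lebesgue_measure R]_t g t = 0.
Proof.
move=> cg fg f0 g0; set a := `|K| + 1.
have Ka : K < a by rewrite (le_lt_trans (ler_norm K))// ltrDl.
have a0 : 0 < a by rewrite ltr_wpDl.
have gE : g = g \_ `[- a, a].
  apply/funext => t; rewrite patchE; case: ifPn => // /negP; rewrite inE/= in_itv/=.
  by rewrite -ler_norml => /negP; rewrite -ltNge => /(lt_trans Ka)/g0.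
rewrite gE -Rintegral_mkcond /Rintegral.
have cf : continuous f.
  by move=> t; apply: differentiable_continuous; apply/derivable1_diffP; case: (fg t).
rewrite (@continuous_FTC2 _ g f).
- by rewrite !f0 /= ?subrr// ?normrN (gtr0_norm a0).
- by rewrite gtrN.
- exact: continuous_subspaceT.
- split; first by move=> x _; case: (fg x).
  + exact: cvg_at_right_filter (cf _).
  + exact: cvg_at_left_filter (cf _).
- by move=> t _; rewrite derive1E; case: (fg t).
Qed.

(** Fundamental theorem of calculus in one coordinate, after Fubini. *)
Lemma Rintegral_partial0 n (j : 'I_n) (K : R) (F G : 'rV[R]_n -> R) :
  continuous F -> continuous G -> supported_in K F -> supported_in K G ->
  (forall x, derivable F x (delta_mx 0 j) /\ 'D_(delta_mx 0 j) F x = G x) ->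
  \int[lebesgue_rV R n]_x G x = 0.
Proof.
elim: n => [|n IH] in j F G *; first by case: j.
move=> cF cG sF sG FG; case: (unliftP ord0 j) => [i|] ji.
  rewrite (Rintegral_consl cG sG) (_ : (fun _ => _) = cst 0).
    by rewrite Rintegral_cst// mul0r.
  apply/funext => t; apply: (IH i (fun y => F (cons_rV (t, y)))).
  - exact: slicer_continuous.
  - exact: slicer_continuous.
  - exact: slicer_supported.
  - exact: slicer_supported.
  move=> y; rewrite -(FG (cons_rV (t, y))).2.
  apply: (@derive_affine _ _ _ (fun y => cons_rV (t, y) : 'rV[R]_n.+1)); last first.
    by case: (FG (cons_rV (t, y))).
  move=> h; apply/esym/cons_rVP => [|k].
    by rewrite mxE cons_rV0 !mxE ji mulr0 add0r.
  by rewrite mxE cons_rV_lift ji !mxE/=.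
rewrite (Rintegral_consr cG sG) (_ : (fun _ => _) = cst 0).
  by rewrite Rintegral_cst// mul0r.
apply/funext => y.
apply: (@Rintegral_derive_supported (fun t => F (cons_rV (t, y))) _ K).
- exact: slicel_continuous.
- move=> t; rewrite -(FG (cons_rV (t, y))).2.
  apply: (@derive_affine _ _ _ (fun t => cons_rV (t, y) : 'rV[R]_n.+1)); last first.
    by case: (FG (cons_rV (t, y))).
  move=> h; apply/esym/cons_rVP => [|k].
    by rewrite mxE cons_rV0 !mxE ji eqxx.
  by rewrite mxE cons_rV_lift ji !mxE/= mulr0 add0r.
- exact: slicel_supported.
- exact: slicel_supported.
Qed.

(** Both sides are measures with the same value on half-open intervals. *)
Lemma lebesgue_measure_shift (s : R) (A : set (measurableTypeR R)) : measurable A ->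
  pushforward (@lebesgue_measure R) (fun t : measurableTypeR R => t + s : measurableTypeR R) A =
  lebesgue_measure A.
Proof.
have ms : measurable_fun [set: measurableTypeR R] (fun t : measurableTypeR R => t + s : measurableTypeR R).
  by apply: measurable_funD => //; exact: measurable_cst.
pose m := pushforward (@lebesgue_measure R) (fun t : measurableTypeR R => t + s : measurableTypeR R).
pose mm : {measure set (measurableTypeR R) -> \bar R} :=
  measure_function_pushforward__canonical__measure_function_Measure (@lebesgue_measure R) ms.
move=> mA; apply/esym; apply: (lebesgue_measure_unique (mu := mm)) => //= _ [[a b]] _ <-.
rewrite /mm/= /pushforward (_ : _ @^-1` _ = `]a - s, b - s]%classic).
  rewrite !lebesgue_measure_itv/= !lte_fin ltrD2r; case: ifP => // _.
  by rewrite -!EFinB; congr (_%:E); ring.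
by apply/seteqP; split=> t /=; rewrite !in_itv/= ltrBlDr lerBrDr.
Qed.

Lemma Rintegral_shift (f : R -> R) (K s : R) : continuous f ->
  (forall t, K < `|t| -> f t = 0) ->
  \int[@lebesgue_measure R]_t f (t + s) = \int[@lebesgue_measure R]_t f t.
Proof.
move=> cf f0.
have ms : measurable_fun [set: measurableTypeR R] (fun t : measurableTypeR R => t + s : measurableTypeR R).
  by apply: measurable_funD => //; exact: measurable_cst.
have mf : measurable_fun [set: measurableTypeR R] (EFin \o f).
  by apply/measurable_EFinP; exact: continuous_measurable_fun.
rewrite /Rintegral; congr fine.
have sE : [set t : R | - K <= t <= K] = `[- K, K]%classic.
  by apply/seteqP; split=> t /=; rewrite in_itv.
have intf : (@lebesgue_measure R).-integrable setT ((EFin \o f) \o (fun t => t + s)).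
  have [M fM] : exists M, forall t, `|f t| <= M.
    have : compact (f @` `[- K, K]).
      by apply: continuous_compact; [exact: continuous_subspaceT|exact: segment_compact].
    move=> /compact_bounded[M [_ HM]]; exists (`|M| + 1) => t.
    have M1 : M < `|M| + 1 by rewrite (le_lt_trans (ler_norm _))// ltrDl.
    have [->|ft] := eqVneq (f t) 0; first by rewrite normr0 addr_ge0.
    apply: HM => //; exists t => //=; rewrite in_itv/= -ler_norml.
    by move: ft; apply: contra_neqT; rewrite -ltNge => /f0.
  apply: (@integrable_supported _ _ _ (@lebesgue_measure R) `[- K - s, K - s]%classic
      (fun t => f (t + s)) M) => //.
  - by rewrite [X in (X < _)%E]lebesgue_measure_itv/=; case: ifP => _; rewrite ltry.
  - by apply: measurableT_comp => //; exact: continuous_measurable_fun.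
  - move=> t /=; rewrite in_itv/= lerBlDr lerBrDr -ler_norml.
    by apply: contra_neqT; rewrite -ltNge => /f0.
have := integral_pushforward ms mf intf measurableT.
rewrite preimage_setT => <-; apply: eq_measure_integral => A mA _.
exact: lebesgue_measure_shift.
Qed.

Lemma supported_shift n (K : R) (f : 'rV[R]_n -> R) (eta : 'rV[R]_n) :
  supported_in K f -> supported_in (K + \sum_i `|eta 0 i|) (fun x => f (x + eta)).
Proof.
move=> sf x i Ki; apply: (sf _ i); rewrite mxE.
have := lerB_normD (x 0 i) (eta 0 i); apply: lt_le_trans.
rewrite ltrBrDr (le_lt_trans _ Ki)// lerD2l (bigD1 i)//= lerDl.
exact: sumr_ge0.
Qed.

Lemma continuous_shift_rV n (f : 'rV[R]_n -> R) (eta : 'rV[R]_n) :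
  continuous f -> continuous (fun x : 'rV[R]_n => f (x + eta)).
Proof.
move=> cf x; have h : continuous (fun z : 'rV[R]_n => z + eta).
  apply: continuous_rV => i; under eq_fun do rewrite mxE.
  move=> z; apply: (@continuousD _ R^o _ (fun z : 'rV[R]_n => z 0 i) (fun=> eta 0 i)).
    exact: coord_continuous.
  exact: cst_continuous.
exact: (cvg_comp _ _ (h x) (cf (x + eta))).
Qed.

(** Fubini reduces the translation to its components, which are moved one at a time:
    first the coordinate 0, then the others by induction. *)
Lemma Rintegral_shift_rV n (f : 'rV[R]_n -> R) (K : R) (eta : 'rV[R]_n) :
  continuous f -> supported_in K f ->
  \int[lebesgue_rV R n]_x f (x + eta) = \int[lebesgue_rV R n]_x f x.
Proof.
elim: n => [|n IH] in f eta *.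
  move=> _ _; congr Rintegral; apply/funext => x; congr f; apply/rowP => -[] //.
move=> cf sf; pose e' : 'rV[R]_n := \row_j eta 0 (lift ord0 j).
pose eta0 : 'rV[R]_n.+1 := cons_rV (0, e').
have etaE p : (cons_rV p : 'rV[R]_n.+1) + eta = cons_rV (p.1 + eta 0 0, p.2 + e').
  by rewrite [in LHS](cons_rV_surj eta) -cons_rVD.
have eta0E p : (cons_rV p : 'rV[R]_n.+1) + eta0 = cons_rV (p.1, p.2 + e').
  by rewrite -cons_rVD/= addr0.
rewrite (Rintegral_consr (continuous_shift_rV (eta := eta) cf) (supported_shift (eta := eta) sf)).
transitivity (\int[lebesgue_rV R n.+1]_x f (x + eta0)).
  rewrite (Rintegral_consr (continuous_shift_rV (eta := eta0) cf) (supported_shift (eta := eta0) sf)).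
  apply: eq_Rintegral => y _; under eq_Rintegral do rewrite etaE.
  under [RHS]eq_Rintegral do rewrite eta0E.
  apply: (Rintegral_shift (f := fun t => f (cons_rV (t, y + e'))) (K := K)).
    exact: slicel_continuous.
  exact: slicel_supported.
rewrite (Rintegral_consl (continuous_shift_rV (eta := eta0) cf) (supported_shift (eta := eta0) sf)).
rewrite (Rintegral_consl cf sf).
apply: eq_Rintegral => t _; under eq_Rintegral do rewrite eta0E.
apply: (IH (fun y => f (cons_rV (t, y)))).
  exact: slicer_continuous.
exact: slicer_supported.
Qed.

Lemma Rintegral_gt0 n (f : 'rV[R]_n -> R) (K : R) : continuous f ->
  supported_in K f -> (forall x, 0 <= f x) -> 0 < f 0 ->
  0 < \int[lebesgue_rV R n]_x f x.
Proof.
move=> cf sf f0 f00.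
have [e /= e0 fe] : exists2 e : R, 0 < e & forall x, cube n (e / 2) x -> f 0 / 2 <= f x.
  have /nbhs_ballP[e /= e0 he] : \forall x \near (0 : 'rV[R]_n), f 0 / 2 <= f x.
    have : f 0 / 2 < f 0 by rewrite ltr_pdivrMr// ltr_pMr// ltr1n.
    by move=> h; apply: (cvgr_ge _ (cf 0)).
  exists e => // x xe; apply: he; split=> // i j; rewrite ord1 mxE /ball/= sub0r normrN.
  by rewrite (le_lt_trans (xe j))// ltr_pdivrMr// ltr_pMr// ltr1n.
have intf := integrable_continuous cf sf.
rewrite -lte_fin /Rintegral fineK; last exact: integrable_fin_num.
apply: (@lt_le_trans _ _ (\int[lebesgue_rV R n]_x ((f 0 / 2) * \1_(cube n (e / 2)) x)%:E)%E).
  under eq_integral do rewrite EFinM.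
  rewrite ge0_integralZl//; last first.
  - by rewrite lee_fin divr_ge0// ltW.
  - by apply/measurable_EFinP; apply: measurable_indic; exact: measurable_cube.
  rewrite integral_indic//; last exact: measurable_cube.
  rewrite setIT [X in (_ * X)%E]lebesgue_cube ?divr_gt0// -EFinM lte_fin mulr_gt0 ?divr_gt0//.
  by rewrite exprn_gt0// mulrn_wgt0// divr_gt0.
apply: ge0_le_integral => //.
- by move=> x _; rewrite lee_fin mulr_ge0// ?divr_ge0// ltW.
- apply/measurable_EFinP; apply: measurable_funM => //.
  by apply: measurable_indic; exact: measurable_cube.
- by apply/measurable_EFinP; exact: continuous_measurable_rV.
- move=> x _; rewrite lee_fin indicE; have [|_] := boolP (x \in _).
    by rewrite inE mulr1 => /fe.
  by rewrite mulr0.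
Qed.

(** The zero set of a function that restricts to a polynomial on every line is
    negligible: by Fubini, since outside the finitely many zeros of a nonzero
    restriction to the first axis direction the slices are negligible. *)
Lemma zero_set_null n (f : 'rV[R]_n -> R) (x0 : 'rV[R]_n) : continuous f ->
  (forall x y, exists p : {poly R}, forall t : R, f (x + t *: y) = p.[t]) ->
  f x0 != 0 -> lebesgue_rV R n (f @^-1` [set 0]) = 0%E.
Proof.
elim: n => [|n IH] in f x0 *.
  move=> _ _ fx0; rewrite [X in lebesgue_rV _ _ X](_ : _ = set0) ?measure0//.
  apply/seteqP; split=> // x /= fx; move: fx0; rewrite (_ : x0 = x) ?fx ?eqxx//.
  by apply/rowP => -[].
move=> cf pf fx0; rewrite lebesgue_rVS /product_measure1.
have mf : measurable_fun [set: borel_rV R n.+1] f by exact: continuous_measurable_rV.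
set Z := _ @^-1` _.
have mZ : measurable Z.
  rewrite -[Z]setTI; apply: measurable_cons_rV => //.
  by rewrite -[X in measurable X]setTI; apply: mf.
pose y0 : 'rV[R]_n := \row_j x0 0 (lift ord0 j).
have [p pE] := pf (cons_rV (0, y0)) (cons_rV (1, 0)).
have pE' t : f (cons_rV (t, y0)) = p.[t].
  by rewrite -pE cons_rVZ -cons_rVD/= mulr1 add0r scaler0 addr0.
have p0 : p != 0.
  by apply: contra_neq fx0 => p0; rewrite (cons_rV_surj x0) pE' p0 horner0.
rewrite (_ : (0 = \int[@lebesgue_measure R]_t 0)%E); last by rewrite integral0.
apply: ae_eq_integral => //; first exact: measurable_fun_xsection.
have [s sp] := poly_roots_seq p0.
have cs : countable [set` s] by apply: finite_set_countable; exact: finite_seq.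
exists [set` s]; split; [exact: countable_measurable|exact: countable_lebesgue_measure0|].
move=> t /= /not_implyP[_ Zt]; apply: sp; apply/negPn/negP => pt; apply: Zt.
rewrite (_ : xsection Z t = (fun y => f (cons_rV (t, y))) @^-1` [set 0]).
  apply: (IH _ y0); last by rewrite pE'.
    exact: slicer_continuous.
  move=> x y; have [q qE] := pf (cons_rV (t, x)) (cons_rV (0, y)).
  by exists q => r; rewrite -qE cons_rVZ -cons_rVD/= mulr0 addr0.
by rewrite /xsection/=; apply/seteqP; split=> y /=; rewrite inE.
Qed.

End integration_rV.

(** * Smooth bump functions *)

Section smooth_functions.
Context {R : realType} {d : nat}.
Implicit Types f g : 'rV[R]_d -> R.

(** Unlike [smooth], this notion has finite orders, which makes closure under sums and
    products provable by induction on [k]. *)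
Fixpoint Ck (k : nat) f : Prop := continuous f /\
  if k is k'.+1 then
    forall j, (forall x, derivable f x (delta_mx 0 j)) /\ Ck k' (real_partial j f)
  else True.

Lemma CkW k f : Ck k.+1 f -> Ck k f.
Proof.
elim: k f => [|k IH] f [cf fS]; split=> // j.
by have [df /IH] := fS j.
Qed.

Lemma Ck_continuous k f : Ck k f -> continuous f.
Proof. by case: k => [|k] []. Qed.

Lemma Ck_smooth f : (forall k, Ck k f) -> smooth f.
Proof.
move=> fk s; have gk : forall k, Ck k (foldr (@real_partial R d) f s).
  elim: s => //= j s IH k; have [_ H] := IH k.+1.
  by have [] := H j.
by have [cg H] := gk 1%N; split=> // j x; have [] := H j.
Qed.

Lemma CkD k f g : Ck k f -> Ck k g -> Ck k (fun x => f x + g x).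
Proof.
elim: k f g => [|k IH] f g [cf fS] [cg gS]; split => //.
- by move=> x; apply: continuousD; [exact: cf|exact: cg].
- by move=> x; apply: continuousD; [exact: cf|exact: cg].
move=> j; have [df fk] := fS j; have [dg gk] := gS j; split.
  by move=> x; apply: derivableD.
rewrite (_ : real_partial j _ = fun x => real_partial j f x + real_partial j g x).
  exact: IH.
by apply/funext => x; rewrite /real_partial deriveD.
Qed.

Lemma CkM k f g : Ck k f -> Ck k g -> Ck k (fun x => f x * g x).
Proof.
elim: k f g => [|k IH] f g.
  by move=> [cf _] [cg _]; split=> // x; apply: continuousM; [exact: cf|exact: cg].
move=> fk gk; have fk' := CkW fk; have gk' := CkW gk.
move: fk gk => [cf fS] [cg gS]; split.
  by move=> x; apply: continuousM; [exact: cf|exact: cg].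
move=> j; have [df fk] := fS j; have [dg gk] := gS j; split.
  by move=> x; apply: derivableM.
rewrite (_ : real_partial j _ =
    fun x => f x * real_partial j g x + g x * real_partial j f x).
  by apply: CkD; apply: IH.
by apply/funext => x; rewrite /real_partial deriveM.
Qed.

Lemma Ck_cst k (c : R) : Ck k (fun=> c).
Proof.
elim: k c => [|k IH] c; split=> //; do ?exact: cst_continuous.
move=> j; split; first by move=> x; exact: derivable_cst.
rewrite (_ : real_partial j _ = fun=> 0); first exact: IH.
by apply/funext => x; rewrite /real_partial derive_cst.
Qed.

Lemma Ck_prod k (I : Type) (s : seq I) (F : I -> 'rV[R]_d -> R) :
  (forall i, Ck k (F i)) -> Ck k (fun x => \prod_(i <- s) F i x).
Proof.
move=> Fk; elim: s => [|i s IH].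
  by under eq_fun do rewrite big_nil; exact: Ck_cst.
by under eq_fun do rewrite big_cons; exact: CkM.
Qed.

Lemma smooth_partial j f : smooth f -> smooth (real_partial j f).
Proof. by move=> sf s; have := sf (rcons s j); rewrite foldr_rcons. Qed.

Lemma smooth_continuous f : smooth f -> continuous f.
Proof. by move=> sf; have [] := sf [::]. Qed.

Lemma smooth_derivable f : smooth f -> forall j x, derivable f x (delta_mx 0 j).
Proof. by move=> sf; have [] := sf [::]. Qed.

Lemma supported_partial (K : R) j f : supported_in K f -> supported_in K (real_partial j f).
Proof.
move=> sf x i Kx; rewrite /real_partial -(derive_cst (0 : R) x (delta_mx 0 j)).
apply: near_eq_derive.
have : \forall y \near x, K < `|(y : 'rV[R]_d) 0 i|.
  have c : `|y 0 i| @[y --> x] --> `|x 0 i|.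
    by apply: cvg_norm; exact: coord_continuous.
  exact: (cvgr_gt _ c).
by apply: filterS => y /sf.
Qed.

End smooth_functions.

Lemma derive_scalar {R : realType} (f : R -> R) (t v : R) : derivable f t 1 ->
  derivable f t v /\ 'D_v f t = v * 'D_1 f t.
Proof.
move=> /derivable1_diffP df; split; first exact: diff_derivable.
by rewrite !deriveE// -[in LHS](mulr1 v) -[v * 1]/(v *: 1) linearZ.
Qed.

Section flat_function.
Context {R : realType}.
Implicit Types p : {poly R}.

(** The family of functions [p (1 / t) exp (- 1 / t)] extended by 0 to [t <= 0]
    is closed under derivation, see [is_derive_flat]; this is why a polynomial is
    carried along. *)
Definition flat p (t : R) : R := if 0 < t then p.[t^-1] * expR (- t^-1) else 0.

Lemma expR_ge_pow (s : R) (n : nat) : 0 < s ->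
  s ^+ n.+1 * expR (- s) <= n.+1%:R ^+ n.+1.
Proof.
move=> s0; rewrite expRN ler_pdivrMr ?expR_gt0//.
have -> : expR s = expR (s / n.+1%:R) ^+ n.+1.
  by rewrite -expRM_natl mulrC divfK.
have s_le : s <= n.+1%:R * expR (s / n.+1%:R).
  rewrite -ler_pdivrMl// mulrC (le_trans _ (expR_ge1Dx _))// lerDr ler01//.
by rewrite -exprMn lerXn2r ?nnegrE ?(ltW s0)// mulr_ge0 ?expR_ge0.
Qed.

(** Exponential decay beats the polynomial; the quadratic bound forces the derivative
    at 0 to vanish. *)
Lemma flat_bound p : exists C : R, forall t : R, 0 < t -> `|flat p t| <= C * t ^+ 2.
Proof.
exists (\sum_(i < size p) `|p`_i| * i.+2%:R ^+ i.+2) => t t0.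
rewrite /flat t0 horner_coef normrM (gtr0_norm (expR_gt0 _)).
set s := t^-1; have s0 : 0 < s by rewrite invr_gt0.
rewrite -[t]invrK -/s exprVn ler_pdivlMr ?exprn_gt0// -mulrA.
rewrite (le_trans (ler_wpM2r _ (ler_norm_sum _ _ _)))//.
  by rewrite mulr_ge0 ?expR_ge0// exprn_ge0// ltW.
rewrite mulr_suml; apply: ler_sum => i _.
rewrite normrM normrX (gtr0_norm s0) -mulrA ler_wpM2l//.
rewrite (le_trans _ (expR_ge_pow i.+1 s0))// !exprS le_eqVlt; apply/orP; left.
by apply/eqP; rewrite expr0; ring.
Qed.

Lemma is_derive_flat p (t : R) :
  is_derive t 1 (flat p) (flat ('X^2 * (p - p^`())) t).
Proof.
case: (ltgtP t 0) => t0.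
- rewrite [flat _ t]/flat ltNge (ltW t0)/=.
  apply: (near_eq_is_derive (f := cst 0)).
    near=> y; rewrite /flat ltNge (_ : y <= 0)//; apply: ltW; near: y.
    exact: lt_nbhsl.
- apply: (near_eq_is_derive (f := fun t : R => p.[t^-1] * expR (- t^-1))).
    near=> y; rewrite /flat ifT//; near: y; exact: lt_nbhsr.
  rewrite /flat t0.
  have dV : is_derive t 1 (fun t : R => t^-1) (- t ^- 2).
    apply: is_derive_eq; first by apply: (is_deriveV (f := id)); rewrite gt_eqF.
    by rewrite /GRing.scale/= mulr1.
  have dp : is_derive t 1 (fun t : R => p.[t^-1]) (p^`().[t^-1] * - t ^- 2).
    exact: (is_derive1_comp (f := horner p)).
  have de : is_derive t 1 (fun t : R => expR (- t^-1)) (expR (- t^-1) * t ^- 2).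
    rewrite -[t ^- 2]opprK.
    exact: (is_derive1_comp (f := expR) (g := fun t => - t^-1)).
  apply: (is_derive_eq (is_deriveM dp de)).
  rewrite !hornerE/= /GRing.scale/= exprVn.
  by ring.
- rewrite t0 [flat _ 0]/flat ltxx.
  have [C HC] := flat_bound p.
  have c0 : C * `|h| @[h --> (0 : R)^'] --> (0 : R).
    have : C * `|h| @[h --> (0 : R)^'] --> C * `|0 : R|.
      apply: cvgMr; apply: cvg_norm; apply: nbhs_dnbhs.
    by rewrite normr0 mulr0.
  have dq : h^-1 *: (flat p (h *: 1 + 0) - flat p 0) @[h --> 0^'] --> 0.
    apply: (@squeeze_cvgr _ _ _ _ (fun h => - (C * `|h|)) (fun h => C * `|h|)).
    - near=> h; rewrite -ler_norml /GRing.scale/= mulr1 addr0 {2}/flat ltxx subr0.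
      have h0 : h != 0 by near: h; exact: nbhs_dnbhs_neq.
      rewrite normrM normfV ler_pdivrMl ?normr_gt0//.
      case: (ltP 0 h) => hp.
        by rewrite (le_trans (HC h hp))// gtr0_norm//; rewrite expr2; lra.
      rewrite {1}/flat ltNge hp/= normr0 mulr_ge0// mulr_ge0//.
      by have := HC 1 ltr01; rewrite expr1n mulr1; exact: le_trans.
    - have : - (C * `|h|) @[h --> (0 : R)^'] --> - (0 : R) by apply: cvgN; exact: c0.
      by rewrite oppr0.
    - exact: c0.
  apply: DeriveDef; first by apply/cvg_ex; exists 0.
  exact: (cvg_lim _ dq).
Unshelve. all: by end_near. Qed.

Lemma flat_ge0 (t : R) : 0 <= flat 1 t.
Proof. by rewrite /flat; case: ifP => // _; rewrite hornerC mul1r expR_ge0. Qed.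

Lemma flat_gt0 (t : R) : 0 < t -> 0 < flat 1 t.
Proof. by move=> t0; rewrite /flat t0 hornerC mul1r expR_gt0. Qed.

Lemma flat_le0 p (t : R) : t <= 0 -> flat p t = 0.
Proof. by move=> t0; rewrite /flat ltNge t0. Qed.

Lemma continuous_flat p : continuous (flat p).
Proof.
move=> t; apply: differentiable_continuous; apply/derivable1_diffP.
by case: (is_derive_flat p t).
Qed.

Lemma Ck_flat d k p (i : 'I_d) (a c : R) :
  Ck k (fun x : 'rV[R]_d => flat p (a + c * x 0 i)).
Proof.
elim: k p => [|k IH] p.
  split=> //; move=> x.
  have h : {for x, continuous (fun x : 'rV[R]_d => a + c * x 0 i)}.
    apply: continuousD; first exact: cst_continuous.
    by apply: continuousM; [exact: cst_continuous|exact: coord_continuous].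
  exact: (cvg_comp _ _ h (@continuous_flat p _)).
have cf : continuous (fun x : 'rV[R]_d => flat p (a + c * x 0 i)).
  exact: Ck_continuous (IH p).
split=> // j.
have D x : derivable (fun x : 'rV[R]_d => flat p (a + c * x 0 i)) x (delta_mx 0 j) /\
  'D_(delta_mx 0 j) (fun x : 'rV[R]_d => flat p (a + c * x 0 i)) x =
  (c * (i == j)%:R) * flat ('X^2 * (p - p^`())) (a + c * x 0 i).
  have [dp pE] := is_derive_flat p (a + c * x 0 i).
  have [dp' pE'] := derive_scalar (c * (i == j)%:R) dp.
  rewrite -pE -pE'; apply: (@derive_affine _ _ _ (fun x : 'rV[R]_d => a + c * x 0 i)).
    by move=> h; rewrite !mxE eqxx/= /GRing.scale/= eq_sym; ring.
  exact: dp'.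
split; first by move=> x; case: (D x).
rewrite (_ : real_partial j _ = fun x => (c * (i == j)%:R) * flat ('X^2 * (p - p^`())) (a + c * x 0 i)).
  by apply: CkM; [exact: Ck_cst|exact: IH].
by apply/funext => x; case: (D x).
Qed.

End flat_function.

Section bump.
Context {R : realType} {d : nat}.

Definition smooth_bump (r : R) (x : 'rV[R]_d) : R :=
  \prod_i (flat 1 (r + 1 * x 0 i) * flat 1 (r + (-1) * x 0 i)).

Lemma smooth_bump_smooth r : smooth (smooth_bump r).
Proof.
apply: Ck_smooth => k; apply: Ck_prod => i.
by apply: CkM; exact: Ck_flat.
Qed.

Lemma smooth_bump_supported r : supported_in r (smooth_bump r).
Proof.
move=> x i; rewrite /smooth_bump (bigD1 i)//= ltNge => /negP rx.
apply/eqP; rewrite !mulf_eq0; apply/orP; left.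
rewrite mul1r mulN1r; case: (leP (r + x 0 i) 0) => h1; first by rewrite flat_le0 ?eqxx.
case: (leP (r - x 0 i) 0) => h2; first by rewrite (flat_le0 _ h2) eqxx orbT.
by exfalso; apply: rx; rewrite ler_norml; lra.
Qed.

Lemma smooth_bump_ge0 r x : 0 <= smooth_bump r x.
Proof. by apply: prodr_ge0 => i _; rewrite mulr_ge0 ?flat_ge0. Qed.

Lemma smooth_bump_gt0 r : 0 < r -> 0 < smooth_bump r 0.
Proof.
move=> r0; apply: prodr_gt0 => i _; rewrite mxE !mulr0 addr0.
by rewrite mulr_gt0 ?flat_gt0.
Qed.

End bump.

(** * Solutions are transforms of measures carried by the characteristic set *)

Section continuous_real_functions.
Context {R : realType} {T : topologicalType}.
Implicit Types f g : T -> R.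

Lemma continuous_funD f g : continuous f -> continuous g ->
  continuous (fun x => f x + g x).
Proof. by move=> cf cg x; apply: (@continuousD _ R^o); [exact: cf|exact: cg]. Qed.

Lemma continuous_funB f g : continuous f -> continuous g ->
  continuous (fun x => f x - g x).
Proof. by move=> cf cg x; apply: (@continuousB _ R^o); [exact: cf|exact: cg]. Qed.

Lemma continuous_funM f g : continuous f -> continuous g ->
  continuous (fun x => f x * g x).
Proof. by move=> cf cg x; apply: continuousM; [exact: cf|exact: cg]. Qed.

Lemma continuous_funZ (a : R) f : continuous f -> continuous (fun x => a * f x).
Proof. by move=> cf; apply: continuous_funM => //; exact: cst_continuous. Qed.

End continuous_real_functions.

Section finite_measures.
Context {R : realType} {dT : measure_display} {T : measurableType dT}.

Lemma integrable_bounded (m : {finite_measure set T -> \bar R}) (f : T -> R) :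
  bounded_measurable f -> m.-integrable setT (EFin \o f).
Proof.
move=> [mf [M fM]]; apply: (@integrable_supported R _ T m setT f M) => //.
by rewrite ltey_eq fin_num_measure.
Qed.

Lemma bounded_convergence_Rintegral (m : {finite_measure set T -> \bar R}) :
  bounded_convergence (fun f : T -> R => \int[m]_x f x).
Proof.
split=> [a f g bf bg|f_ f M mf fM ff].
  rewrite RintegralD//; [|exact/integrable_bounded/bounded_measurableZ
    |exact: integrable_bounded].
  by rewrite RintegralZl//; exact: integrable_bounded.
have mlf : measurable_fun setT f.
  by have [] := bounded_measurable_lim mf fM ff.
have intM : m.-integrable setT (EFin \o (fun=> M)).
  by apply: integrable_bounded; exact: bounded_measurable_cst.
have [intf _ cf] : [/\ m.-integrable setT (EFin \o f),
    (\int[m]_x `|(f_ n x)%:E - (f x)%:E|)%E @[n --> \oo] --> 0%E &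
    (\int[m]_x (f_ n x)%:E)%E @[n --> \oo] --> (\int[m]_x (f x)%:E)%E].
  apply: (@dominated_convergence _ _ _ m setT measurableT
      (fun n => EFin \o f_ n) (EFin \o f) (EFin \o (fun=> M))) => //.
  - by move=> n; exact/measurable_EFinP.
  - exact/measurable_EFinP.
  - by apply: aeW => x _; apply: cvg_EFin; [exact: nearW|exact: ff].
  - by apply: aeW => x n _; rewrite lee_fin.
rewrite /Rintegral; apply: fine_cvg.
by rewrite fineK//; exact: integrable_fin_num.
Qed.

(** Both parts of the Jordan decomposition are finite measures, to which dominated
    convergence applies. *)
Lemma bounded_convergence_charge (nu : {charge set T -> \bar R}) :
  bounded_convergence (charge_integral nu).
Proof.
rewrite /charge_integral; set mp := jordan_pos _; set mn := jordan_neg _.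
have [Dp Cp] := bounded_convergence_Rintegral mp.
have [Dn Cn] := bounded_convergence_Rintegral mn.
split=> [a f g bf bg|f_ f M mf fM ff].
  by rewrite Dp// Dn//; ring.
by apply: cvgB; [exact: Cp ff|exact: Cn ff].
Qed.

Context {n : nat}.

Lemma integrable_kernel (m : {finite_measure set T -> \bar R})
    (k : T * borel_rV R n -> R) (phi : 'rV[R]_n -> R) (K : R) :
  bounded_measurable k -> continuous phi -> supported_in K phi ->
  (m \x lebesgue_rV R n)%E.-integrable setT
    (EFin \o (fun p : T * borel_rV R n => k p * phi p.2)).
Proof.
move=> [mk [M kM]] cphi sphi; have [N phiN] := supported_bounded cphi sphi.
apply: (@integrable_supported R _ _ (m \x lebesgue_rV R n)%E
    (setT `*` cube n K) _ (M * N)).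
- by apply: measurableX => //; exact: measurable_cube.
- have mE := @product_measure1E _ _ _ _ _ m (lebesgue_rV R n) _ _ measurableT
    (@measurable_cube R n K).
  rewrite [X in (X < _)%E]mE lte_mul_pinfty//; first by rewrite fin_num_measure.
  exact: lebesgue_cube_lty.
- apply: measurable_funM => //; apply: measurableT_comp => //.
  exact: continuous_measurable_rV.
- by move=> p; rewrite normrM ler_pM.
- move=> [x xi] /=; rewrite mulf_eq0 negb_or => /andP[_ h]; split=> //.
  exact: supported_cube h.
Qed.

Lemma Rintegral_kernel_swap (m : {finite_measure set T -> \bar R})
    (k : T * borel_rV R n -> R) (phi : 'rV[R]_n -> R) (K : R) :
  bounded_measurable k -> continuous phi -> supported_in K phi ->
  \int[lebesgue_rV R n]_xi ((\int[m]_x k (x, xi)) * phi xi) =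
  \int[m]_x \int[lebesgue_rV R n]_xi (k (x, xi) * phi xi).
Proof.
move=> bk cphi sphi; have ik := integrable_kernel m bk cphi sphi.
have [mk [M kM]] := bk; have [N phiN] := supported_bounded cphi sphi.
have bk1 xi : bounded_measurable (fun x => k (x, xi)).
  by split; [exact: measurableT_comp|exists M => x; exact: kM].
rewrite /Rintegral; congr fine.
transitivity (\int[lebesgue_rV R n]_xi \int[m]_x (k (x, xi) * phi xi)%:E)%E.
  apply: eq_integral => xi _.
  under [RHS]eq_integral do rewrite mulrC EFinM.
  have ikx := integrable_bounded m (bk1 xi).
  rewrite (integralZl measurableT ikx).
  by rewrite EFinM fineK; [exact: muleC|exact: integrable_fin_num ikx].
have := Fubini ik; rewrite /= => <-.
apply: eq_integral => x _; rewrite fineK//; apply: integrable_fin_num => //.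
apply: (@integrable_supported R _ _ (lebesgue_rV R n) (cube n K) _ (M * N)).
- exact: measurable_cube.
- exact: lebesgue_cube_lty.
- apply: measurable_funM; first exact: measurableT_comp.
  exact: continuous_measurable_rV.
- by move=> p; rewrite normrM ler_pM.
- move=> xi /=; rewrite mulf_eq0 negb_or => /andP[_ h].
  exact: supported_cube h.
Qed.

Lemma integrable_kernel_avg (m : {finite_measure set T -> \bar R})
    (k : T * borel_rV R n -> R) (phi : 'rV[R]_n -> R) (K : R) :
  bounded_measurable k -> continuous phi -> supported_in K phi ->
  (lebesgue_rV R n).-integrable setT
    (EFin \o (fun xi => (\int[m]_x k (x, xi)) * phi xi)).
Proof.
move=> bk cphi sphi; have ik := integrable_kernel m bk cphi sphi.
have bk1 xi : bounded_measurable (fun x => k (x, xi)).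
  have [mk [M kM]] := bk.
  by split; [exact: measurableT_comp|exists M => x; exact: kM].
have mf := measurable_int _ ik.
rewrite (_ : EFin \o _ = fubini_G m (EFin \o (fun p : T * borel_rV R n => k p * phi p.2))).
  apply/integrableP; split; first exact: measurable_fubini_G ik.
  apply: le_lt_trans ((integrable21ltyP m (lebesgue_rV R n) mf).1 ik).
  apply: ge0_le_integral => //.
  - by apply: measurableT_comp => //; exact: measurable_fubini_G ik.
  - apply: (measurable_fun_fubini_tonelli_G (m1 := m)
      (abse \o (EFin \o (fun p : T * borel_rV R n => k p * phi p.2)))) => //.
      exact: measurableT_comp.
    by move=> p; exact: abse_ge0.
  - move=> xi _; apply: le_abse_integral => //.
    exact: (measurableT_comp mf).
apply/funext => xi; rewrite /fubini_G /=.
under [RHS]eq_integral do rewrite mulrC EFinM.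
have ikx := integrable_bounded m (bk1 xi).
rewrite (integralZl measurableT ikx).
by rewrite EFinM fineK; [exact: muleC|exact: integrable_fin_num ikx].
Qed.

(** With [k] the cosine or the sine of the pairing this is the exchange formula for the
    Fourier transform, the transform moving from the measure to the test function. *)
Lemma charge_integral_kernel_swap (nu : {charge set T -> \bar R})
    (k : T * borel_rV R n -> R) (phi : 'rV[R]_n -> R) (K : R) :
  bounded_measurable k -> continuous phi -> supported_in K phi ->
  \int[lebesgue_rV R n]_xi (charge_integral nu (fun x => k (x, xi)) * phi xi) =
  charge_integral nu (fun x => \int[lebesgue_rV R n]_xi (k (x, xi) * phi xi)).
Proof.
move=> bk cphi sphi; rewrite /charge_integral.
rewrite -!(Rintegral_kernel_swap _ bk cphi sphi).
rewrite -RintegralB//; [|exact: integrable_kernel_avg bk cphi sphi..].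
by apply: eq_Rintegral => xi _; rewrite mulrBl.
Qed.

Lemma bounded_kernel_transform
    (k : T * borel_rV R n -> R) (phi : 'rV[R]_n -> R) (K : R) (x0 : T) :
  bounded_measurable k -> continuous phi -> supported_in K phi ->
  bounded_measurable (fun x => \int[lebesgue_rV R n]_xi (k (x, xi) * phi xi)).
Proof.
(* The point mass only serves to obtain measurability in the parameter from Fubini. *)
move=> bk cphi sphi; have ik := integrable_kernel (\d_x0) bk cphi sphi.
have [mk [M kM]] := bk; have [N phiN] := supported_bounded cphi sphi.
split.
  apply: (measurableT_comp (f := fine)) => //.
  exact: measurable_fubini_F ik.
exists (M * N * fine (lebesgue_rV R n (cube n K))) => x.
have mkx : measurable_fun [set: borel_rV R n] (fun xi => k (x, xi) * phi xi).
  apply: measurable_funM; first exact: measurableT_comp.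
  exact: continuous_measurable_rV.
have MN xi : `|k (x, xi) * phi xi| <= M * N by rewrite normrM ler_pM.
have kc xi : k (x, xi) * phi xi != 0 -> cube n K xi.
  by rewrite mulf_eq0 negb_or => /andP[_ h]; exact: supported_cube h.
have ix : (lebesgue_rV R n).-integrable setT (EFin \o (fun xi => k (x, xi) * phi xi)).
  apply: (@integrable_supported R _ _ (lebesgue_rV R n) (cube n K) _ (M * N)) => //.
    exact: measurable_cube.
  exact: lebesgue_cube_lty.
have i1 : (lebesgue_rV R n).-integrable setT (EFin \o (\1_(cube n K) : borel_rV R n -> R)).
  apply: (@integrable_supported R _ _ (lebesgue_rV R n) (cube n K) _ 1) => //.
  - exact: measurable_cube.
  - exact: lebesgue_cube_lty.
  - by apply: measurable_indic; exact: measurable_cube.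
  - by move=> y; rewrite indicE; case: (_ \in _); rewrite ?normr1 ?normr0.
  - by move=> y; rewrite indicE pnatr_eq0 eqb0 negbK inE.
rewrite (le_trans (le_normr_Rintegral _ ix))//.
have -> : fine (lebesgue_rV R n (cube n K)) = \int[lebesgue_rV R n]_xi \1_(cube n K) xi.
  by rewrite /Rintegral integral_indic ?setIT//; exact: measurable_cube.
rewrite -RintegralZl//; apply: le_Rintegral => //.
- have := integrable_abse ix; apply: eq_integrable => // y _ /=.
- have := integrableZl measurableT (M * N) i1; apply: eq_integrable => // y _ /=.
- move=> y _; rewrite indicE; have [yK|yK] := boolP (y \in _).
    by rewrite mulr1.
  rewrite mulr0 normr_le0; apply: contraNT yK => /kc; rewrite inE//.
Qed.

End finite_measures.

Section transform.
Context {R : realType} {d : nat}.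
Implicit Types (phi : 'rV[R]_d -> R) (x xi : 'rV[R]_d).

(** The real and imaginary parts of the Fourier transform of [phi]. *)
Definition cosT phi x := \int[lebesgue_rV R d]_xi (cos (dotv x xi) * phi xi).
Definition sinT phi x := \int[lebesgue_rV R d]_xi (sin (dotv x xi) * phi xi).

Lemma measurable_dotv2 : measurable_fun [set: borel_rV R d * borel_rV R d]
  (fun p : borel_rV R d * borel_rV R d => dotv p.1 p.2 : R).
Proof.
apply: measurable_sum => i; apply: measurable_funM.
  exact: (measurableT_comp (measurable_coord_rV i) measurable_fst).
exact: (measurableT_comp (measurable_coord_rV i) measurable_snd).
Qed.

Lemma bounded_cos_kernel : bounded_measurable
  (fun p : borel_rV R d * borel_rV R d => cos (dotv p.1 p.2) : R).
Proof.
split; last by exists 1 => x; rewrite ler_norml cos_geN1 cos_le1.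
apply: (measurableT_comp (f := @cos R)); last exact: measurable_dotv2.
by apply: continuous_measurable_fun; exact: continuous_cos.
Qed.

Lemma bounded_sin_kernel : bounded_measurable
  (fun p : borel_rV R d * borel_rV R d => sin (dotv p.1 p.2) : R).
Proof.
split; last by exists 1 => x; rewrite ler_norml sin_geN1 sin_le1.
apply: (measurableT_comp (f := @sin R)); last exact: measurable_dotv2.
by apply: continuous_measurable_fun; exact: continuous_sin.
Qed.

Lemma bounded_cosT K phi : continuous phi -> supported_in K phi ->
  bounded_measurable (cosT phi : borel_rV R d -> R).
Proof.
move=> cphi sphi.
exact: (bounded_kernel_transform (0 : borel_rV R d) bounded_cos_kernel cphi sphi).
Qed.

Lemma bounded_sinT K phi : continuous phi -> supported_in K phi ->
  bounded_measurable (sinT phi : borel_rV R d -> R).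
Proof.
move=> cphi sphi.
exact: (bounded_kernel_transform (0 : borel_rV R d) bounded_sin_kernel cphi sphi).
Qed.

Lemma continuous_dotv x : continuous (dotv x).
Proof.
rewrite /dotv; elim: (index_enum _) => [|i r IH].
  by under eq_fun do rewrite big_nil; exact: cst_continuous.
under eq_fun do rewrite big_cons; apply: continuous_funD; last exact: IH.
by apply: continuous_funZ; exact: coord_continuous.
Qed.

Lemma continuous_cos_mul phi x : continuous phi -> continuous (fun xi => cos (dotv x xi) * phi xi).
Proof.
move=> cphi xi; apply: continuousM; last exact: cphi.
exact: (cvg_comp _ _ (@continuous_dotv x xi) (@continuous_cos R _)).
Qed.

Lemma continuous_sin_mul phi x : continuous phi -> continuous (fun xi => sin (dotv x xi) * phi xi).
Proof.
move=> cphi xi; apply: continuousM; last exact: cphi.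
exact: (cvg_comp _ _ (@continuous_dotv x xi) (@continuous_sin R _)).
Qed.

Lemma supported_mul K phi (g : 'rV[R]_d -> R) : supported_in K phi ->
  supported_in K (fun xi => g xi * phi xi).
Proof. by move=> sphi xi i /sphi ->; rewrite mulr0. Qed.

Lemma derive_dotv_comp (f : R -> R) (j : 'I_d) x xi : derivable f (dotv x xi) 1 ->
  derivable (f \o dotv x) xi (delta_mx 0 j) /\
  'D_(delta_mx 0 j) (f \o dotv x) xi = x 0 j * 'D_1 f (dotv x xi).
Proof.
move=> df; have [df' <-] := derive_scalar (x 0 j) df.
apply: (@derive_affine _ _ _ (dotv x)) => // h.
by rewrite dotvDr dotvZr dotv_delta.
Qed.

(** Integration by parts: derivation becomes multiplication by the coordinate. *)
Lemma cosT_partial K phi j x : smooth phi -> supported_in K phi ->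
  cosT (real_partial j phi) x = x 0 j * sinT phi x.
Proof.
move=> mphi sphi; have cphi := smooth_continuous mphi.
have mphi' := smooth_partial j mphi; have sphi' := supported_partial j sphi.
have cphi' := smooth_continuous mphi'.
have i1 := integrable_continuous (continuous_cos_mul (x := x) cphi').
have i2 := integrable_continuous (continuous_sin_mul (x := x) cphi).
pose G xi := cos (dotv x xi) * real_partial j phi xi -
   x 0 j * (sin (dotv x xi) * phi xi).
have : \int[lebesgue_rV R d]_xi G xi = 0.
  apply: (@Rintegral_partial0 _ _ j K (fun xi => cos (dotv x xi) * phi xi)).
  - exact: continuous_cos_mul.
  - apply: continuous_funB; first exact: continuous_cos_mul.
    apply: continuous_funZ.
    exact: continuous_sin_mul.
  - exact: supported_mul.
  - by move=> xi i h; rewrite /G (sphi _ _ h) (sphi' _ _ h) !mulr0 subrr.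
  move=> xi; have [dc cE] : derivable (cos \o dotv x) xi (delta_mx 0 j) /\
      'D_(delta_mx 0 j) (cos \o dotv x) xi = x 0 j * - sin (dotv x xi).
    have [] := @derive_dotv_comp cos j x xi; first exact: derivable_cos.
    by move=> ? ->; split=> //; case: (is_derive_cos (dotv x xi)) => _ ->.
  have dphi : derivable phi xi (delta_mx 0 j) by exact: smooth_derivable.
  split; first exact: (derivableM dc dphi).
  rewrite (deriveM dc dphi) cE /G /GRing.scale/=.
  by rewrite /real_partial; ring.
rewrite /G RintegralB//; last first.
- have := integrableZl measurableT (x 0 j) (i2 _ (supported_mul (fun xi => sin (dotv x xi)) sphi)).
  by apply: eq_integrable.
- exact: i1 _ (supported_mul (fun xi => cos (dotv x xi)) sphi').
rewrite RintegralZl//; last exact: i2 _ (supported_mul (fun xi => sin (dotv x xi)) sphi).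
by move=> /eqP; rewrite subr_eq0 => /eqP.
Qed.

Lemma sinT_partial K phi j x : smooth phi -> supported_in K phi ->
  sinT (real_partial j phi) x = - (x 0 j * cosT phi x).
Proof.
move=> mphi sphi; have cphi := smooth_continuous mphi.
have mphi' := smooth_partial j mphi; have sphi' := supported_partial j sphi.
have cphi' := smooth_continuous mphi'.
have i1 := integrable_continuous (continuous_sin_mul (x := x) cphi').
have i2 := integrable_continuous (continuous_cos_mul (x := x) cphi).
pose G xi := sin (dotv x xi) * real_partial j phi xi +
   x 0 j * (cos (dotv x xi) * phi xi).
have : \int[lebesgue_rV R d]_xi G xi = 0.
  apply: (@Rintegral_partial0 _ _ j K (fun xi => sin (dotv x xi) * phi xi)).
  - exact: continuous_sin_mul.
  - apply: continuous_funD; first exact: continuous_sin_mul.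
    apply: continuous_funZ.
    exact: continuous_cos_mul.
  - exact: supported_mul.
  - by move=> xi i h; rewrite /G (sphi _ _ h) (sphi' _ _ h) !mulr0 addr0.
  move=> xi; have [dc cE] : derivable (sin \o dotv x) xi (delta_mx 0 j) /\
      'D_(delta_mx 0 j) (sin \o dotv x) xi = x 0 j * cos (dotv x xi).
    have [] := @derive_dotv_comp sin j x xi; first exact: derivable_sin.
    by move=> ? ->; split=> //; case: (is_derive_sin (dotv x xi)) => _ ->.
  have dphi : derivable phi xi (delta_mx 0 j) by exact: smooth_derivable.
  split; first exact: (derivableM dc dphi).
  rewrite (deriveM dc dphi) cE /G /GRing.scale/=.
  by rewrite /real_partial; ring.
rewrite /G RintegralD//; last first.
- have := integrableZl measurableT (x 0 j) (i2 _ (supported_mul (fun xi => cos (dotv x xi)) sphi)).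
  by apply: eq_integrable.
- exact: i1 _ (supported_mul (fun xi => sin (dotv x xi)) sphi').
rewrite RintegralZl//; last exact: i2 _ (supported_mul (fun xi => cos (dotv x xi)) sphi).
by move=> /eqP; rewrite addr_eq0 => /eqP.
Qed.

(** Translation of [phi] becomes modulation. *)
Lemma cosT_shift K phi (eta : 'rV[R]_d) x : continuous phi -> supported_in K phi ->
  cosT (fun xi => phi (xi - eta)) x =
  cos (dotv x eta) * cosT phi x - sin (dotv x eta) * sinT phi x.
Proof.
move=> cphi sphi.
pose h xi := cos (dotv x (xi + eta)) * phi xi.
have hE xi : h xi = cos (dotv x eta) * (cos (dotv x xi) * phi xi) -
    sin (dotv x eta) * (sin (dotv x xi) * phi xi).
  by rewrite /h dotvDr cosD; ring.
have i1 := integrable_continuous (continuous_cos_mul (x := x) cphi)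
  (supported_mul (fun xi => cos (dotv x xi)) sphi).
have i2 := integrable_continuous (continuous_sin_mul (x := x) cphi)
  (supported_mul (fun xi => sin (dotv x xi)) sphi).
transitivity (\int[lebesgue_rV R d]_xi h (xi - eta)).
  by apply: eq_Rintegral => xi _; rewrite /h subrK.
rewrite (@Rintegral_shift_rV _ _ h K (- eta)).
- rewrite (funext hE : h = _).
  rewrite RintegralB//; last first.
  + by have := integrableZl measurableT (sin (dotv x eta)) i2; apply: eq_integrable.
  + by have := integrableZl measurableT (cos (dotv x eta)) i1; apply: eq_integrable.
  by rewrite !RintegralZl.
- rewrite (funext hE : h = _).
  apply: continuous_funB; apply: continuous_funZ.
    exact: continuous_cos_mul.
  exact: continuous_sin_mul.
- exact: supported_mul.
Qed.

Lemma sinT_shift K phi (eta : 'rV[R]_d) x : continuous phi -> supported_in K phi ->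
  sinT (fun xi => phi (xi - eta)) x =
  sin (dotv x eta) * cosT phi x + cos (dotv x eta) * sinT phi x.
Proof.
move=> cphi sphi.
pose h xi := sin (dotv x (xi + eta)) * phi xi.
have hE xi : h xi = sin (dotv x eta) * (cos (dotv x xi) * phi xi) +
    cos (dotv x eta) * (sin (dotv x xi) * phi xi).
  by rewrite /h dotvDr sinD; ring.
have i1 := integrable_continuous (continuous_cos_mul (x := x) cphi)
  (supported_mul (fun xi => cos (dotv x xi)) sphi).
have i2 := integrable_continuous (continuous_sin_mul (x := x) cphi)
  (supported_mul (fun xi => sin (dotv x xi)) sphi).
transitivity (\int[lebesgue_rV R d]_xi h (xi - eta)).
  by apply: eq_Rintegral => xi _; rewrite /h subrK.
rewrite (@Rintegral_shift_rV _ _ h K (- eta)).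
- rewrite (funext hE : h = _).
  rewrite RintegralD//; last first.
  + by have := integrableZl measurableT (cos (dotv x eta)) i2; apply: eq_integrable.
  + by have := integrableZl measurableT (sin (dotv x eta)) i1; apply: eq_integrable.
  by rewrite !RintegralZl.
- rewrite (funext hE : h = _).
  apply: continuous_funD; apply: continuous_funZ.
    exact: continuous_cos_mul.
  exact: continuous_sin_mul.
- exact: supported_mul.
Qed.

Lemma smooth_shift (eta : 'rV[R]_d) phi : smooth phi -> smooth (fun xi => phi (xi - eta)).
Proof.
move=> mphi s.
have E : foldr (@real_partial R d) (fun xi => phi (xi - eta)) s =
    (fun xi => foldr (@real_partial R d) phi s (xi - eta)).
  elim: s => //= j s ->; apply/funext => xi.
  have [_ dg] := mphi s.
  have [||_ h] := @derive_affine _ _ _ (fun xi => xi - eta) xi (delta_mx 0 j)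
    (delta_mx 0 j) (foldr (@real_partial R d) phi s).
  - by move=> h; rewrite addrA.
  - exact: dg.
  - exact: h.
rewrite E; have [cg dg] := mphi s; split.
  exact: (@continuous_shift_rV _ _ _ (- eta)).
move=> j xi.
have [||h _] := @derive_affine _ _ _ (fun xi => xi - eta) xi (delta_mx 0 j)
  (delta_mx 0 j) (foldr (@real_partial R d) phi s).
- by move=> h; rewrite addrA.
- exact: dg.
- exact: h.
Qed.

End transform.

Section fourier_of_solutions.
Context {R : realType} {d : nat}.
Local Open Scope complex_scope.
Implicit Types (phi w : 'rV[R]_d -> R) (U : Defs.distribution R d).

(** A substitute for polynomial growth: transforms of test functions decay so fast that
    multiplication by such weights keeps them bounded. *)
Definition moderate w := forall (K : R) phi, smooth phi -> supported_in K phi ->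
  bounded_measurable ((fun x => w x * cosT phi x) : borel_rV R d -> R) /\
  bounded_measurable ((fun x => w x * sinT phi x) : borel_rV R d -> R).

Lemma moderate1 : moderate (fun=> 1).
Proof.
move=> K phi mphi sphi; have cphi := smooth_continuous mphi.
under eq_fun do rewrite mul1r; under [X in _ /\ bounded_measurable X]eq_fun do rewrite mul1r.
by split; [exact: bounded_cosT sphi|exact: bounded_sinT sphi].
Qed.

Lemma moderate_coord j w : moderate w -> moderate (fun x => w x * x 0 j).
Proof.
move=> mw K phi mphi sphi.
have [wc ws] := mw K _ (smooth_partial j mphi) (supported_partial j sphi).
split.
  rewrite (_ : (fun _ => _) = fun x => -1 * (w x * sinT (real_partial j phi) x)).
    exact: bounded_measurableZ.
  by apply/funext => x; rewrite (sinT_partial j x mphi sphi); ring.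
rewrite (_ : (fun _ => _) = fun x => w x * cosT (real_partial j phi) x) //.
by apply/funext => x; rewrite (cosT_partial j x mphi sphi); ring.
Qed.

Lemma moderate_lin (a : R) w1 w2 : moderate w1 -> moderate w2 ->
  moderate (fun x => a * w1 x + w2 x).
Proof.
move=> mw1 mw2 K phi mphi sphi.
have [c1 s1] := mw1 K phi mphi sphi; have [c2 s2] := mw2 K phi mphi sphi.
split.
  rewrite (_ : (fun _ => _) = fun x => a * (w1 x * cosT phi x) + w2 x * cosT phi x).
    exact: bounded_measurable_lin.
  by apply/funext => x; ring.
rewrite (_ : (fun _ => _) = fun x => a * (w1 x * sinT phi x) + w2 x * sinT phi x).
  exact: bounded_measurable_lin.
by apply/funext => x; ring.
Qed.

Variable mu : {charge set (borel_rV R d) -> \bar R}.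
Let L := charge_integral mu.
Let bL : bounded_convergence L := bounded_convergence_charge mu.

(** [U] is the Fourier transform of the measure [w * mu], on real test functions. *)
Definition transform_of U w := forall (K : R) phi, smooth phi -> supported_in K phi ->
  U (fun xi => (phi xi)%:C) =
  L (fun x => w x * cosT phi x) +i* L (fun x => w x * sinT phi x).

Lemma transform_of_fourier : transform_of (regular_distribution (fourier mu)) (fun=> 1).
Proof.
move=> K phi mphi sphi; have cphi := smooth_continuous mphi.
under [X in _ = L X +i* _]eq_fun do rewrite mul1r.
under [X in _ = _ +i* L X]eq_fun do rewrite mul1r.
rewrite /regular_distribution /complex_integral/=.
congr (_ +i* _).
- under eq_Rintegral do rewrite mulr0 subr0.
  exact: charge_integral_kernel_swap bounded_cos_kernel cphi sphi.
- under eq_Rintegral do rewrite mulr0 add0r.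
  exact: charge_integral_kernel_swap bounded_sin_kernel cphi sphi.
Qed.

Lemma partial_real (j : 'I_d) phi :
  partial j (fun xi => (phi xi)%:C) = (fun xi => (real_partial j phi xi)%:C).
Proof.
apply/funext => xi; rewrite /partial/=; congr (_ +i* _).
exact: derive_cst.
Qed.

Lemma invCi : (0 +i* 1 : R[i])^-1 = 0 +i* -1.
Proof.
apply: mulr1_eq; apply/eqP; rewrite eq_complex/=.
by rewrite !mul0r !mulr0 mulrN1 sub0r opprK addr0 !eqxx.
Qed.

Lemma mulNi_opp (a b : R) : (0 +i* -1) * - (a +i* (-1 * b)) = b +i* a.
Proof. by apply/eqP; rewrite eq_complex/=; apply/andP; split; apply/eqP; ring. Qed.

(** [D_j] multiplies the transform by the coordinate [x 0 j]: two factors are combined,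
    the derivative of the character and the [1 / i] in the definition of [D_j]. *)
Lemma transform_of_D (j : 'I_d) U w : moderate w -> transform_of U w ->
  transform_of (dist_D j U) (fun x => w x * x 0 j).
Proof.
move=> mw Uw K phi mphi sphi.
have [wc ws] := moderate_coord j mw mphi sphi.
rewrite /dist_D /dist_partial partial_real (Uw K) ?invCi; last 2 first.
- exact: smooth_partial.
- exact: supported_partial.
have -> : (fun x => w x * cosT (real_partial j phi) x) = (fun x => w x * x 0 j * sinT phi x).
  by apply/funext => x; rewrite (cosT_partial j x mphi sphi) mulrA.
have -> : (fun x => w x * sinT (real_partial j phi) x) =
    (fun x => -1 * (w x * x 0 j * cosT phi x)).
  by apply/funext => x; rewrite (sinT_partial j x mphi sphi); ring.
have -> : L (fun x => -1 * (w x * x 0 j * cosT phi x)) =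
    -1 * L (fun x => w x * x 0 j * cosT phi x) := bounded_convergenceZ bL (-1) wc.
exact: mulNi_opp.
Qed.

Lemma transform_of_iter (j : 'I_d) k U w : moderate w -> transform_of U w ->
  moderate (fun x => w x * x 0 j ^+ k) /\
  transform_of (iter k (dist_D j) U) (fun x => w x * x 0 j ^+ k).
Proof.
move=> mw Uw; elim: k => [|k [IH1 IH2]].
  by under eq_fun do rewrite mulr1; split.
have E : (fun x : 'rV[R]_d => w x * x 0 j ^+ k.+1) = (fun x => w x * x 0 j ^+ k * x 0 j).
  by apply/funext => x; rewrite exprSr mulrA.
by rewrite E /=; split; [exact: moderate_coord|exact: transform_of_D].
Qed.

Lemma transform_of_monomial (m : mpoly.multinom d) U : transform_of U (fun=> 1) ->
  moderate (fun x => \prod_i x 0 i ^+ mpoly.fun_of_multinom m i) /\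
  transform_of (dist_monomial m U) (fun x => \prod_i x 0 i ^+ mpoly.fun_of_multinom m i).
Proof.
move=> U1; rewrite /dist_monomial.
have -> : (fun x : 'rV[R]_d => \prod_i x 0 i ^+ mpoly.fun_of_multinom m i) =
    (fun x => \prod_(i <- enum 'I_d) x 0 i ^+ mpoly.fun_of_multinom m i).
  by apply/funext => x; rewrite big_enum.
elim: (enum 'I_d) => [|j s [IH1 IH2]].
  by under eq_fun do rewrite big_nil; split; [exact: moderate1|exact: U1].
have E : (fun x : 'rV[R]_d => \prod_(i <- j :: s) x 0 i ^+ mpoly.fun_of_multinom m i) =
    (fun x => (\prod_(i <- s) x 0 i ^+ mpoly.fun_of_multinom m i) *
              x 0 j ^+ mpoly.fun_of_multinom m j).
  by apply/funext => x; rewrite big_cons mulrC.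
by rewrite E /=; exact: transform_of_iter.
Qed.

Lemma transform_of_op (P : mpoly.mpoly d R) U : transform_of U (fun=> 1) ->
  moderate (evalv P) /\ transform_of (dist_op P U) (evalv P).
Proof.
move=> U1; have -> : evalv P = (fun x => \sum_(m <- mpoly.msupp P)
    mpoly.mcoeff m P * \prod_i x 0 i ^+ mpoly.fun_of_multinom m i).
  by apply/funext => x; rewrite /evalv mpoly.mevalE.
rewrite /dist_op; elim: (mpoly.msupp P) => [|m s [IH1 IH2]].
  split.
    move=> K phi _ _; under eq_fun do rewrite big_nil mul0r.
    under [X in _ /\ bounded_measurable X]eq_fun do rewrite big_nil mul0r.
    by split; exact: bounded_measurable_cst.
  move=> K phi _ _; rewrite big_nil.
  under [X in _ = L X +i* _]eq_fun do rewrite big_nil mul0r.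
  under [X in _ = _ +i* L X]eq_fun do rewrite big_nil mul0r.
  by rewrite (bounded_convergence0 bL).
have [mm Um] := transform_of_monomial m U1.
split.
  by under eq_fun do rewrite big_cons; exact: moderate_lin.
move=> K phi mphi sphi; rewrite big_cons (Um K)// (IH2 K)//.
have [mc ms] := mm K phi mphi sphi; have [sc ss] := IH1 K phi mphi sphi.
have c := bL.1 (mpoly.mcoeff m P) _ _ mc sc.
have s' := bL.1 (mpoly.mcoeff m P) _ _ ms ss.
apply/eqP; rewrite eq_complex/=; apply/andP; split; apply/eqP.
  rewrite mul0r subr0 -c; congr L; apply/funext => x; rewrite big_cons; ring.
rewrite mul0r addr0 -s'; congr L; apply/funext => x; rewrite big_cons; ring.
Qed.

Lemma test_function_real (K : R) phi : smooth phi -> supported_in K phi ->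
  test_function (fun xi => (phi xi)%:C).
Proof.
move=> mphi sphi; split; first exact: mphi.
  by apply: Ck_smooth => k; exact: Ck_cst.
apply: (subclosed_compact (@closed_closure _ _) (@cube_compact R d K)).
rewrite closureE; apply: smallest_sub; first exact: compact_closed (@cube_compact R d K).
by move=> x /=; rewrite eq_complex/= eqxx andbT; exact: supported_cube.
Qed.

Lemma solves_transform (P : mpoly.mpoly d R) (K : R) phi :
  solves P (fourier mu) -> smooth phi -> supported_in K phi ->
  L (fun x => evalv P x * cosT phi x) = 0 /\ L (fun x => evalv P x * sinT phi x) = 0.
Proof.
move=> sP mphi sphi; have [_ UP] := transform_of_op P transform_of_fourier.
have := sP _ (test_function_real mphi sphi); rewrite (UP K)//.
by move=> h; split; [exact: (congr1 (@complex.Re R) h)|exact: (congr1 (@complex.Im R) h)].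
Qed.

End fourier_of_solutions.

Lemma eq_opp_eq0 {R : realType} (a b : R) : a = b -> a = - b -> a = 0.
Proof. by lra. Qed.

Section characteristic_variety.
Context {R : realType} {d : nat} (mu : {charge set (borel_rV R d) -> \bar R}).
Let L := charge_integral mu.
Let bL : bounded_convergence L := bounded_convergence_charge mu.
Context (P : mpoly.mpoly d R) (sP : solves P (fourier mu)).

Lemma normr_dotv_le (K : R) (x xi : 'rV[R]_d) : cube d K xi ->
  `|dotv x xi| <= K * \sum_i `|x 0 i|.
Proof.
move=> xiK; rewrite /dotv (le_trans (ler_norm_sum _ _ _))// mulr_sumr.
by apply: ler_sum => i _; rewrite normrM mulrC ler_wpM2r.
Qed.

(** For a small bump the cosine is positive on the support. *)
Lemma cosT_bump_gt0 (r : R) (x : 'rV[R]_d) : 0 < r -> r * \sum_i `|x 0 i| < 1 ->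
  0 < cosT (smooth_bump r) x.
Proof.
move=> r0 rx; rewrite /cosT.
apply: (@Rintegral_gt0 _ _ (fun xi => cos (dotv x xi) * smooth_bump r xi) r).
- by apply: continuous_cos_mul; apply: smooth_continuous; exact: smooth_bump_smooth.
- by apply: supported_mul; exact: smooth_bump_supported.
- move=> xi; have [->|bxi] := eqVneq (smooth_bump r xi) 0; first by rewrite mulr0.
  rewrite mulr_ge0 ?smooth_bump_ge0// ltW// cos_gt0_pihalf//.
  have := normr_dotv_le x (supported_cube (@smooth_bump_supported R d r) bxi).
  move=> /le_lt_trans/(_ rx); rewrite ltr_norml => /andP[h1 h2].
  have := @pi_ge2 R => pi2; apply/andP; split; lra.
- by rewrite dotv0r cos0 mul1r smooth_bump_gt0.
Qed.

(** The measure is carried by the zeros of [P]: by uniqueness of the Fourier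
    transform the bounded density [P * cosT (smooth_bump r)] annihilates it, since
    modulations of [cosT (smooth_bump r)] come from translations of the bump; and
    [cosT (smooth_bump r) x] is nonzero as soon as [r] is small compared to [x]. *)
Lemma solves_carried (f : borel_rV R d -> R) : bounded_measurable f ->
  L (fun x => (evalv P x != 0)%:R * f x) = 0.
Proof.
move=> bf.
have [mP _] := transform_of_op P (@transform_of_fourier R d mu).
pose C n := cosT (smooth_bump n.+1%:R^-1) : 'rV[R]_d -> R.
pose S n := sinT (smooth_bump n.+1%:R^-1) : 'rV[R]_d -> R.
have [bC bS] : (forall n, bounded_measurable ((fun x => evalv P x * C n x) : borel_rV R d -> R)) /\
    (forall n, bounded_measurable ((fun x => evalv P x * S n x) : borel_rV R d -> R)).
  by split=> n; have [] := mP _ _ (@smooth_bump_smooth R d n.+1%:R^-1) (@smooth_bump_supported R d _).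
have trig n eta : L (fun x => evalv P x * C n x * cos (dotv x eta)) = 0 /\
    L (fun x => evalv P x * C n x * sin (dotv x eta)) = 0.
  (* Translations by [eta] and by [- eta] give relations with opposite signs, which
     together kill all the integrals. *)
  have shifted e : L (fun x => evalv P x * C n x * cos (dotv x e)) =
        L (fun x => evalv P x * S n x * sin (dotv x e)) /\
      L (fun x => evalv P x * C n x * sin (dotv x e)) =
        - L (fun x => evalv P x * S n x * cos (dotv x e)).
    have sb := @smooth_bump_smooth R d n.+1%:R^-1; have cb := smooth_continuous sb.
    have ub := @smooth_bump_supported R d n.+1%:R^-1.
    have us := supported_shift (eta := - e) ub.
    have [Lc Ls] := solves_transform sP (smooth_shift e sb) us.
    have cc := bounded_measurableM (bC n) (bounded_cos_dotv e).
    have cs := bounded_measurableM (bC n) (bounded_sin_dotv e).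
    have sc := bounded_measurableM (bS n) (bounded_cos_dotv e).
    have ss := bounded_measurableM (bS n) (bounded_sin_dotv e).
    split; apply/eqP; rewrite -subr_eq0 ?opprK; apply/eqP.
      rewrite -(bounded_convergenceB bL cc ss) -{}Lc; congr L; apply/funext => x.
      by rewrite (cosT_shift e x cb ub) /C /S; ring.
    rewrite -(bounded_convergenceD bL cs sc) -{}Ls; congr L; apply/funext => x.
    by rewrite (sinT_shift e x cb ub) /C /S; ring.
  have [c1 s1] := shifted eta; have [c2 s2] := shifted (- eta).
  have Nc (g : 'rV[R]_d -> R) : (fun x => g x * cos (dotv x (- eta))) = (fun x => g x * cos (dotv x eta)).
    by apply/funext => x; rewrite dotvNr cosN.
  have Ns (g : 'rV[R]_d -> R) : bounded_measurable (g : borel_rV R d -> R) ->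
      L (fun x => g x * sin (dotv x (- eta))) = - L (fun x => g x * sin (dotv x eta)).
    move=> bg; rewrite -[RHS]mulN1r -(bounded_convergenceZ bL); last first.
      exact: bounded_measurableM bg (bounded_sin_dotv eta).
    by congr L; apply/funext => x; rewrite dotvNr sinN; ring.
  move: c2 s2; rewrite !Nc (Ns _ (bC n)) (Ns _ (bS n)) => c2 s2.
  split; first exact: eq_opp_eq0 c1 c2.
  exact: eq_opp_eq0 (oppr_inj s2) s1.
have Pn n : forall g, bounded_measurable g -> L (fun x => (evalv P x * C n x != 0)%:R * g x) = 0.
  apply: (bounded_convergence_cancel bL (bC n)).
  apply: (fourier_uniqueness (bounded_convergence_weight bL (bC n))).
    by move=> xi; case: (trig n xi).
  by move=> xi; case: (trig n xi).
have [mf [M fM]] := bf.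
apply: (@cvg_seq_unique _ (fun n => L (fun x => (evalv P x * C n x != 0)%:R * f x))); last first.
  by under eq_cvg do rewrite (Pn _ _ bf); exact: cvg_cst.
apply: (bL.2 _ _ M).
- move=> n; apply: measurable_funM => //.
  have [mPC _] := bC n.
  rewrite (_ : (fun _ => _) = \1_((fun x => evalv P x * C n x) @^-1` [set~ 0])).
    apply: measurable_indic; rewrite -[X in measurable X]setTI; apply: mPC => //.
    exact: measurableC.
  by apply/funext => x; rewrite indicE; congr ((_ : bool)%:R); apply/idP/idP;
    rewrite inE/= => /eqP.
- move=> n x; rewrite normrM (le_trans _ (fM x))// ler_piMl//.
  by case: (_ != _); rewrite ?normr1 ?normr0.
move=> x; apply: cvg_near_cst.
have [N xN] : exists N : nat, \sum_i `|x 0 i| < N%:R.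
  by exists (Num.truncn (\sum_i `|x 0 i|)).+1; exact: truncnS_gt.
exists N => // n /= Nn; apply/eqP.
have Cn : 0 < C n x.
  apply: cosT_bump_gt0; first by rewrite invr_gt0.
  rewrite mulrC ltr_pdivrMr// mul1r (lt_le_trans xN)// ler_nat.
  by rewrite (leq_trans Nn).
by rewrite mulf_eq0 (gt_eqF Cn) orbF.
Qed.

End characteristic_variety.

(** * Reflections of a quadric *)

Section bilinear_forms.
Context {R : realType} {d : nat}.
Implicit Types (M : 'M[R]_d) (x y z : 'rV[R]_d).

Definition bil M x y : R := (x *m M *m y^T) 0 0.

Lemma bilDl M x y z : bil M (x + y) z = bil M x z + bil M y z.
Proof. by rewrite /bil !mulmxDl mxE. Qed.

Lemma bilZl M (a : R) x y : bil M (a *: x) y = a * bil M x y.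
Proof. by rewrite /bil -!scalemxAl mxE. Qed.

Lemma bilDr M x y z : bil M x (y + z) = bil M x y + bil M x z.
Proof. by rewrite /bil linearD/= mulmxDr mxE. Qed.

Lemma bilZr M (a : R) x y : bil M x (a *: y) = a * bil M x y.
Proof. by rewrite /bil linearZ/= -scalemxAr mxE. Qed.

Lemma bilC M x y : M^T = M -> bil M x y = bil M y x.
Proof.
by move=> MT; rewrite /bil -[in LHS]MT -{1}[x]trmxK -!trmx_mul mxE mulmxA.
Qed.

Lemma bilE M x y : bil M x y = \sum_j dotv x (col j M)^T * y 0 j.
Proof.
rewrite /bil mxE; apply: eq_bigr => j _; rewrite !mxE; congr (_ * _).
by apply: eq_bigr => i _; rewrite !mxE.
Qed.

Lemma bilDm (M N : 'M[R]_d) x y : bil (M + N) x y = bil M x y + bil N x y.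
Proof. by rewrite /bil mulmxDr mulmxDl mxE. Qed.

Lemma bilZm (a : R) M x y : bil (a *: M) x y = a * bil M x y.
Proof. by rewrite /bil -scalemxAr -scalemxAl mxE. Qed.

Lemma bilT M x y : bil M^T x y = bil M y x.
Proof. by rewrite /bil -{1}[x]trmxK -trmx_mul -trmx_mul mxE mulmxA. Qed.

Lemma bil_delta (i j : 'I_d) x y : bil (delta_mx i j) x y = x 0 i * y 0 j.
Proof.
rewrite bilE (bigD1 j)//= big1 => [|k /negPf kj].
  rewrite addr0 (_ : (col j (delta_mx i j))^T = delta_mx 0 i) ?dotv_delta//.
  by apply/rowP => k; rewrite !mxE eqxx andbT.
rewrite (_ : (col k (delta_mx i j))^T = 0) ?dotv0r ?mul0r//.
by apply/rowP => l; rewrite !mxE kj andbF.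
Qed.

Lemma continuous_sum (T : topologicalType) (I : Type) (s : seq I) (F : I -> T -> R) :
  (forall i, continuous (F i)) -> continuous (fun t => \sum_(i <- s) F i t).
Proof.
move=> cF; elim: s => [|i s IH].
  by under eq_fun do rewrite big_nil; exact: cst_continuous.
by under eq_fun do rewrite big_cons; exact: continuous_funD.
Qed.

Lemma continuous_bil_diag M : continuous (fun x => bil M x x).
Proof.
under eq_fun do rewrite bilE; apply: continuous_sum => j.
apply: continuous_funM; last exact: coord_continuous.
by under eq_fun do rewrite dotvC; exact: continuous_dotv.
Qed.

Lemma continuous_bill M y : continuous (fun x => bil M x y).
Proof.
under eq_fun do rewrite bilE; apply: continuous_sum => j.
apply: continuous_funM; last exact: cst_continuous.
by under eq_fun do rewrite dotvC; exact: continuous_dotv.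
Qed.

Lemma monomial_deg2 (m : mpoly.multinom d) : mpoly.mdeg m = 2 ->
  exists i j, forall x, \prod_k x 0 k ^+ mpoly.fun_of_multinom m k = x 0 i * x 0 j.
Proof.
move=> m2; have [i mi] : exists i, (0 < mpoly.fun_of_multinom m i)%N.
  apply: contrapT => H; move: m2; rewrite mpoly.mdegE big1// => i _.
  by apply/eqP; rewrite -leqn0 leqNgt; apply/negP => mi; apply: H; exists i.
have mE : m = mpoly.mnm_add (mpoly.mnm_sub m (mpoly.mnm1 i)) (mpoly.mnm1 i).
  rewrite mpoly.submK//; apply/mpoly.mnm_lepP => l; rewrite mpoly.mnm1E.
  by case: eqP => [<-|].
have /eqP/mpoly.mdeg1P[j /eqP jE] :
    mpoly.mdeg (mpoly.mnm_sub m (mpoly.mnm1 i)) = 1%N.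
  by move: m2; rewrite {1}mE mpoly.mdegD mpoly.mdeg1 addn1 => -[].
exists i, j => x; rewrite mE jE -mpoly.mevalX mpoly.mpolyXD mpoly.mevalM.
by rewrite !mpoly.mevalXU mulrC.
Qed.

Lemma quadratic_form_bil (Q : mpoly.mpoly d R) : quadratic_form Q ->
  exists2 M : 'M[R]_d, M^T = M & forall x, evalv Q x = bil M x x.
Proof.
move=> /mpoly.dhomogP hQ.
suff [M QM] : exists M : 'M[R]_d, forall x, evalv Q x = bil M x x.
  exists (2^-1 *: (M + M^T)).
    by rewrite linearZ/= linearD/= trmxK addrC.
  by move=> x; rewrite bilZm bilDm bilT QM; lra.
suff [M QM] : exists M : 'M[R]_d, forall x, \sum_(m <- mpoly.msupp Q)
    mpoly.mcoeff m Q * \prod_i x 0 i ^+ mpoly.fun_of_multinom m i = bil M x x.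
  by exists M => x; rewrite -QM /evalv mpoly.mevalE.
elim: (mpoly.msupp Q) hQ => [|m s IH] hs.
  exists 0 => x; rewrite big_nil (_ : 0 = 0 *: (0 : 'M[R]_d)) ?bilZm ?mul0r//.
  by rewrite scaler0.
have [M QM] : exists M : 'M[R]_d, forall x, \sum_(m <- s)
    mpoly.mcoeff m Q * \prod_i x 0 i ^+ mpoly.fun_of_multinom m i = bil M x x.
  by apply: IH => m' m's; apply: hs; rewrite inE m's orbT.
have [|i [j ijE]] := @monomial_deg2 m; first by apply: hs; rewrite inE eqxx.
exists (mpoly.mcoeff m Q *: delta_mx i j + M) => x.
by rewrite big_cons QM bilDm bilZm bil_delta ijE.
Qed.

Lemma evalv_quadratic_poly (Q : mpoly.mpoly d R) M (v : 'rV[R]_d) (rho : R) x :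
  (forall x, evalv Q x = bil M x x) ->
  evalv (quadratic_poly Q v rho) x = bil M x x + dotv v x - rho.
Proof.
move=> QM; rewrite -QM /evalv /quadratic_poly mpoly.mevalB mpoly.mevalD mpoly.mevalC.
congr (_ + _ - _); rewrite (big_morph _ (mpoly.mevalD _) (mpoly.meval0 _)).
apply: eq_bigr => i _ /=.
by rewrite mpoly.mevalZ mpoly.mevalXU.
Qed.

End bilinear_forms.

Section reflections.
Context {R : realType} {d : nat} (M : 'M[R]_d) (MT : M^T = M) (v : 'rV[R]_d) (rho : R).
Implicit Types (u x y : 'rV[R]_d).

Definition quadric x : R := bil M x x + dotv v x - rho.

(** If [quadric x = 0] then the line [x + R u] meets the quadric at [x] and at
    [reflect_along u x]: [- height u x] is the root other than 0 of the equation given by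
    [quadric_line]. *)
Definition height u x : R := (2 * bil M x u + dotv v u) / bil M u u.
Definition reflect_along u x : 'rV[R]_d := x - height u x *: u.

Lemma quadric_line u x (t : R) : quadric (x + t *: u) =
  bil M u u * t ^+ 2 + (2 * bil M x u + dotv v u) * t + quadric x.
Proof.
rewrite /quadric bilDl !bilDr !bilZl !bilZr dotvDr dotvZr (bilC u x MT).
by ring.
Qed.

Lemma height_line u w x (t : R) :
  height w (x + t *: u) = height w x + t * (2 * bil M u w / bil M w w).
Proof. by rewrite /height bilDl bilZl; ring. Qed.

Lemma height_reflect u w x : height w (reflect_along u x) =
  height w x - (2 * bil M u w / bil M w w) * height u x.
Proof. by rewrite /reflect_along -scaleNr height_line; ring. Qed.

Lemma height_reflect_self u x : bil M u u != 0 ->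
  height u (reflect_along u x) = - height u x.
Proof. by move=> u0; rewrite height_reflect mulfK//; ring. Qed.

Lemma continuous_height u : continuous (height u).
Proof.
apply: continuous_funM; last exact: cst_continuous.
apply: continuous_funD; last exact: cst_continuous.
by apply: continuous_funZ; exact: continuous_bill.
Qed.

Lemma continuous_quadric : continuous quadric.
Proof.
apply: continuous_funB; last exact: cst_continuous.
by apply: continuous_funD; [exact: continuous_bil_diag|exact: continuous_dotv].
Qed.

Lemma measurable_along u (t : borel_rV R d -> R) : measurable_fun setT t ->
  measurable_fun setT ((fun x => x + t x *: u) : borel_rV R d -> borel_rV R d).
Proof.
move=> mt; apply: measurable_fun_rV => i.
rewrite (_ : (fun _ => _) = fun x : 'rV[R]_d => x 0 i + t x * u 0 i).
  apply: measurable_funD; first exact: measurable_coord_rV.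
  exact: measurable_funM.
by apply/funext => x; rewrite !mxE.
Qed.

Lemma measurable_reflect_along u :
  measurable_fun setT (reflect_along u : borel_rV R d -> borel_rV R d).
Proof.
rewrite (_ : reflect_along u = fun x => x + (- height u x) *: u).
  apply: (@measurable_along u (fun x => - height u x)).
  apply: measurableT_comp => //.
  by apply: continuous_measurable_rV; exact: continuous_height.
by apply/funext => x; rewrite scaleNr.
Qed.

Context (L : (borel_rV R d -> R) -> R) (bL : bounded_convergence L).
Hypothesis carriedL : forall f : borel_rV R d -> R, bounded_measurable f ->
  L (fun x => (quadric x != 0)%:R * f x) = 0.

Lemma carried_eq (f g : borel_rV R d -> R) : bounded_measurable f ->
  bounded_measurable g -> (forall x, quadric x = 0 -> f x = g x) -> L f = L g.
Proof.
move=> bf bg fg; apply/eqP; rewrite -subr_eq0 -(bounded_convergenceB bL)//; apply/eqP.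
have bfg : bounded_measurable (fun x : borel_rV R d => f x - g x).
  rewrite (_ : (fun _ => _) = fun x => -1 * g x + f x).
    exact: bounded_measurable_lin.
  by apply/funext => x; ring.
rewrite -[RHS](carriedL bfg); congr L; apply/funext => x.
have [/fg ->|_] := eqVneq (quadric x) 0; first by rewrite subrr mulr0.
by rewrite mul1r.
Qed.

Definition proj_along u x : 'rV[R]_d := x - dotv x u *: u.

Context (u : 'rV[R]_d) (u1 : dotv u u = 1) (u0 : bil M u u != 0).
Hypothesis hypL : forall xi, dotv xi u = 0 ->
  L (fun x => cos (dotv x xi)) = 0 /\ L (fun x => sin (dotv x xi)) = 0.

Lemma measurable_proj_along :
  measurable_fun setT (proj_along u : borel_rV R d -> borel_rV R d).
Proof.
rewrite (_ : proj_along u = fun x => x + (- dotv x u) *: u).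
  apply: (@measurable_along u (fun x => - dotv x u)).
  by apply: measurableT_comp => //; exact: measurable_dotv.
by apply/funext => x; rewrite scaleNr.
Qed.

Lemma dotv_proj_along x xi : dotv (proj_along u x) xi = dotv x (proj_along u xi).
Proof.
by rewrite /proj_along dotvBl dotvBr dotvZl dotvZr (dotvC u xi) mulrC.
Qed.

(** The transform of the image of the measure under the projection along [u] is the
    restriction of the transform to the hyperplane orthogonal to [u]. *)
Lemma projection_zero (F : borel_rV R d -> R) : bounded_measurable F ->
  L (F \o proj_along u) = 0.
Proof.
have h xi : dotv (proj_along u xi) u = 0.
  by rewrite /proj_along dotvBl dotvZl u1 mulr1 subrr.
apply: (fourier_uniqueness (bounded_convergence_comp bL measurable_proj_along)) => xi.
  rewrite -[RHS](hypL (h xi)).1; congr L; apply/funext => x /=.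
  by rewrite dotv_proj_along.
rewrite -[RHS](hypL (h xi)).2; congr L; apply/funext => x /=.
by rewrite dotv_proj_along.
Qed.

Let q := bil M u u.
Let beta y := 2 * bil M y u + dotv v u.
Let disc y := beta y ^+ 2 - 4 * q * quadric y.
Let root (s : R) y := (- beta y + s * Num.sqrt (disc y)) / (2 * q).

Lemma measurable_root s : measurable_fun setT (root s : borel_rV R d -> R).
Proof.
have cb : continuous beta.
  apply: continuous_funD; last exact: cst_continuous.
  by apply: continuous_funZ; exact: continuous_bill.
apply: continuous_measurable_rV; apply: continuous_funM; last exact: cst_continuous.
apply: continuous_funD.
  by rewrite (_ : (fun _ => _) = fun y => -1 * beta y);
    [exact: continuous_funZ|apply/funext => y; rewrite mulN1r].
apply: continuous_funZ => y.
have cd : continuous disc.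
  apply: continuous_funB; first exact: continuous_funM.
  by apply: continuous_funZ; exact: continuous_quadric.
exact: (cvg_comp _ _ (cd y) (@sqrt_continuous R _)).
Qed.

(** Since the projection along [u] is at most two-to-one on the quadric, with
    fibres the orbits of the reflection, a measure whose projection vanishes is
    reversed by the reflection. *)
Theorem reflection_anti_invariant (f : borel_rV R d -> R) : bounded_measurable f ->
  L (f \o reflect_along u) = - L f.
Proof.
move=> bf; have [mf [N fN]] := bf.
have bfS : bounded_measurable (f \o reflect_along u : borel_rV R d -> R).
  split; last by exists N => x; exact: fN.
  exact: measurableT_comp (measurable_reflect_along u).
(* On the quadric [F \o proj_along u] is the sum of [f] over the two points of the
   fibre. *)
pose F y := f (y + root 1 y *: u) + f (y + root (-1) y *: u).
have bF : bounded_measurable (F : borel_rV R d -> R).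
  apply: bounded_measurableD; split; do ?[by exists N => x; exact: fN];
  by apply: (measurableT_comp mf); apply: measurable_along; exact: measurable_root.
have bFp : bounded_measurable (F \o proj_along u : borel_rV R d -> R).
  have [mF [N' FN']] := bF; split; last by exists N' => x; exact: FN'.
  exact: measurableT_comp measurable_proj_along.
apply/eqP; rewrite -addr_eq0 addrC -(bounded_convergenceD bL)//; apply/eqP.
rewrite -[RHS](projection_zero bF); apply: carried_eq => //.
  exact: bounded_measurableD.
move=> x Zx; rewrite /F /=; set y := proj_along u x; set t := dotv x u.
have xE : x = y + t *: u by rewrite subrK.
have hE : height u x = (beta y + 2 * t * q) / q.
  by rewrite {1}xE height_line /height -/(beta y) -/q mulrA; field.
have eq0 : q * t ^+ 2 + beta y * t + quadric y = 0 by rewrite -quadric_line -xE.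
have dE : disc y = (2 * q * t + beta y) ^+ 2.
  rewrite /disc; have -> : quadric y = - (q * t ^+ 2 + beta y * t) by lra.
  by ring.
have rE s : root s y = (- beta y + s * `|2 * q * t + beta y|) / (2 * q).
  by rewrite /root dE sqrtr_sqr.
have -> : reflect_along u x = y + (- beta y / q - t) *: u.
  by rewrite /reflect_along hE {1}xE -addrA -scalerBl; congr (_ + _ *: _); field.
have q0 : q != 0 by [].
rewrite {1}xE !rE; case: (ger0P (2 * q * t + beta y)) => _.
  rewrite (_ : (- beta y + 1 * _) / _ = t); last by field.
  by rewrite (_ : (- beta y + -1 * _) / _ = - beta y / q - t)//; field.
rewrite (_ : (- beta y + 1 * _) / _ = - beta y / q - t); last by field.
by rewrite (_ : (- beta y + -1 * _) / _ = t) 1?addrC//; field.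
Qed.

End reflections.

(** * Irrational rotations *)

Section irrational_rotation.
Context {R : realType}.

(** Pigeonhole principle for the fractional parts of the multiples of [a]. *)
Lemma dirichlet_approx (a delta : R) : 0 < delta ->
  exists (n : nat) (p : int), (0 < n)%N /\ `|n%:R * a - p%:~R| < delta.
Proof.
move=> d0; pose N := (Num.truncn delta^-1).+1.
have N0 : 0 < N%:R :> R by rewrite ltr0n.
have Nd : N%:R^-1 < delta.
  by rewrite invf_plt ?posrE//; exact: truncnS_gt.
pose fr (i : nat) : R := i%:R * a - (Num.floor (i%:R * a))%:~R.
have fr0 i : 0 <= fr i by rewrite subr_ge0 floor_le_tmp.
have fr1 i : fr i < 1.
  by rewrite ltrBlDl; have := floorD1_gt (i%:R * a); rewrite intrD.
have bin_lt i : (Num.truncn (N%:R * fr i) < N)%N.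
  rewrite truncn_lt_nat ?mulr_ge0//; first by rewrite gtr_pMr.
pose bin (i : 'I_N.+1) : 'I_N := Ordinal (bin_lt i).
have /injectivePn[i [j ij bij]] : ~~ injectiveb bin.
  by apply/negP => /injectiveP/leq_card; rewrite !card_ord ltnn.
wlog lt_ij : i j ij bij / (i < j)%N.
  move=> H; case: (ltngtP i j) => [|/H|/val_inj/eqP]; first exact: H.
    by rewrite eq_sym; exact.
  by rewrite (negPf ij).
exists (j - i)%N, (Num.floor (j%:R * a) - Num.floor (i%:R * a)).
split; first by rewrite subn_gt0.
apply: le_lt_trans Nd.
rewrite natrB 1?ltnW// intrB.
rewrite (_ : _ - _ = fr j - fr i); last by rewrite /fr; ring.
have {bij} := congr1 val bij; rewrite /bin/=; set k := Num.truncn _ => kE.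
have /andP[h1 h2] : k%:R <= N%:R * fr i < k.+1%:R by rewrite /k truncn_itv// mulr_ge0.
have /andP[h3 h4] : k%:R <= N%:R * fr j < k.+1%:R.
  by rewrite kE truncn_itv// mulr_ge0.
rewrite -(ler_pM2l N0) divff ?gt_eqF// -{1}(gtr0_norm N0) -normrM mulrBr.
move: h2 h4; rewrite -natr1 => h2 h4.
by rewrite ler_norml; apply/andP; split; lra.
Qed.

(** By [dirichlet_approx] some multiple of [a] is, modulo 1, a nonzero step smaller than
    [delta]; its multiples approach every point.  The shift by [z] in the proof makes the
    required number of steps nonnegative. *)
Lemma irrational_dense (a : R) :
  (forall (n : nat) (p : int), (0 < n)%N -> n%:R * a != p%:~R) ->
  forall y delta : R, 0 < delta ->
  exists (m : nat) (z : int), `|m%:R * a - y - z%:~R| < delta.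
Proof.
move=> irr y delta d0; have [n [p [n0 nd]]] := dirichlet_approx a d0.
set e := n%:R * a - p%:~R in nd.
have e0 : e != 0 by rewrite subr_eq0 irr.
have [z zE] : exists z : int, 0 <= (y + z%:~R) / e.
  have yN : `|y| < (Num.truncn `|y|).+1%:R by exact: truncnS_gt.
  case: (ltgtP e 0) => [en|ep|/eqP]; last by rewrite (negPf e0).
    exists (- (Num.truncn `|y|).+1%:Z).
    rewrite nmulr_lge0 ?invr_lt0// intrN -pmulrn subr_le0.
    by rewrite (le_trans (ler_norm y))// ltW.
  exists ((Num.truncn `|y|).+1%:Z).
  rewrite divr_ge0 ?(ltW ep)// -pmulrn -lerBlDl sub0r lerNl.
  by rewrite lerNl (le_trans _ (ltW yN))// -normrN ler_norm.
pose k := Num.truncn ((y + z%:~R) / e).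
have /andP[k1 k2] : k%:R <= (y + z%:~R) / e < k.+1%:R by rewrite truncn_itv.
exists (k * n)%N, (k%:Z * p + z).
rewrite (_ : _ - _ - _ = k%:R * e - (y + z%:~R)); last first.
  by rewrite intrD intrM -pmulrn natrM /e; ring.
apply: le_lt_trans nd; rewrite -{1}[y + _](divfK e0) -mulrBl normrM ler_piMl//.
move: k2; rewrite -natr1 => k2.
by rewrite ler_norml; apply/andP; split; lra.
Qed.

Lemma periodic_int (H : R -> R) (tp : R) : (forall t, H (t + tp) = H t) ->
  forall (z : int) t, H (t + z%:~R * tp) = H t.
Proof.
move=> per; have pern (n : nat) t : H (t + n%:R * tp) = H t.
  elim: n => [|n IH]; first by rewrite mul0r addr0.
  by rewrite -natr1 mulrDl mul1r addrA per.
case=> n t; first exact: pern.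
rewrite NegzE intrN mulNr -pmulrn.
by rewrite -[in RHS](subrK (n.+1%:R * tp) t) pern.
Qed.

(** The Birkhoff averages of a Lipschitz function along an irrational rotation do
    not depend on the starting point: the second orbit is uniformly close to a
    shift of the first one. *)
Lemma rotation_averages (H : R -> R) (C tp alpha phi psi : R) : 0 < tp ->
  (forall t, H (t + tp) = H t) -> (forall t, `|H t| <= 1) ->
  (forall s t, `|H s - H t| <= C * `|s - t|) ->
  (forall (n : nat) (p : int), (0 < n)%N -> n%:R * alpha != p%:~R * tp) ->
  n.+1%:R^-1 * \sum_(i < n.+1) (H (phi - i%:R * alpha) - H (psi - i%:R * alpha))
    @[n --> \oo] --> 0.
Proof.
move=> tp0 per H1 HC irr.
have C0 : 0 <= C by have := HC 1 0; rewrite subr0 normr1 mulr1; exact: le_trans.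
apply/cvgrPdist_le => e e0.
pose delta := e / (2 * (C + 1) * tp).
have d0 : 0 < delta by rewrite divr_gt0// !mulr_gt0//; lra.
have irr' (n : nat) (p : int) : (0 < n)%N -> n%:R * (alpha / tp) != p%:~R.
  move=> n0; apply: contra (irr n p n0) => /eqP <-.
  by rewrite -!mulrA mulVf ?mulr1// gt_eqF.
have [m [z mz]] := irrational_dense irr' ((phi - psi) / tp) d0.
pose c i := H (phi - i%:R * alpha).
have shift1 n j : `|\sum_(i < n) c (i + j)%N - \sum_(i < n) c (i + j.+1)%N| <= 2.
  rewrite -sumrB (_ : \sum_(i < n) _ = c j - c (n + j)%N).
    by apply: (le_trans (ler_normB _ _)); exact: lerD (H1 _) (H1 _).
  elim: n => [|n IH]; first by rewrite big_ord0 add0n subrr.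
  by rewrite big_ord_recr/= IH addnS addSn; ring.
have shiftm n : `|\sum_(i < n) c i - \sum_(i < n) c (i + m)%N| <= 2 * m%:R.
  elim: m {mz} => [|j IH].
    under [X in _ - X]eq_bigr do rewrite addn0.
    by rewrite subrr normr0 mulr0.
  rewrite -(natr1 j) mulrDr mulr1 (_ : _ - _ = (\sum_(i < n) c i - \sum_(i < n) c (i + j)%N) +
    (\sum_(i < n) c (i + j)%N - \sum_(i < n) c (i + j.+1)%N)); last by ring.
  by rewrite (le_trans (ler_normD _ _))// lerD.
have near_orbit i : `|c (i + m)%N - H (psi - i%:R * alpha)| <= e / 2.
  rewrite -(periodic_int per (- z) (psi - i%:R * alpha)) (le_trans (HC _ _))//.
  rewrite (_ : _ - _ = - tp * (m%:R * (alpha / tp) -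
     (phi - psi) / tp - z%:~R)); last first.
    by rewrite natrD intrN; field; rewrite gt_eqF.
  rewrite normrM normrN (gtr0_norm tp0).
  apply: (@le_trans _ _ (C * (tp * delta))).
    by rewrite ler_wpM2l// ler_wpM2l ?ltW.
  rewrite (_ : C * _ = C / (C + 1) * (e / 2)); last first.
    have C1 : C + 1 != 0 by rewrite gt_eqF//; lra.
    have tpn : tp != 0 by rewrite gt_eqF.
    by rewrite /delta; field; rewrite ?C1 ?tpn.
  by rewrite ler_piMl// ?ler_pdivrMr ?divr_ge0//; lra.
have [N HN] : exists N : nat, 4 * m%:R / e < N%:R.
  by exists (Num.truncn (4 * m%:R / e)).+1; exact: truncnS_gt.
exists N => // n /= Nn; rewrite sub0r normrN normrM ger0_norm ?invr_ge0//.
rewrite mulrC ler_pdivrMr ?ltr0n// sumrB.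
rewrite (_ : _ - _ = (\sum_(i < n.+1) c i - \sum_(i < n.+1) c (i + m)%N) +
  \sum_(i < n.+1) (c (i + m)%N - H (psi - i%:R * alpha))); last first.
  by rewrite sumrB; ring.
rewrite (le_trans (ler_normD _ _))// (le_trans (lerD (shiftm _) (ler_norm_sum _ _ _)))//.
have : \sum_(i < n.+1) `|c (i + m)%N - H (psi - i%:R * alpha)| <= n.+1%:R * (e / 2).
  have -> : n.+1%:R * (e / 2) = \sum_(i < n.+1) (e / 2).
    by rewrite sumr_const card_ord mulr_natl.
  by apply: ler_sum => i _; exact: near_orbit.
have : N%:R <= n.+1%:R :> R by rewrite ler_nat (leq_trans Nn).
move: HN; rewrite ltr_pdivrMr// => h1 h2 h3.
have : N%:R * e <= n.+1%:R * e by rewrite ler_pM2r.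
by nra.
Qed.

Lemma polar (X Y : R) : exists r phi : R, X = r * cos phi /\ Y = r * sin phi.
Proof.
pose r := Num.sqrt (X ^+ 2 + Y ^+ 2).
have s0 : 0 <= X ^+ 2 + Y ^+ 2 by rewrite addr_ge0 ?sqr_ge0.
have r2 : r ^+ 2 = X ^+ 2 + Y ^+ 2 by rewrite sqr_sqrtr.
have [r0|r0] := eqVneq r 0.
  move: r2; rewrite r0 expr0n/= => /esym/eqP.
  rewrite paddr_eq0 ?sqr_ge0// !sqrf_eq0 => /andP[/eqP -> /eqP ->].
  by exists 0, 0; rewrite !mul0r.
have rp : 0 < r by rewrite lt_def r0 sqrtr_ge0.
have Xr : -1 <= X / r <= 1.
  rewrite -ler_norml normrM normfV (gtr0_norm rp) ler_pdivrMr// mul1r.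
  rewrite -(ler_pXn2r (n := 2))// ?nnegrE ?(ltW rp)//.
  by rewrite r2 real_normK ?num_real// lerDl sqr_ge0.
have cE : cos (acos (X / r)) = X / r by rewrite acosK.
have sE : sin (acos (X / r)) = `|Y| / r.
  rewrite sin_acos// expr_div_n r2 -[1](@divff _ (X ^+ 2 + Y ^+ 2)); last first.
    by rewrite -r2 expf_neq0.
  rewrite -mulrBl addrAC subrr add0r sqrtrM ?sqr_ge0// sqrtr_sqr.
  by rewrite sqrtrV// -r2 sqrtr_sqr (gtr0_norm rp).
have [Y0|Y0] := leP 0 Y.
  exists r, (acos (X / r)); rewrite cE sE ger0_norm//.
  by split; field.
exists r, (- acos (X / r)); rewrite cosN sinN cE sE ltr0_norm//.
by split; field.
Qed.

End irrational_rotation.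

(** * The product of two reflections *)

Lemma geometric_gt {R : realType} (l a C : R) : 1 < l -> 0 < a ->
  exists N : nat, forall n, (N <= n)%N -> C < l ^+ n * a.
Proof.
move=> l1 a0; have l0 : 0 < l - 1 by rewrite subr_gt0.
have bern n : 1 + n%:R * (l - 1) <= l ^+ n.
  elim: n => [|n IH]; first by rewrite mul0r addr0 expr0.
  rewrite exprS -natr1.
  have n0 : 0 <= n%:R * (l - 1) ^+ 2 by rewrite mulr_ge0// sqr_ge0.
  have := ler_wpM2l (ltW (lt_trans ltr01 l1)) IH; apply: le_trans; lra.
exists (Num.truncn (`|C| / (a * (l - 1)))).+1 => n Nn.
have : `|C| / (a * (l - 1)) < n%:R.
  by rewrite (lt_le_trans (truncnS_gt _))// ler_nat.
rewrite ltr_pdivrMr ?mulr_gt0// => /(le_lt_trans (ler_norm C))/lt_le_trans; apply.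
have := ler_wpM2r (ltW a0) (bern n); apply: le_trans; lra.
Qed.

Lemma geometric_lt {R : realType} (l a r : R) : 1 < l -> 0 < r ->
  exists N : nat, forall n, (N <= n)%N -> l^-1 ^+ n * a < r.
Proof.
move=> l1 r0; have [N HN] := geometric_gt a l1 r0.
exists N => n /HN h; rewrite exprVn mulrC.
by rewrite ltr_pdivrMr ?exprn_gt0 ?(lt_trans ltr01 l1)// mulrC.
Qed.

Lemma derive_le1_lipschitz {R : realType} (f df : R -> R) :
  (forall x : R, is_derive x (1 : R) f (df x)) -> (forall x, `|df x| <= 1) ->
  forall a b, `|f a - f b| <= `|a - b|.
Proof.
move=> fdf df1 a b; wlog ab : a b / b <= a.
  move=> W; have [/W//|/ltW/W] := leP b a.
  by rewrite (distrC (f b)) (distrC b).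
have cf : {within `[b, a], continuous f}.
  by apply: derivable_within_continuous => x _; have [] := fdf x.
have [c _ ->] := MVT_segment ab (fun x _ => fdf x) cf.
by rewrite normrM ler_piMl.
Qed.

Lemma cos_lipschitz {R : realType} (a b : R) : `|cos a - cos b| <= `|a - b|.
Proof.
apply: (@derive_le1_lipschitz _ cos (fun x => - sin x)) => x.
by rewrite normrN ler_norml sin_geN1 sin_le1.
Qed.

Lemma sin_lipschitz {R : realType} (a b : R) : `|sin a - sin b| <= `|a - b|.
Proof.
apply: (@derive_le1_lipschitz _ sin cos) => x.
by rewrite ler_norml cos_geN1 cos_le1.
Qed.

Section two_reflections.
Context {R : realType} {d : nat} (M : 'M[R]_d) (v : 'rV[R]_d).
Context (u1 u2 : 'rV[R]_d) (q10 : bil M u1 u1 != 0) (q20 : bil M u2 u2 != 0).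
Context (L : (borel_rV R d -> R) -> R) (bL : bounded_convergence L).

Let S1 := reflect_along M v u1.
Let S2 := reflect_along M v u2.
Let h1 := height M v u1.
Let h2 := height M v u2.
Let k1 := 2 * bil M u2 u1 / bil M u1 u1.
Let k2 := 2 * bil M u1 u2 / bil M u2 u2.

Hypothesis anti1 : forall f : borel_rV R d -> R, bounded_measurable f ->
  L (f \o S1) = - L f.
Hypothesis anti2 : forall f : borel_rV R d -> R, bounded_measurable f ->
  L (f \o S2) = - L f.

(* The functional is invariant under [T], see [invariant_iter]. *)
Let T x := S1 (S2 x).

Lemma height1_T x : h1 (T x) = - h1 x + k1 * h2 x.
Proof.
rewrite /T /h1 /S1 (height_reflect_self _ _ q10) /S2 height_reflect.
by rewrite -/h1 -/h2 -/k1; ring.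
Qed.

Lemma height2_T x : h2 (T x) = - k2 * h1 x + (k1 * k2 - 1) * h2 x.
Proof.
rewrite /T /h2 /S1 height_reflect /S2 height_reflect_self// height_reflect.
by rewrite -/h1 -/h2 -/k1 -/k2; ring.
Qed.

Lemma TDE x : T x = x + ((k1 * h2 x - h1 x) *: u1 + (- h2 x) *: u2).
Proof.
rewrite /T /S1 {1}/reflect_along /S2 height_reflect -/h1 -/h2 -/k1 /reflect_along -/h2.
by apply/rowP => i; rewrite !mxE; ring.
Qed.

Lemma bounded_measurable_reflect (f : borel_rV R d -> R) u : bounded_measurable f ->
  bounded_measurable (f \o reflect_along M v u : borel_rV R d -> R).
Proof.
move=> [mf [N fN]]; split; last by exists N => x; exact: fN.
exact: measurableT_comp (measurable_reflect_along M v u).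
Qed.

Lemma bounded_measurable_iter (f : borel_rV R d -> R) n : bounded_measurable f ->
  bounded_measurable (fun x : borel_rV R d => f (iter n T x)).
Proof.
move=> bf; elim: n f bf => [|n IH] f bf; first exact: bf.
rewrite /=; apply: (IH (f \o T)).
exact: (bounded_measurable_reflect u2 (bounded_measurable_reflect u1 bf)).
Qed.

Lemma invariant_iter (f : borel_rV R d -> R) n : bounded_measurable f ->
  L (fun x => f (iter n T x)) = L f.
Proof.
move=> bf; elim: n f bf => [//|n IH] f bf.
rewrite /= (IH (f \o T)); last first.
  exact: (bounded_measurable_reflect u2 (bounded_measurable_reflect u1 bf)).
rewrite -[RHS]opprK -(anti1 bf) -anti2//.
exact: bounded_measurable_reflect.
Qed.

(** Bounded regions that stay away from the common fixed points of the two
    reflections. *)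
Definition shell (K r : R) : set 'rV[R]_d :=
  [set x | cube d K x /\ r <= `|h1 x| + `|h2 x|].

Lemma measurable_shell K r : measurable (shell K r : set (borel_rV R d)).
Proof.
apply: measurableI; first exact: measurable_cube.
rewrite (_ : (fun _ => _) = (fun x => `|h1 x| + `|h2 x|) @^-1` `[r, +oo[); last first.
  by apply/seteqP; split=> x /=; rewrite in_itv/= andbT.
rewrite -[X in measurable X]setTI.
have mh u : measurable_fun [set: borel_rV R d] (fun x => `|height M v u x|).
  apply: measurableT_comp => //.
  by apply: continuous_measurable_rV; exact: continuous_height.
by apply: (measurable_funD (mh u1) (mh u2)).
Qed.

(** If every orbit leaves every shell then the invariant functional sees only the
    common fixed points of the reflections, where it equals its own opposite. *)
Lemma escape_zero :
  (forall K r x, 0 < r -> (h1 x != 0) || (h2 x != 0) ->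
    exists N : nat, forall n, (N <= n)%N -> ~ shell K r (iter n T x)) ->
  forall f : borel_rV R d -> R, bounded_measurable f -> L f = 0.
Proof.
move=> esc f bf; have [mf [C fC]] := bf.
have C0 : 0 <= C by rewrite (le_trans _ (fC 0)).
pose g K r (x : borel_rV R d) := f x * \1_(shell K r) x.
have bg K r : bounded_measurable (g K r).
  apply: bounded_measurableM => //; apply: bounded_measurable_indic.
  exact: measurable_shell.
have gC K r x : `|g K r x| <= C.
  rewrite /g normrM (le_trans _ (fC x))// ler_piMr// indicE.
  by case: (_ \in _); rewrite ?normr1 ?normr0.
have Lg K r : 0 < r -> L (g K r) = 0.
  move=> r0.
  apply: (@cvg_seq_unique _ (fun n => L (fun x => g K r (iter n T x)))).
    by under eq_cvg do rewrite (invariant_iter _ (bg K r)); exact: cvg_cst.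
  rewrite -(bounded_convergence0 bL); apply: (bL.2 _ _ C).
  - by move=> n; have [] := bounded_measurable_iter n (bg K r).
  - by move=> n x; exact: gC.
  move=> x; apply: cvg_near_cst.
  have [h0|] := boolP ((h1 x != 0) || (h2 x != 0)).
    have [N HN] := esc K r x r0 h0; exists N => // n /= /HN Sn.
    by apply/eqP; rewrite /g indicE memNset// mulr0.
  rewrite negb_or !negbK => /andP[/eqP h10 /eqP h20].
  exists 0%N => // n _; apply/eqP; rewrite /g indicE memNset ?mulr0// => -[_].
  suff [-> ->] : h1 (iter n T x) = 0 /\ h2 (iter n T x) = 0.
    by rewrite normr0 addr0 leNgt r0.
  elim: n => [//|n [IH1 IH2]] /=.
  by rewrite height1_T height2_T IH1 IH2 !mulr0 oppr0 addr0.
(* The functions [g n (1 / n)] exhaust [f] off the common fixed points. *)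
pose fix_ (x : borel_rV R d) : R := ((h1 x == 0) && (h2 x == 0))%:R.
have cvgf x : f x - g n%:R n.+1%:R^-1 x @[n --> \oo] --> f x * fix_ x.
  apply: cvg_near_cst; rewrite /fix_.
  have [h0|] := boolP ((h1 x == 0) && (h2 x == 0)).
    move: (h0) => /andP[/eqP h10 /eqP h20].
    exists 0%N => // n _; apply/eqP; rewrite /g indicE memNset ?mulr0 ?subr0 ?mulr1// => -[_].
    by rewrite h10 h20 normr0 addr0 leNgt invr_gt0 ltr0n.
  rewrite negb_and -!normr_gt0 => h0.
  have hp : 0 < `|h1 x| + `|h2 x|.
    by move: h0 => /orP[] ?; [rewrite ltr_pwDl|rewrite ltr_pwDr].
  have [N1 HN1] : exists N : nat, (`|h1 x| + `|h2 x|)^-1 < N%:R.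
    by eexists; exact: truncnS_gt.
  have [N2 HN2] : exists N : nat, \sum_i `|x 0 i| < N%:R.
    by eexists; exact: truncnS_gt.
  exists (maxn N1 N2) => // n /=; rewrite geq_max => /andP[n1 n2].
  apply/eqP; rewrite /g indicE mem_set ?mulr1 ?subrr ?mulr0//; split.
    move=> i; rewrite (@le_trans _ _ (\sum_i `|x 0 i|))//.
      by rewrite (bigD1 i)//= lerDl sumr_ge0.
    by rewrite (le_trans (ltW HN2))// ler_nat.
  rewrite invf_ple ?posrE// (le_trans (ltW HN1))// ler_nat.
  exact: leq_trans n1 _.
have bfg n : bounded_measurable (fun x : borel_rV R d => f x - g n%:R n.+1%:R^-1 x).
  rewrite (_ : (fun _ => _) = fun x : borel_rV R d => -1 * g n%:R n.+1%:R^-1 x + f x).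
    exact: bounded_measurable_lin.
  by apply/funext => x; ring.
have fgC n x : `|f x - g n%:R n.+1%:R^-1 x| <= C + C.
  by rewrite (le_trans (ler_normB _ _))// lerD.
have bfix : bounded_measurable (fun x : borel_rV R d => f x * fix_ x).
  by apply: (@bounded_measurable_lim _ _ (borel_rV R d) _ _ (C + C) _ fgC cvgf) => n; case: (bfg n).
have Lfix : L f = L (fun x => f x * fix_ x).
  apply: (@cvg_seq_unique _ (fun n => L (fun x => f x - g n%:R n.+1%:R^-1 x))).
    under eq_cvg do rewrite (bounded_convergenceB bL bf (bg _ _)) Lg ?invr_gt0// subr0.
    exact: cvg_cst.
  by apply: (bL.2 _ _ (C + C)) => // n; case: (bfg n).
have := anti1 bfix; rewrite Lfix.
have -> : (fun x : borel_rV R d => f x * fix_ x) \o S1 = (fun x => f x * fix_ x).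
  apply/funext => x /=; have h1S : h1 (S1 x) = - h1 x by exact: height_reflect_self.
  rewrite /fix_ h1S oppr_eq0.
  have [h10|_] := eqVneq (h1 x) 0; last by rewrite !mulr0.
  suff -> : S1 x = x by [].
  by rewrite /S1 /reflect_along -/h1 h10 scale0r subr0.
by move=> /eqP; rewrite -addr_eq0 -mulr2n mulrn_eq0/= => /eqP.
Qed.

Lemma height_bounded u K : exists C : R, forall x, cube d K x -> `|height M v u x| <= C.
Proof.
have : compact (height M v u @` cube d K).
  apply: continuous_compact; last exact: cube_compact.
  by apply: continuous_subspaceT; exact: continuous_height.
move=> /compact_bounded[C [_ HC]]; exists (`|C| + 1) => x xK.
by apply: HC; [rewrite (le_lt_trans (ler_norm _))// ltrDl|exists x].
Qed.

(** Hyperbolic case: the heights evolve by a matrix with real eigenvalues [l], [1 / l],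
    [1 < |l|].  The coordinate for [l] explodes unless it is zero, and then both heights
    shrink to 0. *)
Lemma escape_hyperbolic : k1 * k2 < 0 \/ 4 < k1 * k2 ->
  forall K r x, 0 < r -> (h1 x != 0) || (h2 x != 0) ->
    exists N : nat, forall n, (N <= n)%N -> ~ shell K r (iter n T x).
Proof.
move=> hyp K r x r0 hx; set tau := k1 * k2 - 2.
(* [l] is the root of larger modulus of the characteristic polynomial. *)
have [l [leq l1]] : exists l : R, l ^+ 2 - tau * l + 1 = 0 /\ 1 < `|l|.
  have tau2 : 0 < tau ^+ 2 - 4.
    by rewrite /tau; case: hyp => h; nra.
  pose s := Num.sqrt (tau ^+ 2 - 4).
  have s2 : s ^+ 2 = tau ^+ 2 - 4 by rewrite sqr_sqrtr// ltW.
  have s0 : 0 < s by rewrite sqrtr_gt0.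
  case: hyp => h.
    exists ((tau - s) / 2); split; first by nra.
    by rewrite ltr0_norm; rewrite /tau; lra.
  exists ((tau + s) / 2); split; first by nra.
  by rewrite gtr0_norm; rewrite /tau; lra.
have l0 : l != 0 by apply: contraTneq l1 => ->; rewrite normr0 ltr10.
have k20 : k2 != 0 by apply: contraPneq hyp => ->; rewrite mulr0 ltxx => -[//|]; lra.
pose p y := - k2 * h1 y + (1 + l) * h2 y.
pose q y := - k2 * h1 y + (1 + l^-1) * h2 y.
have kE : k1 * k2 = l + l^-1 + 2.
  have : tau * l = l ^+ 2 + 1 by lra.
  move=> /(congr1 (fun z => z / l)); rewrite mulfK// /tau => h.
  by rewrite -[LHS](subrK 2) h; field.
have pT y : p (T y) = l * p y.
  rewrite /p height1_T height2_T kE.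
  rewrite (_ : - k2 * (- h1 y + k1 * h2 y) = k2 * h1 y - (k1 * k2) * h2 y); last by ring.
  by rewrite kE; field.
have qT y : q (T y) = l^-1 * q y.
  rewrite /q height1_T height2_T kE.
  rewrite (_ : - k2 * (- h1 y + k1 * h2 y) = k2 * h1 y - (k1 * k2) * h2 y); last by ring.
  by rewrite kE; field.
have pn n : p (iter n T x) = l ^+ n * p x.
  by elim: n => [|n IH]; rewrite ?mul1r//= pT IH exprS mulrA.
have qn n : q (iter n T x) = l^-1 ^+ n * q x.
  by elim: n => [|n IH]; rewrite ?mul1r//= qT IH exprS mulrA.
have [p0|p0] := eqVneq (p x) 0.
  have lV : l - l^-1 != 0.
    rewrite subr_eq0; apply: contraTneq l1 => lE.
    have : l ^+ 2 = 1 by rewrite expr2 {2}lE divff.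
    move=> /(congr1 Num.norm); rewrite normrX normr1 => /eqP.
    by rewrite pexpr_eq1// => /eqP ->; rewrite ltxx.
  have h2E y : p y = 0 -> h2 y = - q y / (l - l^-1).
    move=> py; have -> : - q y = h2 y * (l - l^-1) by rewrite -[LHS]add0r -py /p /q; ring.
    by rewrite mulfK.
  have h1E y : p y = 0 -> h1 y = (1 + l) * h2 y / k2.
    rewrite /p => py; have -> : (1 + l) * h2 y = k2 * h1 y by lra.
    by rewrite mulrAC divff// mul1r.
  pose D := `|l - l^-1|^-1 * (1 + `|(1 + l) / k2|).
  have [N HN] := geometric_lt (`|q x| * D) l1 r0.
  exists N => n /HN Nn [_]; apply/negP; rewrite -ltNge.
  have py : p (iter n T x) = 0 by rewrite pn p0 mulr0.
  rewrite h1E// mulrAC normrM h2E// qn.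
  rewrite !normrM normrN normrM normfV normrX normfV.
  apply: le_lt_trans Nn; rewrite /D exprVn.
  rewrite [`|(1 + l) / k2|]normrM !normfV.
  by rewrite le_eqVlt; apply/orP; left; apply/eqP; ring.
have [C1 HC1] := height_bounded u1 K; have [C2 HC2] := height_bounded u2 K.
have px0 : 0 < `|p x| by rewrite normr_gt0.
have [N HN] := geometric_gt (`|k2| * C1 + `|1 + l| * C2) l1 px0.
exists N => n /HN Nn [xK _]; move: Nn; apply/negP; rewrite -leNgt.
rewrite -normrX -normrM -pn /p (le_trans (ler_normD _ _))//.
rewrite [`|- k2 * _|]normrM normrN [`|(1 + l) * _|]normrM.
by apply: lerD; apply: ler_wpM2l => //; do ?[exact: HC1|exact: HC2].
Qed.

(** Parabolic case: [T] acts unipotently on the heights.  Either [h2] grows linearly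
    along the orbit, or the heights are constant and the orbit is a translation by a
    fixed combination of [u1] and [u2], which is nonzero since they are independent and
    the heights are not both 0. *)
Lemma escape_parabolic : k1 * k2 = 4 ->
  (forall a b : R, a *: u1 + b *: u2 = 0 -> a = 0 /\ b = 0) ->
  forall K r x, 0 < r -> (h1 x != 0) || (h2 x != 0) ->
    exists N : nat, forall n, (N <= n)%N -> ~ shell K r (iter n T x).
Proof.
move=> kk free K r x r0 hx.
have k20 : k2 != 0 by apply: contra_eq_neq kk => ->; rewrite mulr0 eq_sym.
pose p y := - k2 * h1 y + 2 * h2 y.
have pT y : p (T y) = p y.
  rewrite /p height1_T height2_T kk.
  rewrite (_ : - k2 * (- h1 y + k1 * h2 y) = k2 * h1 y - (k1 * k2) * h2 y); last by ring.
  by rewrite kk; ring.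
have pn n : p (iter n T x) = p x by elim: n => //= n IH; rewrite pT.
have h2n n : h2 (iter n T x) = h2 x + n%:R * p x.
  elim: n => [|n IH] /=; first by rewrite mul0r addr0.
  have -> : h2 (T (iter n T x)) = h2 (iter n T x) + p (iter n T x).
    by rewrite height2_T kk /p; ring.
  by rewrite pn IH -natr1; ring.
have lin_gt (a b C : R) : b != 0 -> exists N : nat, forall n, (N <= n)%N -> C < `|a + n%:R * b|.
  move=> b0; exists (Num.truncn ((`|C| + `|a|) / `|b|)).+1 => n Nn.
  have : (`|C| + `|a|) / `|b| < n%:R by rewrite (lt_le_trans (truncnS_gt _))// ler_nat.
  rewrite ltr_pdivrMr ?normr_gt0// => h.
  have := lerB_normD (n%:R * b) a; rewrite normrM normr_nat [n%:R * b + a]addrC => h'.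
  have := ler_norm C; lra.
have [p0|p0] := eqVneq (p x) 0; last first.
  have [C2 HC2] := height_bounded u2 K.
  have [N HN] := lin_gt (h2 x) (p x) C2 p0.
  exists N => n /HN Nn [xK _]; move: Nn; apply/negP; rewrite -leNgt -h2n.
  exact: HC2.
have h1E y : p y = 0 -> k1 * h2 y = 2 * h1 y.
  rewrite /p => py; apply: (mulIf k20); have : k2 * h1 y = 2 * h2 y by lra.
  by move=> h; rewrite mulrAC kk -[2 * h1 y * k2]mulrA [h1 y * k2]mulrC h; ring.
pose delta := h1 x *: u1 + (- h2 x) *: u2.
have h2c n : h2 (iter n T x) = h2 x by rewrite h2n p0 mulr0 addr0.
have h1c n : h1 (iter n T x) = h1 x.
  have e1 := h1E _ p0; have e2 := h1E (iter n T x); move: e2; rewrite pn h2c => /(_ p0).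
  by lra.
have TE n : iter n T x = x + n%:R *: delta.
  elim: n => [|n IH]; first by rewrite scale0r addr0.
  rewrite iterS TDE h1c h2c h1E// IH -natr1.
  by apply/rowP => i; rewrite !mxE; ring.
have d0 : delta != 0.
  apply: contraTneq hx => /free[-> /eqP]; rewrite oppr_eq0 => /eqP ->.
  by rewrite !eqxx.
clearbody delta; have [i di] : exists i, delta 0 i != 0.
  apply: contrapT => H; move/eqP: d0; apply; apply/rowP => i; rewrite [RHS]mxE.
  by apply/eqP; apply: contrapT => /negP di; apply: H; exists i.
have [N HN] := lin_gt (x 0 i) (delta 0 i) K di.
exists N => n /HN Nn [/(_ i) + _]; rewrite TE !mxE => xK.
by move: Nn; rewrite ltNge xK.
Qed.

(** Elliptic case: in suitable coordinates [T] is a rotation by an irrational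
    angle on each circle, while each reflection maps circles to themselves.  The
    Birkhoff averages of a character along the orbits of [x] and of its reflection
    have the same limit; the functional is invariant under [T] and reversed by the
    reflection, so that it kills the character. *)
Lemma rotation_zero (kap th : R) : kap != 0 -> sin th != 0 ->
  k1 = 2 * kap * cos th -> k2 = 2 * cos th / kap ->
  (forall (n : nat) (p : int), (0 < n)%N -> n%:R * (2 * th) != p%:~R * (pi *+ 2)) ->
  forall f : borel_rV R d -> R, bounded_measurable f -> L f = 0.
Proof.
move=> kap0 s0 k1E k2E irr.
(* In the coordinates [h1], [Y] the map [T] is the rotation of angle [- 2 * th], and
   the reflection [S1] is the symmetry [h1 |-> - h1]. *)
pose c := cos th; pose s := sin th.
have c2 : c ^+ 2 = 1 - s ^+ 2 by rewrite -(cos2Dsin2 th) addrK.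
pose Y y := (kap * h2 y - c * h1 y) / s.
have sY y : s * Y y = kap * h2 y - c * h1 y by rewrite mulrC divfK.
have c2E : cos (2 * th) = 1 - 2 * s ^+ 2.
  by rewrite mulr_natl mulr2n cosD -!expr2 -/c -/s c2; ring.
have s2E : sin (2 * th) = 2 * s * c.
  by rewrite mulr_natl mulr2n sinD -/c -/s; ring.
have XT y : h1 (T y) = cos (2 * th) * h1 y + sin (2 * th) * Y y.
  rewrite height1_T k1E -/c c2E s2E.
  have -> : 2 * s * c * Y y = 2 * c * (s * Y y) by ring.
  rewrite sY; have -> : s ^+ 2 = 1 - c ^+ 2 by rewrite c2; ring.
  by ring.
have YT y : Y (T y) = - sin (2 * th) * h1 y + cos (2 * th) * Y y.
  apply: (mulfI s0); rewrite -/s sY mulrDr [s * (cos _ * _)]mulrCA sY.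
  rewrite height1_T height2_T k1E k2E -/c c2E s2E.
  have -> : s * (- (2 * s * c) * h1 y) = - 2 * c * s ^+ 2 * h1 y by ring.
  have -> : s ^+ 2 = 1 - c ^+ 2 by rewrite c2; ring.
  by field.
have YS y : Y (S1 y) = Y y.
  have h1S : h1 (S1 y) = - h1 y by exact: height_reflect_self.
  apply: (mulfI s0); rewrite -/s !sY h1S /h2 /S1 height_reflect -/h1 -/h2 -/k2 k2E -/c.
  by field.
pose on_circle r phi y := h1 y = r * cos phi /\ Y y = r * sin phi.
have circleT r phi y n : on_circle r phi y ->
    on_circle r (phi - n%:R * (2 * th)) (iter n T y).
  move=> hy; elim: n => [|n [IH1 IH2]]; first by rewrite mul0r subr0.
  have -> : phi - n.+1%:R * (2 * th) = phi - n%:R * (2 * th) - 2 * th.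
    by rewrite -natr1; ring.
  rewrite /on_circle iterS XT YT IH1 IH2 [cos (_ - 2 * th)]cosB [sin (_ - 2 * th)]sinB.
  by split; ring.
have circleS r phi y : on_circle r phi y -> on_circle r (pi - phi) (S1 y).
  move=> [h1y Yy]; rewrite /on_circle cosB sinB cospi sinpi.
  have h1S : h1 (S1 y) = - h1 y by exact: height_reflect_self.
  split; first by rewrite h1S h1y; ring.
  by rewrite YS Yy; ring.
have kill (F : R -> R) xi : (forall t, `|F t| <= 1) ->
    (forall a b, `|F a - F b| <= `|a - b|) ->
    measurable_fun setT (fun x : borel_rV R d => F (dotv x xi)) ->
    L (fun x => F (dotv x xi)) = 0.
  move=> F1 Flip mF; pose f x := F (dotv x xi).
  have bf : bounded_measurable (f : borel_rV R d -> R).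
    by split=> //; exists 1 => x; exact: F1.
  (* The values of [p] and [q] make [g] invariant under both reflections. *)
  pose p := dotv u1 xi / 2; pose q := (dotv u2 xi - p * k1) / (2 * kap * s).
  pose g y := dotv y xi - p * h1 y - q * Y y.
  have gS1 y : g (S1 y) = g y.
    have h1S : h1 (S1 y) = - h1 y by exact: height_reflect_self.
    have -> : g (S1 y) = dotv (S1 y) xi - p * h1 (S1 y) - q * Y (S1 y) by [].
    by rewrite YS h1S /S1 /reflect_along -/h1 dotvBl dotvZl /g /p; field.
  have gS2 y : g (S2 y) = g y.
    have h2S : h2 (S2 y) = - h2 y by exact: height_reflect_self.
    have -> : g (S2 y) = dotv (S2 y) xi - p * h1 (S2 y) - q * Y (S2 y) by [].
    have h1S : h1 (S2 y) = h1 y - k1 * h2 y by exact: height_reflect.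
    have -> : Y (S2 y) = Y y - 2 * kap * s * h2 y.
      apply: (mulfI s0); rewrite -/s sY mulrBr sY h1S h2S k1E -/c.
      have -> : s * (2 * kap * s * h2 y) = 2 * kap * s ^+ 2 * h2 y by ring.
      have -> : s ^+ 2 = 1 - c ^+ 2 by rewrite c2; ring.
      by ring.
    rewrite h1S /S2 /reflect_along -/h2 dotvBl dotvZl /g /q; field.
    by rewrite kap0 s0.
  have gT n y : g (iter n T y) = g y.
    by elim: n => [//|n IH]; rewrite iterS /T gS1 gS2.
  pose avg n x := n.+1%:R^-1 * \sum_(i < n.+1) (f (iter i T x) - f (iter i T (S1 x))).
  have bterm i : bounded_measurable
      (fun x : borel_rV R d => f (iter i T x) - f (iter i T (S1 x))).
    rewrite (_ : (fun _ => _) = fun x : borel_rV R d =>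
        -1 * f (iter i T (S1 x)) + f (iter i T x)).
      apply: bounded_measurable_lin; last exact: bounded_measurable_iter.
      exact: (bounded_measurable_reflect u1 (bounded_measurable_iter i bf)).
    by apply/funext => x; ring.
  have Lterm i : L (fun x => f (iter i T x) - f (iter i T (S1 x))) = 2 * L f.
    rewrite (bounded_convergenceB bL (bounded_measurable_iter i bf)
      (bounded_measurable_reflect u1 (bounded_measurable_iter i bf))).
    rewrite (anti1 (bounded_measurable_iter i bf)) (invariant_iter i bf); ring.
  have bsum n : bounded_measurable (fun x : borel_rV R d =>
        \sum_(i < n) (f (iter i T x) - f (iter i T (S1 x)))) /\
      L (fun x => \sum_(i < n) (f (iter i T x) - f (iter i T (S1 x)))) = n%:R * (2 * L f).
    elim: n => [|n [IH1 IH2]].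
      under eq_fun do rewrite big_ord0.
      by rewrite mul0r (bounded_convergence0 bL); split=> //; exact: bounded_measurable_cst.
    under eq_fun do rewrite big_ord_recr/=.
    split; first exact: bounded_measurableD.
    by rewrite (bounded_convergenceD bL)// IH2 Lterm -natr1; ring.
  have Lavg n : L (avg n) = 2 * L f.
    have n0 : n.+1%:R != 0 :> R by rewrite pnatr_eq0.
    rewrite -[RHS](mulKf n0) -(bsum n.+1).2 -(bounded_convergenceZ bL)//.
    exact: (bsum _).1.
  have : 2 * L f = 0.
    apply: (@cvg_seq_unique _ (fun n => L (avg n))).
      by under eq_cvg do rewrite Lavg; exact: cvg_cst.
    rewrite -(bounded_convergence0 bL); apply: (bL.2 _ _ 2).
    - by move=> n; have [] := bounded_measurableZ n.+1%:R^-1 (bsum n.+1).1.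
    - move=> n x; rewrite normrM ger0_norm ?invr_ge0// mulrC ler_pdivrMr ?ltr0n//.
      rewrite (le_trans (ler_norm_sum _ _ _))//.
      rewrite (@le_trans _ _ (\sum_(i < n.+1) 2))//.
        apply: ler_sum => i _; apply: (le_trans (ler_normB _ _)).
        exact: lerD (F1 _) (F1 _).
      by rewrite sumr_const card_ord mulr_natr.
    move=> x; have [r [phi hx]] := polar (h1 x) (Y x).
    pose H t := F (g x + p * (r * cos t) + q * (r * sin t)).
    have fH psi y n : g y = g x -> on_circle r psi y ->
        f (iter n T y) = H (psi - n%:R * (2 * th)).
      move=> gy /(circleT _ _ _ n)[Xy Yy]; rewrite /f /H -Xy -Yy -gy -(gT n y).
      by congr F; rewrite /g; ring.
    under eq_cvg => n.
      rewrite /avg; under eq_bigr => i _.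
        rewrite (fH phi x i erefl hx) (fH (pi - phi) (S1 x) i (gS1 x) (circleS _ _ _ hx)).
        over.
      over.
    apply: (@rotation_averages _ H (`|p * r| + `|q * r|) (pi *+ 2)) => //.
    - by rewrite mulrn_wgt0// pi_gt0.
    - by move=> t; rewrite /H cosD2pi sinD2pi.
    - by move=> t; exact: F1.
    move=> a b; apply: (le_trans (Flip _ _)).
    rewrite (_ : _ - _ = p * r * (cos a - cos b) + q * r * (sin a - sin b)); last by ring.
    rewrite (le_trans (ler_normD _ _))// [`|p * r * (_ - _)|]normrM.
    rewrite [`|q * r * (_ - _)|]normrM mulrDl lerD//.
      by apply: ler_wpM2l => //; exact: cos_lipschitz.
    by apply: ler_wpM2l => //; exact: sin_lipschitz.
  by move/eqP; rewrite mulf_eq0 pnatr_eq0 => /eqP.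
apply: (fourier_uniqueness bL) => xi; apply: kill.
- by move=> t; rewrite ler_norml cos_geN1 cos_le1.
- exact: cos_lipschitz.
- by have [] := bounded_cos_dotv xi.
- by move=> t; rewrite ler_norml sin_geN1 sin_le1.
- exact: sin_lipschitz.
- by have [] := bounded_sin_dotv xi.
Qed.

End two_reflections.

(** * The exceptional set *)

Section exceptional_set.
Context {R : realType} {d : nat} (M : 'M[R]_d).

(** The squared cosines of the rational multiples of [pi], listed along [nat] so that
    the exceptional set is a countable union. *)
Definition rational_cos2 (n : nat) : R :=
  cos (pi * ratr (odflt 0 (unpickle n : option rat))) ^+ 2.

Lemma rational_cos2E (r : rat) : exists n, rational_cos2 n = cos (pi * ratr r) ^+ 2.
Proof. by exists (pickle r); rewrite /rational_cos2 pickleK. Qed.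

(** The product of the reflections along [a] and [b] has finite order on the plane of
    [a] and [b], being a rotation by a rational angle. *)
Definition resonant (n : nat) (a b : 'rV[R]_d) : Prop :=
  [/\ bil M a a != 0, rational_cos2 n != 1 &
      bil M a b ^+ 2 = rational_cos2 n * bil M a a * bil M b b].

Definition exceptional : set ('rV[R]_d * 'rV[R]_d) :=
  [set p | [/\ sphere R d p.1, sphere R d p.2 & exists n, resonant n p.1 p.2]].

Lemma measurable_bil2 : measurable_fun setT
  (fun p : borel_rV R d * borel_rV R d => bil M p.1 p.2).
Proof.
under eq_fun do rewrite bilE; apply: measurable_sum => j; apply: measurable_funM.
  apply: (measurableT_comp (f := fun x : borel_rV R d => dotv x (col j M)^T)).
    exact: measurable_dotv.
  exact: measurable_fst.
exact: (measurableT_comp (measurable_coord_rV j) measurable_snd).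
Qed.

(** Up to the factor [d], the surface measure of a set is the volume of the cone over it;
    since [f] is homogeneous, this cone is contained in the zero set of [f]. *)
Lemma surface_cone_null (f : 'rV[R]_d -> R) (x0 : 'rV[R]_d) : continuous f ->
  (forall x y, exists p : {poly R}, forall t, f (x + t *: y) = p.[t]) ->
  (forall t x, f (t *: x) = t ^+ 2 * f x) -> f x0 != 0 ->
  surface_measure R d (f @^-1` [set 0]) = 0%E.
Proof.
move=> cf pf hf f0; have nf := zero_set_null cf pf f0.
have mZ : measurable (f @^-1` [set 0] : set (borel_rV R d)).
  by rewrite -[X in measurable X]setTI; apply: continuous_measurable_rV.
rewrite /surface_measure (_ : lebesgue_rV R d _ = 0%E) ?mule0//.
apply/eqP; rewrite eq_le measure_ge0 andbT -nf; apply: le_measure; rewrite ?inE//.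
  apply: measurableI; first exact: measurable_punctured_ball.
  by rewrite -[X in measurable X]setTI; apply: measurable_normalize.
move=> x [/andP[x0' _]] /= /eqP; rewrite /normalize hf mulf_eq0 => /orP[|/eqP//].
by rewrite expf_eq0/= invr_eq0 gt_eqF.
Qed.

Lemma resonant_null n a : surface_measure R d [set b | resonant n a b] = 0%E.
Proof.
have [qa|qa] := eqVneq (bil M a a) 0.
  rewrite (_ : [set b | _] = set0) ?measure0//.
  by apply/seteqP; split=> // b [/eqP].
have [cn|cn] := eqVneq (rational_cos2 n) 1.
  rewrite (_ : [set b | _] = set0) ?measure0//.
  by apply/seteqP; split=> // b [_ /eqP].
pose f b := bil M a b ^+ 2 - rational_cos2 n * bil M a a * bil M b b.
rewrite (_ : [set b | _] = f @^-1` [set 0]); last first.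
  apply/seteqP; split=> [b [_ _ /= h]|b /= /eqP]; first by rewrite /f h subrr.
  by rewrite subr_eq0 => /eqP.
apply: (@surface_cone_null f a).
- apply: continuous_funB.
    rewrite (_ : (fun _ => _) = fun b => bil M^T b a * bil M^T b a).
      by apply: continuous_funM; exact: continuous_bill.
    by apply/funext => b; rewrite bilT expr2.
  by apply: continuous_funZ; exact: continuous_bil_diag.
- move=> x y; exists (((bil M a x)%:P + (bil M a y)%:P * 'X) ^+ 2 -
    (rational_cos2 n * bil M a a)%:P * ((bil M x x)%:P +
      (bil M x y + bil M y x)%:P * 'X + (bil M y y)%:P * 'X ^+ 2)) => t.
  rewrite /f !bilDr !bilDl !bilZr !bilZl.
  rewrite !(hornerD, hornerN, horner_exp, hornerM, hornerC, hornerX).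
  by ring.
- by move=> t x; rewrite /f !bilZr !bilZl; ring.
(* At [b = a] both terms are multiples of the square of [bil M a a]. *)
rewrite /f (_ : _ - _ = (1 - rational_cos2 n) * bil M a a * bil M a a); last by ring.
by rewrite !mulf_neq0// subr_eq0 eq_sym.
Qed.

Lemma measurable_resonant n : measurable
  ([set p | resonant n p.1 p.2] : set (borel_rV R d * borel_rV R d)).
Proof.
have [cn|cn] := eqVneq (rational_cos2 n) 1.
  rewrite (_ : [set p | _] = set0); first exact: measurable0.
  by apply/seteqP; split=> // p [_ /eqP].
have mdiag : measurable_fun setT (fun x : borel_rV R d => bil M x x).
  by apply: continuous_measurable_rV; exact: continuous_bil_diag.
have m1 : measurable_fun setT (fun p : borel_rV R d * borel_rV R d => bil M p.1 p.1).
  exact: (measurableT_comp mdiag measurable_fst).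
have m2 : measurable_fun setT (fun p : borel_rV R d * borel_rV R d => bil M p.2 p.2).
  exact: (measurableT_comp mdiag measurable_snd).
pose g (p : borel_rV R d * borel_rV R d) :=
  bil M p.1 p.2 * bil M p.1 p.2 - rational_cos2 n * bil M p.1 p.1 * bil M p.2 p.2.
have mg : measurable_fun setT g.
  apply: measurable_funB; first exact: measurable_funM measurable_bil2 measurable_bil2.
  by apply: measurable_funM => //; apply: measurable_funM.
rewrite (_ : [set p | _] = (fun p : borel_rV R d * borel_rV R d => bil M p.1 p.1) @^-1` (~` [set 0]) `&`
    g @^-1` [set 0]); last first.
  apply/seteqP; split=> [p [/eqP q _ /= h]|p [/= q /eqP]].
    by split=> //=; rewrite /g -expr2 h subrr.
  by rewrite subr_eq0 -expr2 => /eqP h; split=> //; exact/eqP.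
by apply: measurableI; rewrite -[X in measurable X]setTI;
  [apply: m1 => //; exact: measurableC|exact: mg].
Qed.

(** By Fubini it suffices that almost every slice is null; the slice over [a] is a
    countable union of quadratic cones, none of which is everything because none
    contains [a] itself. *)
Lemma negligible_exceptional :
  (surface_measure R d \x surface_measure R d)%E.-negligible exceptional.
Proof.
exists (\bigcup_n [set p | resonant n p.1 p.2]); split.
- by apply: bigcupT_measurable => n; exact: measurable_resonant.
- rewrite /product_measure1 (_ : _ \o _ = cst 0%E) ?integral0//.
  apply/funext => a /=.
  rewrite (_ : xsection _ _ = \bigcup_n [set b | resonant n a b]); last first.
    by apply/seteqP; split=> b; rewrite /xsection/= ?inE.
  have mR n : measurable ([set b | resonant n a b] : set (borel_rV R d)).
    rewrite (_ : [set b | _] = xsection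
        ([set p | resonant n p.1 p.2] : set (borel_rV R d * borel_rV R d)) a).
      exact: (measurable_xsection a (measurable_resonant n)).
    by apply/seteqP; split=> b; rewrite /xsection/= inE.
  apply/negligibleP; first exact: bigcupT_measurable.
  by apply: negligible_bigcup => n; apply/negligibleP => //; exact: resonant_null.
by move=> p [_ _ [n h]]; exists n.
Qed.

End exceptional_set.

Section two_directions.
Context {R : realType} {d : nat}.

Lemma sphere_dotv (u : 'rV[R]_d) : sphere R d u -> dotv u u = 1.
Proof.
rewrite /sphere/= /enorm => u1; have u0 : 0 <= dotv u u.
  by apply: sumr_ge0 => i _; rewrite -expr2 sqr_ge0.
by rewrite -(sqr_sqrtr u0) u1 expr1n.
Qed.

Lemma sphere_free (u1 u2 : 'rV[R]_d) : sphere R d u1 -> sphere R d u2 ->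
  u1 <> u2 -> u1 <> - u2 ->
  forall a b : R, a *: u1 + b *: u2 = 0 -> a = 0 /\ b = 0.
Proof.
move=> /sphere_dotv s1 /sphere_dotv s2 u12 u12' a b ab.
have [a0|a0] := eqVneq a 0.
  split=> //; move: ab; rewrite a0 scale0r add0r => /(congr1 (fun x => dotv x u2)).
  by rewrite dotvZl s2 mulr1 dotvC dotv0r.
exfalso; have uE : u1 = (- b / a) *: u2.
  apply: (scalerI a0); rewrite scalerA mulrC divfK// scaleNr.
  by apply/eqP; rewrite -addr_eq0 ab.
have : (- b / a) ^+ 2 == 1.
  by apply/eqP; move: s1; rewrite uE dotvZl dotvZr s2 mulr1 expr2.
rewrite sqrf_eq1 => /orP[] /eqP e; move: uE; rewrite e ?scale1r ?scaleN1r//.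
Qed.

(** The product [k1 * k2] decides between the hyperbolic, parabolic and elliptic cases;
    outside resonance the elliptic angle is irrational. *)
Lemma not_resonant_zero (M : 'M[R]_d) (MT : M^T = M) (v : 'rV[R]_d)
    (L : (borel_rV R d -> R) -> R) (u1 u2 : 'rV[R]_d) : bounded_convergence L ->
  sphere R d u1 -> sphere R d u2 -> u1 <> u2 -> u1 <> - u2 ->
  bil M u1 u1 != 0 -> bil M u2 u2 != 0 -> (forall n, ~ resonant M n u1 u2) ->
  (forall f : borel_rV R d -> R, bounded_measurable f ->
    L (f \o reflect_along M v u1) = - L f) ->
  (forall f : borel_rV R d -> R, bounded_measurable f ->
    L (f \o reflect_along M v u2) = - L f) ->
  forall f : borel_rV R d -> R, bounded_measurable f -> L f = 0.
Proof.
move=> bL s1 s2 u12 u12' q1 q2 nres anti1 anti2.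
pose k1 := 2 * bil M u2 u1 / bil M u1 u1; pose k2 := 2 * bil M u1 u2 / bil M u2 u2.
pose b := bil M u1 u2.
have bC : bil M u2 u1 = b by rewrite bilC.
have kE : k1 * k2 = 4 * b ^+ 2 / (bil M u1 u1 * bil M u2 u2).
  by rewrite /k1 /k2 bC -/b; field; rewrite q1 q2.
have res_cos th : b ^+ 2 = cos th ^+ 2 * bil M u1 u1 * bil M u2 u2 ->
    cos th ^+ 2 != 1 -> forall r : rat, th <> pi * ratr r.
  move=> bE c1 r thE; have [n nE] := @rational_cos2E R r.
  by apply: (nres n); split=> //; rewrite nE -thE.
have [k0|k0] := ltP (k1 * k2) 0.
  by apply: (escape_zero q1 q2 bL anti1 anti2); apply: escape_hyperbolic => //; left.
have [k4|] := ltP 4 (k1 * k2).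
  by apply: (escape_zero q1 q2 bL anti1 anti2); apply: escape_hyperbolic => //; right.
rewrite le_eqVlt => /orP[/eqP k4|k4].
  apply: (escape_zero q1 q2 bL anti1 anti2); apply: escape_parabolic => //.
  exact: sphere_free.
have [b0|b0] := eqVneq b 0.
  (* Orthogonal directions are resonant, with angle [pi / 2]. *)
  exfalso; apply: (res_cos (pi / 2) _ _ (2^-1)).
  - by rewrite b0 cos_pihalf expr0n/= !mul0r.
  - by rewrite cos_pihalf expr0n/= eq_sym oner_eq0.
  by congr (_ * _); rewrite fmorphV; congr (_^-1); rewrite rmorph_nat.
have qq : 0 < bil M u1 u1 * bil M u2 u2.
  rewrite lt_def mulf_neq0//= -invr_ge0.
  have b2 : 0 < 4 * b ^+ 2 by rewrite mulr_gt0// exprn_even_gt0.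
  by move: k0; rewrite kE pmulr_rge0.
have q21 : 0 < bil M u2 u2 / bil M u1 u1.
  rewrite (_ : _ / _ = bil M u1 u1 * bil M u2 u2 * (bil M u1 u1)^-1 ^+ 2); last by field.
  by rewrite mulr_gt0// exprn_even_gt0//= invr_eq0.
(* [kap] rescales the second height so that the orbits become circles. *)
pose kap := Num.sqrt (bil M u2 u2 / bil M u1 u1).
have kap2 : kap ^+ 2 = bil M u2 u2 / bil M u1 u1 by rewrite sqr_sqrtr// ltW.
have kap0 : kap != 0 by rewrite gt_eqF// sqrtr_gt0.
pose c := k1 / (2 * kap).
have c2 : c ^+ 2 = k1 * k2 / 4.
  have -> : c ^+ 2 = k1 ^+ 2 / (4 * kap ^+ 2) by rewrite /c; field.
  by rewrite kap2 kE /k1 bC; field; rewrite q1 q2.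
have c21 : c ^+ 2 < 1 by rewrite c2 ltr_pdivrMr// mul1r.
have c1 : -1 <= c <= 1.
  by rewrite -ler_norml -(ler_pXn2r (n := 2))// ?nnegrE// expr1n real_normK ?num_real// ltW.
pose th := acos c; have cth : cos th = c by rewrite acosK.
apply: (rotation_zero q1 q2 bL anti1 anti2 (kap := kap) (th := th)) => //.
- have := cos2Dsin2 th; rewrite cth => e; apply: contraTneq c21 => s0.
  by move: e; rewrite s0 expr0n addr0 => ->; rewrite ltxx.
- by rewrite cth /c -/k1; field.
- rewrite cth /c -/k2 (_ : 2 * _ / kap = k1 / kap ^+ 2); last by field.
  by rewrite kap2 /k1 /k2 bC -/b; field; rewrite q1 q2.
move=> n p n0; apply/negP => /eqP e.
have n0' : n%:R != 0 :> R by rewrite pnatr_eq0 -lt0n.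
apply: (res_cos th _ _ (p%:~R / n%:R)).
- rewrite cth c2 kE; field; rewrite ?q1 ?q2//.
- by rewrite cth lt_eqF.
rewrite fmorph_div/= ratr_int ratr_nat; apply: (mulfI n0').
rewrite [RHS]mulrC -mulrA divfK//; move: e; rewrite mulr_natl; lra.
Qed.

End two_directions.

(** * Uniqueness from two hyperplanes *)

Theorem theorem1p4 (R : realType) (d : nat) (hd : (2 <= d)%N)
    (Q : mpoly.mpoly d R) (hQ : quadratic_form Q) (v : 'rV[R]_d) (rho : R) :
  exists E : set ('rV[R]_d * 'rV[R]_d),
    [/\ E `<=` sphere R d `*` sphere R d,
        (surface_measure R d \x surface_measure R d)%E.-negligible E &
        forall u1 u2 : 'rV[R]_d,
          sphere R d u1 -> sphere R d u2 -> u1 <> u2 -> u1 <> - u2 ->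
          evalv Q u1 <> 0 -> evalv Q u2 <> 0 -> ~ E (u1, u2) ->
          forall mu : {charge set (borel_rV R d) -> \bar R},
            solves (quadratic_poly Q v rho) (fourier mu) ->
            (forall x, hyperplane u1 x -> fourier mu x = 0) ->
            (forall x, hyperplane u2 x -> fourier mu x = 0) ->
            forall x, fourier mu x = 0].
Proof.
have [M MT QM] := quadratic_form_bil hQ; exists (exceptional M).
split; first by move=> p [].
  exact: negligible_exceptional.
move=> u1 u2 s1 s2 u12 u12' /eqP q1 /eqP q2 nE mu sP z1 z2 xi.
rewrite QM in q1; rewrite QM in q2.
have bL := bounded_convergence_charge mu.
have carried (f : borel_rV R d -> R) : bounded_measurable f ->
    charge_integral mu (fun x => (quadric M v rho x != 0)%:R * f x) = 0.
  move=> bf; rewrite -[RHS](solves_carried sP bf); congr charge_integral.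
  by apply/funext => x; rewrite (evalv_quadratic_poly v rho x QM).
have anti u (su : sphere R d u) (qu : bil M u u != 0) :
    (forall x, hyperplane u x -> fourier mu x = 0) ->
    forall f : borel_rV R d -> R, bounded_measurable f ->
    charge_integral mu (f \o reflect_along M v u) = - charge_integral mu f.
  move=> z f bf.
  apply: (reflection_anti_invariant MT bL carried (sphere_dotv su) qu) => //.
  by move=> x /z; rewrite /fourier /complex_integral/= => -[-> ->].
have Z := not_resonant_zero MT bL s1 s2 u12 u12' q1 q2 _ (anti _ s1 q1 z1) (anti _ s2 q2 z2).
rewrite /fourier /complex_integral/= !Z//; do ?[exact: bounded_cos_dotv|exact: bounded_sin_dotv].
all: by move=> n h; apply: nE; split=> //; exists n.
Qed.
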